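(* Let $\kappa$ be an infinite regular cardinal. Then $\kappa$ is $\omega$-Ramsey if and only if $\kappa$ is uncountable, $\kappa=\kappa^{<\kappa}$, and $\kappa$ has the well-founded $\omega$-filter property.
   Context: The background theory is ZFC. A weak $\kappa$-model is a (not necessarily transitive) set $M$ of size $\kappa$ with $\kappa+1\subseteq M$ and $\langle M,\in\rangle\models\mathrm{ZFC}^-$ (ZFC without power set, with the collection scheme). It is a $\kappa$-model if also $M^{<\kappa}\subseteq M$. An elementary embedding $j\colon M\to N$ (where $N$ is a set with the true membership relation) is $\kappa$-powerset preserving if it has critical point $\kappa$ and $\mathcal P(\kappa)\cap M=\mathcal P(\kappa)\cap N$. $\kappa$ is $\omega$-Ramsey if for arbitrarily large (i.e. unboundedly many) regular cardinals $\theta$, every $A\subseteq\kappa$ is an element of some weak $\kappa$-model $M\prec H(\theta)$ for which there exists a $\kappa$-powerset preserving elementary embedding $j\colon M\to N$. A filter on $\kappa$ is a set $F\subseteq\mathcal P(\kappa)$ such that the intersection of any finitely many elements of $F$ has size $\kappa$. $F$ measures $X\subseteq\mathcal P(\kappa)$ if for every $A\in X$, $A\in F$ or $\kappa\setminus A\in F$. For a set $M$, a filter $F$ on $\kappa$ is $M$-normal if it measures $\mathcal P(\kappa)\cap M$ and $\{\alpha<\kappa\mid\alpha\in\bigcap_{\beta<\alpha}X_\beta\}\in F$ whenever $\langle X_\beta\mid\beta<\kappa\rangle\in M$ is a sequence of elements of $F$. Game $wfG^\theta_\gamma(\kappa)$, for regular uncountable cardinals $\kappa=\kappa^{<\kappa}<\theta$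 and an ordinal $\gamma\le\kappa^+$: a game of perfect information in which two players, the challenger and the judge, take turns to play $\subseteq$-increasing sequences $\langle M_\xi\mid\xi<\gamma\rangle$ of $\kappa$-models and $\langle F_\xi\mid\xi<\gamma\rangle$ of filters on $\kappa$. At stage $\xi<\gamma$ the challenger plays $M_\xi$ and then the judge plays $F_\xi$, subject to: $M_\xi\prec H(\theta)$; $\langle M_{\eta}\mid\eta<\xi\rangle$ and $\langle F_{\eta}\cap M_{\eta}\mid\eta<\xi\rangle$ are elements of $M_\xi$; $F_\xi$ is a filter on $\kappa$ that measures $\mathcal P(\kappa)\cap M_\xi$; $F_\xi\supseteq\bigcup_{\eta<\xi}F_\eta$. (As usual, a player who cannot make a legal move loses.) Let $M_\gamma=\bigcup_{\xi<\gamma}M_\xi$ and $F_\gamma=\bigcup_{\xi<\gamma}F_\xi$. The judge wins if $F_\gamma$ is an $M_\gamma$-normal filter and the ultrapower of $M_\gamma$ by $F_\gamma$ (formed with functions on $\kappa$ that are elements of $M_\gamma$) is well-founded; otherwise the challenger wins. For uncountable $\kappa=\kappa^{<\kappa}$, $\kappa$ has the well-founded $\gamma$-filter property if for every regular $\theta>\kappa$ the challenger does not have a winning strategy in $wfG^\theta_\gamma(\kappa)$.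
   Formalization: κ-powerset preserving also requires that every x∈N whose elements in N all lie in κ be a subset of κ (automatic for transitive N); without it, for non-transitive N, the equation P(κ)∩M=P(κ)∩N could be met for any weakly compact κ and the equivalence would fail. *)

(* Defs.v *)
(* Plain Stdlib development: set theory inside an arbitrary universe of sets.

   [ZFC] is the type of universes of sets.  As usual for set theory in a
   higher-order metatheory, the "definite properties" of Separation and
   Replacement are the predicates of the metatheory.  Satisfaction in a set
   structure <M, in>, by contrast, is satisfaction of first-order formulas
   ([form], [sat]). *)

From Stdlib Require Import ClassicalEpsilon.

Declare Scope zset_scope.
Delimit Scope zset_scope with zset.
Local Open Scope zset_scope.

Reserved Notation "x ∈ y" (at level 70, no associativity).
Reserved Notation "x ⊆ y" (at level 70, no associativity).

Record ZFC : Type := {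
  set :> Type;
  mem : set -> set -> Prop where "x ∈ y" := (mem x y);
  extensionality : forall x y, (forall z, z ∈ x <-> z ∈ y) -> x = y;
  foundation : forall x, (exists y, y ∈ x) ->
    exists y, y ∈ x /\ forall z, z ∈ y -> ~ z ∈ x;
  pairing : forall a b, exists p, forall z, z ∈ p <-> z = a \/ z = b;
  union : forall x, exists u, forall z, z ∈ u <-> exists y, y ∈ x /\ z ∈ y;
  power_set : forall x, exists p, forall y,
    y ∈ p <-> forall z, z ∈ y -> z ∈ x;
  infinity : exists w,
    (exists e, e ∈ w /\ forall z, ~ z ∈ e) /\
    (forall n, n ∈ w ->
       exists s, s ∈ w /\ forall z, z ∈ s <-> z ∈ n \/ z = n);
  separation : forall (P : set -> Prop) a, exists b, forall x,
    x ∈ b <-> x ∈ a /\ P x;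
  replacement : forall (R : set -> set -> Prop) a,
    (forall x y z, x ∈ a -> R x y -> R x z -> y = z) ->
    exists b, forall y, y ∈ b <-> exists x, x ∈ a /\ R x y;
  choice : forall a,
    (forall x, x ∈ a -> exists z, z ∈ x) ->
    (forall x y z, x ∈ a -> y ∈ a -> z ∈ x -> z ∈ y -> x = y) ->
    exists c, forall x, x ∈ a -> exists! z, z ∈ x /\ z ∈ c
}.

Arguments mem {z} _ _.

Notation "x ∈ y" := (mem x y) : zset_scope.
Notation "x ⊆ y" := (forall z, z ∈ x -> z ∈ y) : zset_scope.

Lemma ZFC_inhabited (U : ZFC) : inhabited U.
Proof. destruct (infinity U) as [w _]. exact (inhabits w). Qed.

(* Definite description and class abstraction.  The values are junk when the
   described object, resp. a set with the given elements, does not exist. *)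
Definition the {U : ZFC} (P : U -> Prop) : U := epsilon (ZFC_inhabited U) P.

Definition compr {U : ZFC} (P : U -> Prop) : U :=
  the (fun y => forall x, x ∈ y <-> P x).

Notation "{{ x | P }}" := (compr (fun x => P))
  (at level 0, x name, P at level 200) : zset_scope.
Notation "{{ x 'in' a | P }}" := (compr (fun x => x ∈ a /\ P))
  (at level 0, x name, a at level 69, P at level 200) : zset_scope.

(** * Basic operations *)

Definition upair {U : ZFC} (a b : U) : U := {{ x | x = a \/ x = b }}.
Definition opair {U : ZFC} (a b : U) : U := upair (upair a a) (upair a b).
Notation "⟨ a , b ⟩" := (opair a b)
  (at level 0, a at level 200, b at level 200) : zset_scope.

Definition pow {U : ZFC} (x : U) : U := {{ y | y ⊆ x }}.
Definition cap {U : ZFC} (x y : U) : U := {{ z in x | z ∈ y }}.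
Definition diff {U : ZFC} (x y : U) : U := {{ z in x | ~ z ∈ y }}.

(* [bigcap k a] is the intersection of the family [a] of subsets of [k]; it is
   [k] when [a] is empty. *)
Definition bigcap {U : ZFC} (k a : U) : U :=
  {{ x in k | forall y, y ∈ a -> x ∈ y }}.

(** * Functions as sets of pairs *)

Definition is_function {U : ZFC} (f : U) : Prop :=
  (forall p, p ∈ f -> exists x y, p = ⟨x, y⟩) /\
  (forall x y z, ⟨x, y⟩ ∈ f -> ⟨x, z⟩ ∈ f -> y = z).

Definition in_dom {U : ZFC} (x f : U) : Prop := exists y, ⟨x, y⟩ ∈ f.

Definition fun_on {U : ZFC} (f d : U) : Prop :=
  is_function f /\ forall x, in_dom x f <-> x ∈ d.

Definition app {U : ZFC} (f x : U) : U := the (fun y => ⟨x, y⟩ ∈ f).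

Definition fun_to {U : ZFC} (f d c : U) : Prop :=
  fun_on f d /\ forall x, x ∈ d -> app f x ∈ c.

Definition restr {U : ZFC} (f d : U) : U :=
  {{ p in f | exists x y, x ∈ d /\ p = ⟨x, y⟩ }}.

Definition lam {U : ZFC} (d : U) (F : U -> U) : U :=
  {{ p | exists x, x ∈ d /\ p = ⟨x, F x⟩ }}.

Definition bijection {U : ZFC} (f x y : U) : Prop :=
  fun_to f x y /\
  (forall a b, a ∈ x -> b ∈ x -> app f a = app f b -> a = b) /\
  (forall b, b ∈ y -> exists a, a ∈ x /\ app f a = b).

(** * Ordinals and cardinals *)

Definition transitive {U : ZFC} (x : U) : Prop := forall y, y ∈ x -> y ⊆ x.

(* By Foundation, the von Neumann ordinals are the transitive sets of
   transitive sets. *)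
Definition is_ordinal {U : ZFC} (x : U) : Prop :=
  transitive x /\ forall y, y ∈ x -> transitive y.

Definition equinumerous {U : ZFC} (x y : U) : Prop :=
  exists f, bijection f x y.

Definition is_cardinal {U : ZFC} (k : U) : Prop :=
  is_ordinal k /\ forall a, a ∈ k -> ~ equinumerous a k.

Definition card {U : ZFC} (x : U) : U :=
  the (fun k => is_cardinal k /\ equinumerous x k).

Definition inductive {U : ZFC} (w : U) : Prop :=
  (exists e, e ∈ w /\ forall z, ~ z ∈ e) /\
  (forall n, n ∈ w -> {{ z | z ∈ n \/ z = n }} ∈ w).

Definition omega {U : ZFC} : U := {{ n | forall w, inductive w -> n ∈ w }}.

Definition finite {U : ZFC} (x : U) : Prop := card x ∈ omega.
Definition uncountable {U : ZFC} (x : U) : Prop := omega ∈ card x.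

Definition infinite_cardinal {U : ZFC} (k : U) : Prop :=
  is_cardinal k /\ omega ⊆ k.

Definition regular {U : ZFC} (k : U) : Prop :=
  infinite_cardinal k /\
  forall a f, a ∈ k -> fun_to f a k ->
    exists b, b ∈ k /\ forall x, x ∈ a -> app f x ∈ b.

(* [k^{<k}], the number of functions from some [a < k] into [k]. *)
Definition lt_power {U : ZFC} (k : U) : U :=
  card {{ f | exists a, a ∈ k /\ fun_to f a k }}.

(** * H(theta) *)

Definition trcl {U : ZFC} (x : U) : U :=
  {{ z | forall t, transitive t -> x ⊆ t -> z ∈ t }}.

Definition H {U : ZFC} (theta : U) : U := {{ x | card (trcl x) ∈ theta }}.

(** * First-order logic of set structures *)

(* Formulas with named variables; an environment assigns values to all
   variables, hence also provides the parameters. *)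
Inductive form : Type :=
| fMem : nat -> nat -> form
| fEq : nat -> nat -> form
| fNot : form -> form
| fAnd : form -> form -> form
| fAll : nat -> form -> form.

Definition update {A : Type} (e : nat -> A) (i : nat) (a : A) : nat -> A :=
  fun n => if Nat.eqb n i then a else e n.

(* [sat M e phi]: the structure <M, in> satisfies [phi] under [e]. *)
Fixpoint sat {U : ZFC} (M : U) (e : nat -> U) (phi : form) : Prop :=
  match phi with
  | fMem i j => e i ∈ e j
  | fEq i j => e i = e j
  | fNot p => ~ sat M e p
  | fAnd p q => sat M e p /\ sat M e q
  | fAll i p => forall x, x ∈ M -> sat M (update e i x) p
  end.

Definition env_in {U : ZFC} (M : U) (e : nat -> U) : Prop :=
  forall n, e n ∈ M.

Definition elem_sub {U : ZFC} (M N : U) : Prop :=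
  M ⊆ N /\ forall phi e, env_in M e -> (sat M e phi <-> sat N e phi).

Definition elem_embedding {U : ZFC} (j M N : U) : Prop :=
  fun_to j M N /\
  forall phi e, env_in M e ->
    (sat M e phi <-> sat N (fun n => app j (e n)) phi).

(** * Models of ZFC without power set *)

(* The three definitions below are the usual notions relativized to <M, in>;
   M need not be transitive. *)
Definition upair_in {U : ZFC} (M p a b : U) : Prop :=
  forall z, z ∈ M -> (z ∈ p <-> z = a \/ z = b).

Definition rel_in {U : ZFC} (M r a b : U) : Prop :=
  exists p s t, p ∈ M /\ s ∈ M /\ t ∈ M /\ p ∈ r /\
    upair_in M s a a /\ upair_in M t a b /\ upair_in M p s t.

Definition well_orders_in {U : ZFC} (M r x : U) : Prop :=
  (forall a, a ∈ M -> a ∈ x -> ~ rel_in M r a a) /\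
  (forall a b c, a ∈ M -> b ∈ M -> c ∈ M -> a ∈ x -> b ∈ x -> c ∈ x ->
     rel_in M r a b -> rel_in M r b c -> rel_in M r a c) /\
  (forall a b, a ∈ M -> b ∈ M -> a ∈ x -> b ∈ x ->
     rel_in M r a b \/ a = b \/ rel_in M r b a) /\
  (forall y, y ∈ M -> (forall z, z ∈ M -> z ∈ y -> z ∈ x) ->
     (exists z, z ∈ M /\ z ∈ y) ->
     exists a, a ∈ M /\ a ∈ y /\
       forall z, z ∈ M -> z ∈ y -> ~ rel_in M r z a).

(* Choice is taken as the well-ordering principle, as is standard in the
   absence of Power Set. *)
Record models_ZFCminus {U : ZFC} (M : U) : Prop := {
  zm_extensionality : forall x y, x ∈ M -> y ∈ M ->
    (forall z, z ∈ M -> (z ∈ x <-> z ∈ y)) -> x = y;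
  zm_foundation : forall x, x ∈ M -> (exists y, y ∈ M /\ y ∈ x) ->
    exists y, y ∈ M /\ y ∈ x /\ forall z, z ∈ M -> z ∈ y -> ~ z ∈ x;
  zm_pairing : forall a b, a ∈ M -> b ∈ M ->
    exists p, p ∈ M /\ upair_in M p a b;
  zm_union : forall x, x ∈ M -> exists u, u ∈ M /\
    forall z, z ∈ M -> (z ∈ u <-> exists y, y ∈ M /\ y ∈ x /\ z ∈ y);
  zm_infinity : exists w, w ∈ M /\
    (exists e, e ∈ M /\ e ∈ w /\ forall z, z ∈ M -> ~ z ∈ e) /\
    (forall n, n ∈ M -> n ∈ w -> exists s, s ∈ M /\ s ∈ w /\
       forall z, z ∈ M -> (z ∈ s <-> z ∈ n \/ z = n));
  (* In the two schemes the variable 0 (and 1) ranges over the elements of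
     [a] (and their witnesses), and [e] supplies the parameters. *)
  zm_separation : forall phi e a, env_in M e -> a ∈ M ->
    exists b, b ∈ M /\
      forall x, x ∈ M -> (x ∈ b <-> x ∈ a /\ sat M (update e 0 x) phi);
  zm_collection : forall phi e a, env_in M e -> a ∈ M ->
    (forall x, x ∈ M -> x ∈ a ->
       exists y, y ∈ M /\ sat M (update (update e 0 x) 1 y) phi) ->
    exists b, b ∈ M /\
      forall x, x ∈ M -> x ∈ a ->
        exists y, y ∈ M /\ y ∈ b /\ sat M (update (update e 0 x) 1 y) phi;
  zm_well_ordering : forall x, x ∈ M -> exists r, r ∈ M /\ well_orders_in M r x
}.

Definition weak_model {U : ZFC} (k M : U) : Prop :=
  card M = k /\ k ⊆ M /\ k ∈ M /\ models_ZFCminus M.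

Definition kappa_model {U : ZFC} (k M : U) : Prop :=
  weak_model k M /\ forall f a, a ∈ k -> fun_to f a M -> f ∈ M.

(** * omega-Ramsey cardinals *)

(* [k] is the least ordinal of [M] that is moved by [j]. *)
Definition critical_point {U : ZFC} (j M k : U) : Prop :=
  is_ordinal k /\ k ∈ M /\ app j k <> k /\
  forall a, a ∈ M -> a ∈ k -> app j a = a.

(* N need not be transitive.  The last clause says that the sets which
   <N, in> takes for subsets of [k] are subsets of [k], so that the previous
   clause does speak about all "subsets of [k] in N"; it is automatic for
   transitive N.  Without it every embedding with critical point [k] could be
   made powerset preserving, by replacing N with an isomorphic copy in which
   each unwanted subset of [k] has an additional element outside of the copy. *)
Definition powerset_preserving {U : ZFC} (k j M N : U) : Prop :=
  critical_point j M k /\ cap (pow k) M = cap (pow k) N /\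
  (forall x, x ∈ N -> (forall z, z ∈ N -> z ∈ x -> z ∈ k) -> x ⊆ k).

Definition omega_Ramsey {U : ZFC} (k : U) : Prop :=
  forall lambda : U, is_ordinal lambda ->
  exists theta, lambda ∈ theta /\ regular theta /\
  forall A, A ⊆ k ->
  exists M, weak_model k M /\ elem_sub M (H theta) /\ A ∈ M /\
  exists N j, elem_embedding j M N /\ powerset_preserving k j M N.

(** * Filters *)

Definition filter {U : ZFC} (k F : U) : Prop :=
  F ⊆ pow k /\
  forall a, a ⊆ F -> finite a -> card (bigcap k a) = k.

Definition measures {U : ZFC} (k F X : U) : Prop :=
  forall A, A ∈ X -> A ∈ F \/ diff k A ∈ F.

Definition normal_filter {U : ZFC} (k M F : U) : Prop :=
  filter k F /\ measures k F (cap (pow k) M) /\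
  forall X, X ∈ M -> fun_on X k -> (forall b, b ∈ k -> app X b ∈ F) ->
    {{ a in k | forall b, b ∈ a -> a ∈ app X b }} ∈ F.

(** * Ultrapowers *)

Definition ult_fun {U : ZFC} (k M f : U) : Prop := f ∈ M /\ fun_on f k.

Definition ult_class {U : ZFC} (k M F f : U) : U :=
  {{ g | ult_fun k M g /\ {{ a in k | app f a = app g a }} ∈ F }}.

Definition ultrapower {U : ZFC} (k M F : U) : U :=
  {{ c | exists f, ult_fun k M f /\ c = ult_class k M F f }}.

Definition ult_mem {U : ZFC} (k M F c d : U) : Prop :=
  exists f g, ult_fun k M f /\ ult_fun k M g /\
    c = ult_class k M F f /\ d = ult_class k M F g /\
    {{ a in k | app f a ∈ app g a }} ∈ F.

Definition well_founded_ultrapower {U : ZFC} (k M F : U) : Prop :=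
  forall S, S ⊆ ultrapower k M F -> (exists c, c ∈ S) ->
    exists c, c ∈ S /\ forall d, d ∈ S -> ~ ult_mem k M F d c.

(** * The game wfG^theta_gamma(kappa) *)

(* [Ms] and [Fs] are the sequences of the moves of the challenger and of the
   judge at the stages below [xi]; [M] is a candidate for the challenger's move
   at stage [xi], and [F] for the judge's answer to [M]. *)
Definition challenger_legal {U : ZFC} (k theta xi Ms Fs M : U) : Prop :=
  kappa_model k M /\ elem_sub M (H theta) /\
  (forall eta, eta ∈ xi -> app Ms eta ⊆ M) /\
  Ms ∈ M /\ lam xi (fun eta => cap (app Fs eta) (app Ms eta)) ∈ M.

Definition judge_legal {U : ZFC} (k xi Fs M F : U) : Prop :=
  filter k F /\ measures k F (cap (pow k) M) /\
  forall eta, eta ∈ xi -> app Fs eta ⊆ F.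

Definition legal_run {U : ZFC} (k theta xi Ms Fs : U) : Prop :=
  fun_on Ms xi /\ fun_on Fs xi /\
  forall eta, eta ∈ xi ->
    challenger_legal k theta eta (restr Ms eta) (restr Fs eta) (app Ms eta) /\
    judge_legal k eta (restr Fs eta) (app Ms eta) (app Fs eta).

Definition seq_union {U : ZFC} (xi s : U) : U :=
  {{ x | exists eta, eta ∈ xi /\ x ∈ app s eta }}.

Definition judge_wins {U : ZFC} (k gamma Ms Fs : U) : Prop :=
  let M := seq_union gamma Ms in
  let F := seq_union gamma Fs in
  normal_filter k M F /\ well_founded_ultrapower k M F.

(* A strategy for the challenger maps a position <Ms, Fs> to a move. *)
Definition follows {U : ZFC} (sigma xi Ms Fs : U) : Prop :=
  forall eta, eta ∈ xi ->
    app Ms eta = app sigma ⟨restr Ms eta, restr Fs eta⟩.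

(* The challenger, playing by [sigma], always has a legal move, and the judge
   wins no run that reaches length [gamma]; in a run that does not reach length
   [gamma] it is then the judge who is stuck, and who loses. *)
Definition challenger_winning {U : ZFC} (k theta gamma sigma : U) : Prop :=
  is_function sigma /\
  (forall xi Ms Fs, xi ∈ gamma -> legal_run k theta xi Ms Fs ->
     follows sigma xi Ms Fs ->
     in_dom ⟨Ms, Fs⟩ sigma /\
     challenger_legal k theta xi Ms Fs (app sigma ⟨Ms, Fs⟩)) /\
  (forall Ms Fs, legal_run k theta gamma Ms Fs ->
     follows sigma gamma Ms Fs -> ~ judge_wins k gamma Ms Fs).

Definition wf_filter_property {U : ZFC} (gamma k : U) : Prop :=
  forall theta, regular theta -> k ∈ theta ->
    ~ exists sigma, challenger_winning k theta gamma sigma.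

(* Main.v *)
From Stdlib Require Import ClassicalEpsilon FunctionalExtensionality.
From Stdlib Require Import PropExtensionality Lia Arith List Cantor.
Require Import Defs.
Import ListNotations.
Local Open Scope zset_scope.

(** From left to right, let [j] map [M] to [N] with critical point [kappa], with [M]
    elementary in [H theta] and the same subsets of [kappa] in [M] and [N]. The derived
    ultrafilter, of the [A] with [kappa] in [j A], is normal for sequences in [M], its
    ultrapower of [M] maps into [N] by [f |-> j f kappa] and hence is well-founded, and
    it is weakly amenable: since [N] has no new subsets of [kappa], its trace on any
    set of size [kappa] in [M] is an element of [M] ([derived_amenable],
    [derived_normal], [value_mem]). So the judge can answer every model [m] in [M]
    with the trace on [m]. If the challenger's strategy is in [M], then the answers and
    the next models stay in [M], and the judge wins ([no_strategy]). It remains to find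
    a winning strategy in [M], given that one exists, although an
    omega-Ramsey cardinal by definition only provides models [M] that contain given
    subsets of [kappa]. This is done by elementarity: some first-order formula over
    [H theta] characterizes the tree of positions of a winning strategy ([strategy_in],
    [strategy_tree]), so if one exists, then one exists in [M]. The play of the judge is
    analysed through that formula instead of the definition of the game.

    Weak amenability also yields [2^a < kappa] for [a < kappa] ([emb_strong_limit]):
    the value of [j s] at [kappa], for an injection [s] from [kappa] to the power set
    of [a], would be fixed by [j] and thus a value that [s] takes at almost all points.
    The functions from some [a < kappa] to [kappa] then are elements of [M], so there
    are only [kappa] many ([emb_lt_power]).

    From right to left, [kappa = kappa^{<kappa}] provides [kappa]-models that are
    elementary in [H theta] and contain given sets ([kappa_model_exists]). Hence the
    challenger always has a move that contains a given [A], and as always playing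
    such moves is not a winning strategy, the judge wins some run of this kind
    ([winning_run]). The ultrapower of the union [M] of the models by the union [F] of
    the filters collapses to a transitive set, and Los's theorem gives the embedding
    ([ult_map_elementary]). By normality the collapse represents each ordinal below
    [kappa] by a constant function and [kappa] by the identity. It has the same subsets
    of [kappa] as [M]: a subset of [kappa] represented by [f] is determined by the
    trace of [F] on [kappa] many sets computed from [f], and the rules make the trace
    of [F] on each model an element of the next one ([ult_map_powerset],
    [filter_property_embedding]).

    Since Separation, Replacement and Foundation hold for arbitrary predicates, the
    natural numbers of the universe are standard, membership is well-founded, and
    class functions are plain functions from [U] to [U]. First-order definability is
    needed only in [H theta], [M] and [N]. There a predicate [P K e] of a structure
    [K] and an environment [e] is called [Dfn] if one formula expresses it in all
    structures; a syntax-directed tactic proves this for relativized predicates. *)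

(** * Sets and classes *)

Section Basics.
Context {U : ZFC}.
Implicit Types a b c x y z : U.

Lemma the_spec (P : U -> Prop) : (exists x, P x) -> P (the P).
Proof. apply epsilon_spec. Qed.

Lemma the_eq (P : U -> Prop) x : P x -> (forall y, P y -> y = x) -> the P = x.
Proof. intros H1 H2. apply H2, the_spec. now exists x. Qed.

Lemma class_choice (P : U -> U -> Prop) a : (forall x, x ∈ a -> exists y, P x y) ->
  exists F, forall x, x ∈ a -> P x (F x).
Proof.
  intros H. exists (fun x => the (P x)). intros x Hx. apply the_spec. auto.
Qed.

Lemma comprE (P : U -> Prop) :
  (exists b, forall x, P x -> x ∈ b) -> forall x, x ∈ {{ x | P x }} <-> P x.
Proof.
  intros [b Hb]. apply (the_spec (fun y => forall x, x ∈ y <-> P x)).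
  destruct (separation U P b) as [c Hc]. exists c. intros x. rewrite Hc.
  split; [tauto | auto].
Qed.

Lemma sepE (P : U -> Prop) a x : x ∈ {{ x in a | P x }} <-> x ∈ a /\ P x.
Proof. apply (comprE (fun x => x ∈ a /\ P x)). exists a. tauto. Qed.

Lemma ext x y : (forall z, z ∈ x <-> z ∈ y) -> x = y.
Proof. apply extensionality. Qed.

Lemma compr_eq (P : U -> Prop) b : (forall x, x ∈ b <-> P x) -> {{ x | P x }} = b.
Proof.
  intros Hb. apply ext. intros z. rewrite comprE, Hb; [tauto|].
  exists b. intros x. apply Hb.
Qed.

Lemma compr_ext (P Q : U -> Prop) :
  (forall x, P x <-> Q x) -> {{ x | P x }} = {{ x | Q x }}.
Proof.
  intros HPQ. f_equal. apply functional_extensionality. intros x.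
  apply propositional_extensionality, HPQ.
Qed.

Lemma upairE a b x : x ∈ upair a b <-> x = a \/ x = b.
Proof.
  apply comprE. destruct (pairing U a b) as [p Hp]. exists p. intros z.
  apply Hp.
Qed.

Lemma upair_inj_l a b c : upair a b = upair a c -> b = c.
Proof.
  intros E. assert (H1 : b ∈ upair a c) by (rewrite <- E; apply upairE; auto).
  assert (H2 : c ∈ upair a b) by (rewrite E; apply upairE; auto).
  rewrite upairE in H1, H2. intuition congruence.
Qed.

Lemma opair_inj a b c d : ⟨a, b⟩ = ⟨c, d⟩ -> a = c /\ b = d.
Proof.
  unfold opair. intros E.
  assert (Ha : a = c).
  { assert (H1 : upair a a ∈ upair (upair c c) (upair c d))
      by (rewrite <- E; apply upairE; auto).
    rewrite upairE in H1.
    assert (H2 : c ∈ upair a a)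
      by (destruct H1 as [-> | ->]; apply upairE; auto).
    rewrite upairE in H2. destruct H2; congruence. }
  split; [exact Ha|]. subst c.
  now apply upair_inj_l, upair_inj_l in E.
Qed.

Lemma powE x y : y ∈ pow x <-> y ⊆ x.
Proof.
  apply (comprE (fun y => y ⊆ x)). destruct (power_set U x) as [p Hp].
  exists p. intros z. apply Hp.
Qed.

Lemma capE x y z : z ∈ cap x y <-> z ∈ x /\ z ∈ y.
Proof. apply (sepE (fun w => w ∈ y)). Qed.

Lemma diffE x y z : z ∈ diff x y <-> z ∈ x /\ ~ z ∈ y.
Proof. apply (sepE (fun z => ~ z ∈ y)). Qed.

Definition empty : U := {{ x | False }}.

Lemma emptyE x : x ∈ empty <-> False.
Proof. apply (comprE (fun _ => False)). destruct (ZFC_inhabited U) as [b]. exists b. tauto. Qed.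

Definition img (F : U -> U) a : U := {{ y | exists x, x ∈ a /\ y = F x }}.

Lemma imgE F a y : y ∈ img F a <-> exists x, x ∈ a /\ y = F x.
Proof.
  apply comprE. destruct (replacement U (fun x y => y = F x) a) as [b Hb].
  - congruence.
  - exists b. intros z. apply Hb.
Qed.

Lemma img_in F a x : x ∈ a -> F x ∈ img F a.
Proof. intros H. apply imgE. eauto. Qed.

Definition fam a (F : U -> U) : U := {{ z | exists x, x ∈ a /\ z ∈ F x }}.

Lemma famE F a z : z ∈ fam a F <-> exists x, x ∈ a /\ z ∈ F x.
Proof.
  apply (comprE (fun z => exists x, x ∈ a /\ z ∈ F x)).
  destruct (union U (img F a)) as [u Hu]. exists u.
  intros w (x & Hx & Hw). apply Hu. exists (F x). split; [now apply img_in|auto].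
Qed.

Definition bigU a : U := fam a (fun x => x).
Definition un a b : U := bigU (upair a b).
Definition sing a : U := upair a a.
Definition succ a : U := {{ z | z ∈ a \/ z = a }}.

Lemma bigUE a z : z ∈ bigU a <-> exists x, x ∈ a /\ z ∈ x.
Proof. apply famE. Qed.

Lemma unE a b z : z ∈ un a b <-> z ∈ a \/ z ∈ b.
Proof.
  unfold un. rewrite bigUE. split.
  - intros (x & H1 & H2). rewrite upairE in H1. destruct H1; subst; auto.
  - intros [H1|H1]; [exists a|exists b]; rewrite upairE; auto.
Qed.

Lemma singE a z : z ∈ sing a <-> z = a.
Proof. unfold sing. rewrite upairE. tauto. Qed.

Lemma succE a z : z ∈ succ a <-> z ∈ a \/ z = a.
Proof.
  apply (comprE (fun z => z ∈ a \/ z = a)). exists (un a (sing a)).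
  intros x. rewrite unE, singE. tauto.
Qed.

Definition prod a b : U := fam a (fun x => img (fun y => ⟨x, y⟩) b).

Lemma prodE a b p : p ∈ prod a b <-> exists x y, x ∈ a /\ y ∈ b /\ p = ⟨x, y⟩.
Proof.
  unfold prod. rewrite famE. split.
  - intros (x & Hx & Hp). apply imgE in Hp as (y & Hy & E). eauto 6.
  - intros (x & y & Hx & Hy & ->). exists x. split; auto.
    apply (img_in (fun y => ⟨x, y⟩)); auto.
Qed.

Lemma prod_in a b x y : ⟨x, y⟩ ∈ prod a b <-> x ∈ a /\ y ∈ b.
Proof.
  rewrite prodE. split; [|intros [Hx Hy]; now exists x, y].
  intros (x' & y' & Hx & Hy & E). apply opair_inj in E as [-> ->]. auto.
Qed.

Lemma no_self x : ~ x ∈ x.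
Proof.
  intros H. destruct (foundation U (sing x)) as (y & Hy & Hm).
  - exists x. now apply singE.
  - apply singE in Hy as ->. apply (Hm x H). now apply singE.
Qed.

(** * The natural numbers *)

Fixpoint num (n : nat) : U := match n with 0 => empty | S n => succ (num n) end.

(** Separation for arbitrary predicates leaves no room for nonstandard natural numbers. *)
Lemma omegaE x : x ∈ omega <-> exists n, x = num n.
Proof.
  unfold omega. rewrite comprE.
  - split.
    + intros Hx.
      destruct (infinity U) as (w & [e [He Hemp]] & Hw).
      assert (Hi : inductive {{ z in w | exists n, z = num n }}).
      { assert (E : e = empty)
          by (apply ext; intros z; rewrite emptyE; split; [apply Hemp|tauto]).
        split.
        - exists empty. split; [|intros z; rewrite emptyE; tauto].
          apply (sepE (fun z => exists n, z = num n)). split; [congruence|].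
          now exists 0.
        - intros n Hn. apply (sepE (fun z => exists n, z = num n)) in Hn as [Hn [m ->]].
          apply (sepE (fun z => exists n, z = num n)). split.
          + destruct (Hw _ Hn) as (s & Hs & Es).
            change (succ (num m) ∈ w). assert (s = succ (num m)) as <-; auto.
            apply ext. intros z. rewrite Es, succE. tauto.
          + now exists (S m). }
      apply Hx, (sepE (fun z => exists n, z = num n)) in Hi. tauto.
    + intros [n ->] w [[e [He Hemp]] Hw]. induction n as [|n IH]; simpl.
      * assert (e = empty) as <-; auto.
        apply ext; intros z; rewrite emptyE; split; [apply Hemp|tauto].
      * now apply Hw in IH.
  - destruct (infinity U) as (w & H0 & Hw). exists w. intros x0 H1. apply H1.
    split; auto. intros n Hn. destruct (Hw n Hn) as (s & Hs & Es).
    assert ({{z | z ∈ n \/ z = n}} = s) as ->; auto. now apply compr_eq.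
Qed.

Lemma num_omega n : num n ∈ omega.
Proof. apply omegaE. eauto. Qed.

Lemma num_lt n x : x ∈ num n <-> exists m, m < n /\ x = num m.
Proof.
  induction n as [|n IH]; simpl.
  - rewrite emptyE. split; [tauto|]. intros (m & H & _). lia.
  - rewrite succE, IH. split.
    + intros [(m & Hm & ->)| ->]; [exists m|exists n]; split; auto.
    + intros (m & Hm & ->). destruct (Nat.eq_dec m n) as [->|]; [auto|].
      left. exists m. split; auto. lia.
Qed.

Lemma num_inj m n : num m = num n -> m = n.
Proof.
  intros E. destruct (lt_eq_lt_dec m n) as [[H|H]|H]; auto; exfalso.
  - apply (no_self (num n)). rewrite <- E at 1. apply num_lt. eauto.
  - apply (no_self (num m)). rewrite E at 1. apply num_lt. eauto.
Qed.

Definition unnum x : nat := epsilon (inhabits 0) (fun n => x = num n).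

Lemma unnumK n : unnum (num n) = n.
Proof.
  apply num_inj. symmetry.
  apply (epsilon_spec (inhabits 0) (fun m => num n = num m)). eauto.
Qed.

Definition range (f : nat -> U) : U := img (fun x => f (unnum x)) omega.

Lemma rangeE f y : y ∈ range f <-> exists n, y = f n.
Proof.
  unfold range. rewrite imgE. split.
  - intros (x & _ & ->). eauto.
  - intros [n ->]. exists (num n). rewrite unnumK. split; auto using num_omega.
Qed.

Lemma fam_omegaE (f : U -> U) x : x ∈ fam omega f <-> exists n, x ∈ f (num n).
Proof.
  rewrite famE. split.
  - intros (i & Hi & Hx). apply omegaE in Hi as [n ->]. eauto.
  - intros [n Hn]. exists (num n). auto using num_omega.
Qed.

(** * Transitive closure, induction and recursion along membership *)

Definition tclose x : U :=
  bigU (range (fix T n := match n with 0 => x | S n => bigU (T n) end)).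

Lemma trcl_exists x : x ⊆ tclose x /\ transitive (tclose x).
Proof.
  unfold tclose. set (T := fix T n := match n with 0 => x | S n => bigU (T n) end).
  split.
  - intros z Hz. apply bigUE. exists (T 0). split; auto. apply rangeE. eauto.
  - intros y Hy z Hz. apply bigUE in Hy as (t & Ht & Hy).
    apply rangeE in Ht as [n ->]. apply bigUE. exists (T (S n)). split.
    + apply rangeE. eauto.
    + simpl. apply bigUE. eauto.
Qed.

Lemma trclE x z : z ∈ trcl x <-> forall t, transitive t -> x ⊆ t -> z ∈ t.
Proof.
  apply (comprE (fun z => forall t, transitive t -> x ⊆ t -> z ∈ t)).
  exists (tclose x). intros y Hy. destruct (trcl_exists x) as [H1 H2]. now apply Hy.
Qed.

Lemma trcl_trans x : transitive (trcl x).
Proof.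
  intros y Hy z Hz. rewrite trclE in *. intros t Ht Hx.
  apply (Ht y); auto.
Qed.

Lemma trcl_sub x : x ⊆ trcl x.
Proof. intros z Hz. apply trclE. auto. Qed.

Lemma trcl_least x t : transitive t -> x ⊆ t -> trcl x ⊆ t.
Proof. intros Ht Hx z Hz. rewrite trclE in Hz. auto. Qed.

(** Foundation yields a minimal point among the inaccessible members of a transitive set. *)
Lemma mem_wf : well_founded (@mem U).
Proof.
  intros x. apply NNPP. intros Hx.
  destruct (foundation U {{ z in trcl (sing x) | ~ Acc mem z }}) as (y & Hy & Hm).
  - exists x. apply (sepE (fun z => ~ Acc mem z)). split; auto.
    apply trcl_sub. now apply singE.
  - apply (sepE (fun z => ~ Acc mem z)) in Hy as [Hy Hn]. apply Hn. constructor.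
    intros z Hz. apply NNPP. intros Hz'. apply (Hm z Hz).
    apply (sepE (fun z => ~ Acc mem z)). split; auto. now apply trcl_trans in Hy; apply Hy.
Qed.

(** Recursion along a well-founded relation; [G] is handed the previously
    defined values, and [empty] for all other arguments. *)
Definition wfrec {A : Type} {R : A -> A -> Prop} (wf : well_founded R)
  (G : A -> (A -> U) -> U) : A -> U :=
  Fix wf (fun _ => U) (fun (x : A) rec => G x (fun (y : A) =>
    match excluded_middle_informative (R y x) with
    | left h => rec y h | right _ => empty end)).

Lemma wfrec_eq {A : Type} {R : A -> A -> Prop} (wf : well_founded R)
    (G : A -> (A -> U) -> U) (x : A) :
  wfrec wf G x = G x (fun y : A =>
    if excluded_middle_informative (R y x) then wfrec wf G y else empty).
Proof.
  unfold wfrec at 1. rewrite Fix_eq; [reflexivity|].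
  intros y f g Hfg. f_equal. apply functional_extensionality. intros z.
  destruct (excluded_middle_informative (R z y)); auto.
Qed.

(** * Ordinals *)

Lemma ord_in x y : is_ordinal x -> y ∈ x -> is_ordinal y.
Proof.
  intros [H1 H2] Hy. split; [now apply H2|]. intros z Hz. apply H2.
  now apply (H1 y).
Qed.

Lemma ord_trans x y z : is_ordinal x -> y ∈ x -> z ∈ y -> z ∈ x.
Proof. intros [H _] Hy Hz. now apply (H y). Qed.

Lemma ord_total x y : is_ordinal x -> is_ordinal y -> x ∈ y \/ x = y \/ y ∈ x.
Proof.
  revert y. induction x as [x IHx] using (well_founded_induction mem_wf).
  intros y. induction y as [y IHy] using (well_founded_induction mem_wf).
  intros Hx Hy.
  destruct (classic (exists u, u ∈ x /\ ~ u ∈ y)) as [(u & Hu & Hn)|N1].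
  { destruct (IHx u Hu y (ord_in _ _ Hx Hu) Hy) as [H|[->|H]]; [tauto|auto|].
    right; right. now apply (ord_trans x u). }
  destruct (classic (exists u, u ∈ y /\ ~ u ∈ x)) as [(u & Hu & Hn)|N2].
  { destruct (IHy u Hu Hx (ord_in _ _ Hy Hu)) as [H|[->|H]]; [|auto|tauto].
    left. now apply (ord_trans y u). }
  right; left. apply ext. intros z. split; intros Hz; apply NNPP; eauto.
Qed.

Lemma ord_sub x y : is_ordinal x -> is_ordinal y -> (x ⊆ y <-> x ∈ y \/ x = y).
Proof.
  intros Hx Hy. split.
  - intros Hs. destruct (ord_total x y Hx Hy) as [H|[H|H]]; auto.
    exfalso. apply (no_self y); auto.
  - intros [H| ->]; auto. intros z Hz. now apply (ord_trans y x).
Qed.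

Lemma ord_nsub x y : is_ordinal x -> is_ordinal y -> ~ x ∈ y -> y ⊆ x.
Proof.
  intros Hx Hy Hn. apply ord_sub; auto.
  destruct (ord_total x y Hx Hy) as [|[|]]; auto; tauto.
Qed.

Lemma ord_succ x : is_ordinal x -> is_ordinal (succ x).
Proof.
  intros [H1 H2]. split.
  - intros y Hy z Hz. rewrite succE in *. destruct Hy as [Hy| ->]; auto.
    left. now apply (H1 y).
  - intros y Hy. rewrite succE in Hy. destruct Hy as [Hy| ->]; auto.
Qed.

Lemma ord_bigU a : (forall x, x ∈ a -> is_ordinal x) -> is_ordinal (bigU a).
Proof.
  intros Ha. split.
  - intros y Hy z Hz. apply bigUE in Hy as (x & Hx & Hy). apply bigUE.
    exists x. split; auto. now apply (ord_trans x y); auto.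
  - intros y Hy. apply bigUE in Hy as (x & Hx & Hy).
    now apply (Ha x Hx).
Qed.

Lemma ord_num n : is_ordinal (num n).
Proof.
  induction n as [|n IH]; [|now apply ord_succ].
  split; intros y Hy; apply emptyE in Hy; tauto.
Qed.

Lemma ord_omega : is_ordinal (omega : U).
Proof.
  split.
  - intros y Hy z Hz. apply omegaE in Hy as [n ->]. apply num_lt in Hz as (m & _ & ->).
    apply num_omega.
  - intros y Hy. apply omegaE in Hy as [n ->]. apply ord_num.
Qed.

Lemma ord_least (P : U -> Prop) :
  (exists x, is_ordinal x /\ P x) ->
  exists x, is_ordinal x /\ P x /\ forall y, y ∈ x -> ~ P y.
Proof.
  intros [x [Hx Px]]. revert Hx Px.
  induction x as [x IH] using (well_founded_induction mem_wf). intros Hx Px.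
  destruct (classic (exists y, y ∈ x /\ P y)) as [(y & Hy & Py)|N].
  - exact (IH y Hy (ord_in _ _ Hx Hy) Py).
  - exists x. split; [|split]; auto. intros y Hy Py. apply N. eauto.
Qed.

(** Burali-Forti: the set of all ordinals would be an ordinal, hence an element of itself. *)
Lemma no_ordinal_set : ~ exists b : U, forall x, is_ordinal x -> x ∈ b.
Proof.
  intros [b Hb]. set (o := {{ x in b | is_ordinal x }}).
  assert (Ho : forall x, x ∈ o <-> is_ordinal x).
  { intros x. unfold o. rewrite (sepE (fun w : U => is_ordinal w)). split; [tauto|auto]. }
  assert (Oo : is_ordinal o).
  { split.
    - intros y Hy z Hz. rewrite Ho in *. now apply (ord_in y).
    - intros y Hy. rewrite Ho in Hy. exact (proj1 Hy). }
  apply (no_self o). now apply Ho.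
Qed.

End Basics.

(** * Functions *)

Section Functions.
Context {U : ZFC}.
Implicit Types a b c d e f x y z : U.

Lemma lamE d F p : p ∈ lam d F <-> exists x, x ∈ d /\ p = ⟨x, F x⟩.
Proof.
  apply (comprE (fun p => exists x, x ∈ d /\ p = ⟨x, F x⟩)).
  exists (img (fun x => ⟨x, F x⟩) d). intros q Hq. now apply imgE.
Qed.

Lemma lam_pair d F x y : ⟨x, y⟩ ∈ lam d F <-> x ∈ d /\ y = F x.
Proof.
  rewrite lamE. split.
  - intros (x' & Hx & E). apply opair_inj in E as [-> ->]. auto.
  - intros [Hx ->]. eauto.
Qed.

Lemma fun_pair f d x y : fun_on f d -> (⟨x, y⟩ ∈ f <-> x ∈ d /\ y = app f x).
Proof.
  intros [[Hp Hu] Hd].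
  assert (H1 : forall x, x ∈ d -> ⟨x, app f x⟩ ∈ f).
  { intros x' Hx. apply (the_spec (fun y => ⟨x', y⟩ ∈ f)). now apply Hd. }
  split.
  - intros H. assert (Hx : x ∈ d) by (apply Hd; now exists y). split; auto.
    apply (Hu x); auto.
  - intros [Hx ->]. auto.
Qed.

Lemma lam_fun_on d F : fun_on (lam d F) d.
Proof.
  split; [split|].
  - intros p Hp. apply lamE in Hp as (x & _ & ->). eauto.
  - intros x y z H1 H2. apply lam_pair in H1 as [_ ->], H2 as [_ ->]. auto.
  - intros x. split.
    + intros [y Hy]. now apply lam_pair in Hy.
    + intros Hx. exists (F x). now apply lam_pair.
Qed.

Lemma app_lam d F x : x ∈ d -> app (lam d F) x = F x.
Proof.
  intros Hx. symmetry. eapply (fun_pair _ d x (F x)).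
  - apply lam_fun_on.
  - now apply lam_pair.
Qed.

Lemma lam_ext d F G : (forall x, x ∈ d -> F x = G x) -> lam d F = lam d G.
Proof.
  intros E. apply ext. intros p. rewrite !lamE.
  split; intros (x & Hx & ->); exists x; rewrite E; auto.
Qed.

Lemma fun_on_lam f d : fun_on f d -> f = lam d (app f).
Proof.
  intros Hf. apply ext. intros p. rewrite lamE. split.
  - intros H. destruct Hf as [Hf Hd]. destruct (proj1 Hf p H) as (x & y & ->).
    assert (Hx : x ∈ d /\ y = app f x) by now apply (fun_pair f d).
    destruct Hx as [Hx ->]. eauto.
  - intros (x & Hx & ->). now apply (fun_pair f d).
Qed.

Lemma restr_lam d e F : e ⊆ d -> restr (lam d F) e = lam e F.
Proof.
  intros Hs. apply ext. intros p. unfold restr.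
  rewrite (sepE (fun p => exists x y, x ∈ e /\ p = ⟨x, y⟩)), !lamE. split.
  - intros [(x & Hx & ->) (x' & y & Hx' & E)]. apply opair_inj in E as [-> _]. eauto.
  - intros (x & Hx & ->). split; eauto.
Qed.

Lemma fun_on_ext f g d :
  fun_on f d -> fun_on g d -> (forall x, x ∈ d -> app f x = app g x) -> f = g.
Proof.
  intros Hf Hg E. rewrite (fun_on_lam f d Hf), (fun_on_lam g d Hg). now apply lam_ext.
Qed.

End Functions.

(** * Comparison of sizes *)

Section Cardinals.
Context {U : ZFC}.
Implicit Types a b c d e f k x y z : U.

Definition inj (F : U -> U) x y :=
  (forall a, a ∈ x -> F a ∈ y) /\
  (forall a b, a ∈ x -> b ∈ x -> F a = F b -> a = b).

Definition inj_le x y := exists F, inj F x y.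

Lemma inj_le_trans x y z : inj_le x y -> inj_le y z -> inj_le x z.
Proof.
  intros (F & F1 & F2) (G & G1 & G2). exists (fun a => G (F a)). split; auto.
Qed.

Lemma inj_le_sub x y : x ⊆ y -> inj_le x y.
Proof. intros H. exists (fun a => a). split; auto. Qed.

Lemma inj_le_refl x : inj_le x x.
Proof. now apply inj_le_sub. Qed.

Lemma surj_le (F : U -> U) x y :
  (forall b, b ∈ y -> exists a, a ∈ x /\ F a = b) -> inj_le y x.
Proof.
  intros H. apply class_choice in H as [G S]. exists G. split.
  - intros b Hb. now apply S.
  - intros b c Hb Hc E. rewrite <- (proj2 (S b Hb)), <- (proj2 (S c Hc)). now rewrite E.
Qed.

Lemma img_le F x : inj_le (img F x) x.
Proof.
  apply (surj_le F). intros b Hb. apply imgE in Hb as (a & Ha & ->). eauto.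
Qed.

Lemma equinumerous_le x y : equinumerous x y -> inj_le x y /\ inj_le y x.
Proof.
  intros (f & [_ H1] & H2 & H3). split.
  - exists (app f). split; auto.
  - now apply (surj_le (app f)).
Qed.

Lemma equinumerous_intro (F : U -> U) x y :
  inj F x y -> (forall b, b ∈ y -> exists a, a ∈ x /\ F a = b) -> equinumerous x y.
Proof.
  intros [F1 F2] Hs. exists (lam x F).
  split; [|split].
  - split; [apply lam_fun_on|]. intros a Ha. rewrite app_lam; auto.
  - intros a b Ha Hb. rewrite !app_lam; auto.
  - intros b Hb. destruct (Hs b Hb) as (a & Ha & <-). exists a. rewrite app_lam; auto.
Qed.

Inductive cb_orbit (F G : U -> U) x y : U -> Prop :=
| cb_start a : a ∈ x -> (forall b, b ∈ y -> G b <> a) -> cb_orbit F G x y a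
| cb_step a : cb_orbit F G x y a -> cb_orbit F G x y (G (F a)).

(** Cantor-Bernstein: use [F] on the orbits that start outside the range of [G], and
    the inverse of [G] elsewhere. *)
Lemma inj_le_antisym x y : inj_le x y -> inj_le y x -> equinumerous x y.
Proof.
  intros (F & F1 & F2) (G & G1 & G2).
  set (C := cb_orbit F G x y).
  assert (CX : forall a, C a -> a ∈ x) by (induction 1; auto).
  set (h := fun a => if excluded_middle_informative (C a) then F a
                     else the (fun b => b ∈ y /\ G b = a)).
  assert (h1 : forall a, C a -> h a = F a).
  { intros a Ha. unfold h. destruct (excluded_middle_informative (C a)); tauto. }
  assert (h2 : forall a, a ∈ x -> ~ C a -> h a ∈ y /\ G (h a) = a).
  { intros a Ha Hn. unfold h. destruct (excluded_middle_informative (C a)); [tauto|].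
    apply (the_spec (fun b => b ∈ y /\ G b = a)). apply NNPP. intros N. apply Hn.
    constructor; auto. intros b Hb E. eauto. }
  apply (equinumerous_intro h).
  - split.
    + intros a Ha. destruct (classic (C a)) as [H|H]; [rewrite h1; auto|now apply h2].
    + intros a b Ha Hb E.
      destruct (classic (C a)) as [H|H], (classic (C b)) as [H'|H'].
      * rewrite !h1 in E; auto.
      * destruct (h2 b Hb H') as [_ E']. exfalso. apply H'. rewrite <- E', <- E, h1; auto.
        now constructor 2.
      * destruct (h2 a Ha H) as [_ E']. exfalso. apply H. rewrite <- E', E, h1; auto.
        now constructor 2.
      * destruct (h2 a Ha H) as [_ <-], (h2 b Hb H') as [_ <-]. now rewrite E.
  - intros b Hb. destruct (classic (C (G b))) as [H|H].
    + inversion H as [a Ha Hn E|a Ha E].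
      * exfalso. now apply (Hn b).
      * exists a. split; auto. rewrite h1; auto.
    + exists (G b). split; auto. apply G2; auto; now apply h2; auto.
Qed.

(** Enumerate [x] by recursion along the ordinals. The process stops, since otherwise
    the inverse of the enumeration would make the class of ordinals a set. *)
Lemma well_ordering x : exists a, is_ordinal a /\ equinumerous x a.
Proof.
  set (h := wfrec mem_wf (fun a h => the (fun z => z ∈ x /\ forall b, b ∈ a -> h b <> z))).
  assert (h_eq : forall a, h a = the (fun z => z ∈ x /\ forall b, b ∈ a -> h b <> z)).
  { intros a. unfold h at 1. rewrite wfrec_eq. fold h. f_equal.
    apply functional_extensionality. intros z. apply propositional_extensionality.
    split; intros [Hz Hb]; split; auto; intros b Hba; generalize (Hb b Hba);
      destruct (excluded_middle_informative (b ∈ a)); tauto. }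
  set (good := fun a => exists z, z ∈ x /\ forall b, b ∈ a -> h b <> z).
  assert (h_good : forall a, good a -> h a ∈ x /\ forall b, b ∈ a -> h b <> h a).
  { intros a Ha. rewrite (h_eq a).
    apply (the_spec (fun z => z ∈ x /\ forall b, b ∈ a -> h b <> z)), Ha. }
  assert (h_inj : forall a b, is_ordinal a -> is_ordinal b -> good a -> good b ->
                    h a = h b -> a = b).
  { intros a b Oa Ob Ga Gb E. destruct (ord_total a b Oa Ob) as [H|[H|H]]; auto; exfalso.
    - now apply (proj2 (h_good b Gb) a).
    - now apply (proj2 (h_good a Ga) b). }
  destruct (ord_least (fun a => ~ good a)) as (a & Oa & Na & La).
  { apply NNPP. intros N. apply (@no_ordinal_set U).
    destruct (replacement U (fun z a => is_ordinal a /\ good a /\ h a = z) x) as [b Hb].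
    - intros z a a' _ (O1 & G1 & E1) (O2 & G2 & E2). apply h_inj; congruence.
    - exists b. intros a Oa. apply Hb.
      assert (Ga : good a) by (apply NNPP; intros Na; eauto).
      exists (h a). split; auto. now apply h_good. }
  exists a. split; auto.
  assert (I : inj h a x).
  { split.
    - intros b Hb. apply h_good, NNPP. now apply La.
    - intros b c Hb Hc. apply h_inj; eauto using ord_in; apply NNPP; auto. }
  apply inj_le_antisym; [|now exists h].
  apply (surj_le h). intros z Hz. apply NNPP. intros N. apply Na. exists z.
  split; auto. intros b Hb E. eauto.
Qed.

Lemma cardinal_not_le k a : is_cardinal k -> a ∈ k -> ~ inj_le k a.
Proof.
  intros [O H] Ha L. apply (H a Ha). apply inj_le_antisym; auto.
  apply inj_le_sub. exact (proj1 O a Ha).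
Qed.

Lemma cardinal_unique k k' : is_cardinal k -> is_cardinal k' ->
  inj_le k k' -> inj_le k' k -> k = k'.
Proof.
  intros H H' L L'. destruct (ord_total k k') as [E|[E|E]]; auto;
    try exact (proj1 H); try exact (proj1 H'); exfalso.
  - now apply (cardinal_not_le k' k).
  - now apply (cardinal_not_le k k').
Qed.

Lemma card_spec x : is_cardinal (card x) /\ equinumerous x (card x).
Proof.
  apply (the_spec (fun k => is_cardinal k /\ equinumerous x k)).
  destruct (ord_least (fun a => equinumerous x a)) as (k & Ok & Ek & Lk).
  - apply well_ordering.
  - exists k. split; auto. split; auto. intros a Ha E. apply (Lk a Ha).
    apply equinumerous_le in E as [E1 E2]. apply equinumerous_le in Ek as [K1 K2].
    apply inj_le_antisym; eauto using inj_le_trans.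
Qed.

Lemma card_cardinal x : is_cardinal (card x).
Proof. apply card_spec. Qed.

Lemma card_ord x : is_ordinal (card x).
Proof. apply (card_cardinal x). Qed.

Lemma le_card x : inj_le x (card x).
Proof. exact (proj1 (equinumerous_le _ _ (proj2 (card_spec x)))). Qed.

Lemma card_le x : inj_le (card x) x.
Proof. exact (proj2 (equinumerous_le _ _ (proj2 (card_spec x)))). Qed.

Lemma card_eq x k : is_cardinal k -> inj_le x k -> inj_le k x -> card x = k.
Proof.
  intros Hk H1 H2. apply cardinal_unique; auto using card_cardinal.
  - eapply inj_le_trans; [apply card_le|auto].
  - eapply inj_le_trans; [|apply le_card]; auto.
Qed.

Definition small k x := exists a, a ∈ k /\ inj_le x a.

Lemma card_small k x : is_cardinal k -> card x ∈ k <-> small k x.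
Proof.
  intros Hk. split.
  - intros H. exists (card x). split; auto using le_card.
  - intros (a & Ha & L). apply NNPP. intros N.
    pose proof (ord_nsub _ _ (card_ord x) (proj1 Hk) N) as N'.
    apply (cardinal_not_le k a Hk Ha).
    eapply inj_le_trans; [apply inj_le_sub, N'|].
    eapply inj_le_trans; [apply card_le|exact L].
Qed.

Lemma not_small k x : is_cardinal k -> ~ small k x -> inj_le k x.
Proof.
  intros Hk N. rewrite <- card_small in N; auto.
  pose proof (ord_nsub _ _ (card_ord x) (proj1 Hk) N) as N'.
  eapply inj_le_trans; [apply inj_le_sub, N'|apply card_le].
Qed.

Lemma small_le k x y : inj_le x y -> small k y -> small k x.
Proof. intros H (a & Ha & L). exists a. eauto using inj_le_trans. Qed.

Lemma small_sub k x y : x ⊆ y -> small k y -> small k x.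
Proof. intros H. now apply small_le, inj_le_sub. Qed.

Lemma small_elem k a : a ∈ k -> small k a.
Proof. intros H. exists a. auto using inj_le_refl. Qed.

Lemma card_small_eq k x : is_cardinal k -> x ⊆ k -> ~ small k x -> card x = k.
Proof.
  intros Hk Hs N. apply card_eq; auto using inj_le_sub, not_small.
Qed.

(** The diagonal argument, along an injection [F] of the power set into [x]. *)
Lemma pow_not_le x : ~ inj_le (pow x) x.
Proof.
  intros (F & F1 & F2).
  set (D := {{ z in x | exists y, y ∈ pow x /\ F y = z /\ ~ z ∈ y }}).
  assert (HD : forall z, z ∈ D <-> z ∈ x /\ exists y, y ∈ pow x /\ F y = z /\ ~ z ∈ y).
  { intros z. apply (sepE (fun z => exists y, y ∈ pow x /\ F y = z /\ ~ z ∈ y)). }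
  assert (DP : D ∈ pow x) by (apply powE; intros z Hz; now apply HD in Hz).
  assert (N : ~ F D ∈ D).
  { intros H. generalize H. apply HD in H as [_ (y & Hy & E & Hn)].
    apply F2 in E; auto. now subst y. }
  apply N, HD. split; eauto.
Qed.

(** * Regular cardinals *)

Lemma regular_cardinal k : regular k -> is_cardinal k.
Proof. intros [[H _] _]. exact H. Qed.

Lemma regular_ord k : regular k -> is_ordinal k.
Proof. intros H. apply regular_cardinal, H. Qed.

Lemma regular_omega k : regular k -> omega ⊆ k.
Proof. intros [[_ H] _]. exact H. Qed.

Lemma regular_num k n : regular k -> num n ∈ k.
Proof. intros H. apply regular_omega; auto using num_omega. Qed.

Lemma regular_succ k a : regular k -> a ∈ k -> succ a ∈ k.
Proof.
  intros Hk Ha. destruct Hk as [[Hc Ho] Hk]. assert (O := proj1 Hc).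
  assert (Os : is_ordinal (succ a)) by (apply ord_succ, (ord_in k); auto).
  destruct (ord_total (succ a) k Os O) as [H|[H|H]]; auto.
  - exfalso. destruct (Hk (succ empty) (lam (succ empty) (fun _ => a))) as (b & Hb & Hb').
    + apply Ho. apply (num_omega 1).
    + split; [apply lam_fun_on|]. intros x Hx. now rewrite app_lam.
    + assert (H1 : empty ∈ succ (empty : U)) by (apply succE; auto).
      specialize (Hb' _ H1). rewrite app_lam in Hb' by auto.
      rewrite <- H in Hb. apply succE in Hb as [Hb| ->].
      * apply (no_self a), (ord_trans a b); auto. now apply (ord_in k).
      * now apply (no_self a).
  - exfalso. apply succE in H as [H| ->]; [|now apply (no_self a)].
    apply (no_self a), (ord_trans a k); auto. now apply (ord_in k).
Qed.

Lemma small_bounded k x : regular k -> x ⊆ k -> small k x ->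
  exists b, b ∈ k /\ x ⊆ b.
Proof.
  intros Hk Hs (a & Ha & F & F1 & F2).
  (* an inverse of [F], with the default value [empty] outside its range *)
  destruct (class_choice (fun i z => (z ∈ x /\ F z = i) \/
              (z = empty /\ forall w, w ∈ x -> F w <> i)) a) as [G HG].
  { intros i _. destruct (classic (exists w, w ∈ x /\ F w = i)) as [[w Hw]|N]; eauto.
    exists empty. right. split; eauto. }
  assert (HG' : forall z, z ∈ x -> G (F z) = z).
  { intros z Hz. destruct (HG (F z) (F1 z Hz)) as [[H1 H2]|[_ H]]; auto. now apply H in Hz. }
  destruct (proj2 Hk a (lam a G) Ha) as (b & Hb & Hb').
  - split; [apply lam_fun_on|]. intros i Hi. rewrite app_lam by auto.
    destruct (HG i Hi) as [[H _]|[-> _]]; auto. apply (regular_num k 0 Hk).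
  - exists b. split; auto. intros z Hz. specialize (Hb' (F z) (F1 z Hz)).
    rewrite app_lam, HG' in Hb'; auto.
Qed.

(** Otherwise [k] injects into the union, and the pieces of [k] that go to the single
    sets are few and, being small, bounded; so their bounds are bounded, too. *)
Lemma small_fam k a (G : U -> U) : regular k -> small k a ->
  (forall x, x ∈ a -> small k (G x)) -> small k (fam a G).
Proof.
  intros Hk Ha HG. apply NNPP. intros N.
  destruct (not_small _ _ (regular_cardinal k Hk) N) as (F & F1 & F2).
  set (P := fun i => {{ z in k | F z ∈ G i }}).
  assert (HP : forall i z, z ∈ P i <-> z ∈ k /\ F z ∈ G i).
  { intros i z. apply (sepE (fun z => F z ∈ G i)). }
  assert (HB : forall i, i ∈ a -> exists b, b ∈ k /\ P i ⊆ b).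
  { intros i Hi. apply small_bounded; auto.
    - intros z Hz. now apply HP in Hz.
    - apply (small_le k _ (G i)); auto. exists F. split.
      + intros z Hz. now apply HP in Hz.
      + intros z w Hz Hw. apply HP in Hz as [Hz _], Hw as [Hw _]. auto. }
  apply class_choice in HB as [B HB'].
  destruct (small_bounded k (img B a) Hk) as (c & Hc & Hc').
  - intros z Hz. apply imgE in Hz as (i & Hi & ->). now apply HB'.
  - apply (small_le k _ a); auto using img_le.
  - assert (Hcs : succ c ∈ k) by now apply regular_succ.
    destruct (proj1 (famE _ _ _) (F1 _ Hcs)) as (i & Hi & HF).
    assert (H1 : succ c ∈ B i) by (apply HB'; auto; now apply HP).
    assert (H2 : B i ∈ c) by (apply Hc', img_in, Hi).
    assert (Oc : is_ordinal c) by (apply (ord_in k); auto using regular_ord).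
    apply (no_self c). apply (ord_trans c (B i)); auto.
    apply (ord_trans (B i) (succ c)); eauto using ord_in. apply succE; auto.
Qed.

Lemma small_num k n : regular k -> small k (num n).
Proof. intros Hk. apply small_elem, regular_num, Hk. Qed.

Lemma upair_le a b : inj_le (upair a b) (num 2).
Proof.
  apply (surj_le (fun i => if excluded_middle_informative (i = num 0) then a else b)).
  intros c Hc. apply upairE in Hc as [-> | ->].
  - exists (num 0). split; [apply num_lt; exists 0; auto|].
    destruct (excluded_middle_informative _); tauto.
  - exists (num 1). split; [apply num_lt; exists 1; auto|].
    destruct (excluded_middle_informative _) as [E|]; auto.
    apply num_inj in E. lia.
Qed.

Lemma small_upair k a b : regular k -> small k (upair a b).
Proof.
  intros Hk. apply (small_le k _ (num 2)); auto using small_num, upair_le.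
Qed.

Lemma small_un k a b : regular k -> small k a -> small k b -> small k (un a b).
Proof.
  intros Hk Ha Hb. apply small_fam; auto using small_upair.
  intros x Hx. apply upairE in Hx as [-> | ->]; auto.
Qed.

Lemma small_prod k a b : regular k -> small k a -> small k b -> small k (prod a b).
Proof.
  intros Hk Ha Hb. apply small_fam; auto.
  intros x Hx. apply (small_le k _ b); auto using img_le.
Qed.

Lemma prod_le a b c d : inj_le a c -> inj_le b d -> inj_le (prod a b) (prod c d).
Proof.
  intros (F & F1 & F2) (G & G1 & G2).
  apply (surj_le (fun q => the (fun p => exists x y, x ∈ a /\ y ∈ b /\ p = ⟨x, y⟩ /\ q = ⟨F x, G y⟩))).
  intros p Hp. apply prodE in Hp as (x & y & Hx & Hy & ->).
  exists ⟨F x, G y⟩. split; [apply prod_in; auto|].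
  apply the_eq; [now exists x, y|].
  intros p (x' & y' & Hx' & Hy' & -> & E). apply opair_inj in E as [E1 E2].
  apply F2 in E1; auto. apply G2 in E2; auto. now subst.
Qed.

Lemma fam_le k a (G : U -> U) : inj_le (prod k k) k -> inj_le a k ->
  (forall x, x ∈ a -> inj_le (G x) k) -> inj_le (fam a G) k.
Proof.
  intros Hk (F & F1 & F2) HG.
  eapply inj_le_trans; [|exact Hk].
  set (K := fun x => epsilon (inhabits (fun z : U => z)) (fun g => inj g (G x) k)).
  destruct (class_choice (fun z x => x ∈ a /\ z ∈ G x) (fam a G)) as [I HI].
  { intros z Hz. now apply famE. }
  assert (HK : forall x, x ∈ a -> inj (K x) (G x) k).
  { intros x Hx. apply (epsilon_spec (inhabits (fun z : U => z)) (fun g => inj g (G x) k)).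
    now apply HG. }
  exists (fun z => ⟨F (I z), K (I z) z⟩). split.
  - intros z Hz. destruct (HI z Hz). apply prod_in. split; auto. now apply HK.
  - intros z w Hz Hw E. apply opair_inj in E as [E1 E2].
    destruct (HI z Hz) as [H1 H2], (HI w Hw) as [H3 H4].
    apply F2 in E1; auto. rewrite <- E1 in *. now apply (HK (I z)) in E2.
Qed.

Lemma un_le k a b : inj_le (prod k k) k -> inj_le (num 2) k ->
  inj_le a k -> inj_le b k -> inj_le (un a b) k.
Proof.
  intros Hk H2 Ha Hb. apply fam_le; auto.
  - eapply inj_le_trans; [apply upair_le|exact H2].
  - intros x Hx. apply upairE in Hx as [-> | ->]; auto.
Qed.

Lemma succ_le k a : inj_le (prod k k) k -> inj_le (num 2) k ->
  inj_le a k -> inj_le (succ a) k.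
Proof.
  intros Hk H2 Ha. apply (inj_le_trans _ (un a (upair a a))).
  - apply inj_le_sub. intros z Hz. apply succE in Hz. apply unE. rewrite upairE. tauto.
  - apply un_le; auto. eapply inj_le_trans; [apply upair_le|exact H2].
Qed.

(** A superset [Y] of [x] with [Y * Y] a subset of [Y]. It replaces the theorem that
    [m * m] and [m] have the same size for every infinite cardinal [m]. *)
Definition pair_hull x : U :=
  bigU (range (fix T n := match n with 0 => x | S n => un (T n) (pow (T n)) end)).

Lemma pair_hull_spec x :
  x ⊆ pair_hull x /\ forall a b, a ∈ pair_hull x -> b ∈ pair_hull x -> ⟨a, b⟩ ∈ pair_hull x.
Proof.
  unfold pair_hull. set (T := fix T n := match n with 0 => x | S n => un (T n) (pow (T n)) end).
  assert (HT : forall z, z ∈ bigU (range T) <-> exists n, z ∈ T n).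
  { intros z. rewrite bigUE. split.
    - intros (y & Hy & Hz). apply rangeE in Hy as [n ->]. eauto.
    - intros [n Hn]. exists (T n). split; auto. apply rangeE. eauto. }
  assert (M1 : forall n, T n ⊆ T (S n)) by (intros n z Hz; apply unE; auto).
  assert (Mon : forall m n z, m <= n -> z ∈ T m -> z ∈ T n).
  { intros m n z H. induction H; auto. }
  split.
  - intros z Hz. apply HT. now exists 0.
  - intros a b Ha Hb. apply HT in Ha as [m Hm], Hb as [n Hn].
    apply HT. exists (S (S (max m n))).
    apply (Mon m (max m n)) in Hm; [|lia]. apply (Mon n (max m n)) in Hn; [|lia].
    apply unE. right. apply powE. intros z Hz. apply unE. right. apply powE.
    intros w Hw. apply upairE in Hz as [-> | ->];
      apply upairE in Hw as [-> | ->]; auto.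
Qed.

(** The successor of a cardinal [m] is regular if [m * m] injects into [m], because then
    the union of [m] sets of size at most [m] has size at most [m]. *)
Lemma regular_above (l : U) : is_ordinal l -> exists theta, l ∈ theta /\ regular theta.
Proof.
  intros Ol.
  set (Y := pair_hull (un l omega)). destruct (pair_hull_spec (un l omega)) as [Y1 Y2].
  fold Y in Y1, Y2.
  assert (YY : inj_le (prod Y Y) Y).
  { apply inj_le_sub. intros p Hp. apply prodE in Hp as (x & y & Hx & Hy & ->). auto. }
  set (m := card Y). assert (Hm : inj_le (prod m m) m).
  { eapply inj_le_trans; [apply prod_le; apply card_le|].
    eapply inj_le_trans; [exact YY|apply le_card]. }
  destruct (ord_least (fun a => ~ inj_le a m)) as (t & Ot & Nt & Lt).
  { exists (card (pow m)). split; auto using card_ord. intros H.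
    apply (pow_not_le m). eapply inj_le_trans; [apply le_card|exact H]. }
  assert (Lt' : forall a, a ∈ t -> inj_le a m) by (intros a Ha; apply NNPP; eauto).
  assert (Big : forall a, is_ordinal a -> inj_le a m -> a ∈ t).
  { intros a Oa La. destruct (ord_total a t Oa Ot) as [H|[H|H]]; auto; exfalso.
    - now subst.
    - apply Nt. eapply inj_le_trans; [|exact La]. apply inj_le_sub. exact (proj1 Oa t H). }
  assert (LY : forall a, a ⊆ un l omega -> inj_le a m).
  { intros a Ha. eapply inj_le_trans; [|apply le_card]. apply inj_le_sub. auto. }
  exists t. split; [|split; [split; [split|]|]]; auto.
  - apply Big; auto. apply LY. intros z Hz. apply unE; auto.
  - intros a Ha E. apply equinumerous_le in E as [_ E]. apply Nt.
    eapply inj_le_trans; [exact E|auto].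
  - intros z Hz. apply Big; [now apply (ord_in omega); auto using ord_omega|].
    apply LY. intros w Hw. apply unE. right. apply (ord_trans omega z); auto using ord_omega.
  - intros a f Ha [Hf Hf'].
    set (b := bigU (img (fun i => succ (app f i)) a)).
    exists b. split.
    + apply Big.
      * apply ord_bigU. intros x Hx. apply imgE in Hx as (i & Hi & ->).
        apply ord_succ, (ord_in t); auto.
      * apply fam_le; auto.
        { eapply inj_le_trans; [apply img_le|auto]. }
        intros x Hx. apply imgE in Hx as (i & Hi & ->). apply succ_le; auto.
        apply LY. intros z Hz. apply unE. right.
        apply (ord_trans omega (num 2)); auto using ord_omega, num_omega.
    + intros i Hi. apply bigUE. exists (succ (app f i)). split.
      * now apply (img_in (fun i => succ (app f i))).
      * apply succE; auto.
Qed.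

End Cardinals.

(** * The sets [H theta] *)

Section Hereditary.
Context {U : ZFC}.
Implicit Types a b c d f k x y z : U.

(** The cumulative hierarchy; it serves to see that [H theta] is a set. *)
Definition rank_level : U -> U :=
  wfrec mem_wf (fun a V => fam a (fun b => pow (V b))).

Lemma rank_levelE a z : z ∈ rank_level a <-> exists b, b ∈ a /\ z ⊆ rank_level b.
Proof.
  unfold rank_level at 1. rewrite wfrec_eq. rewrite famE.
  split; intros (b & Hb & Hz); exists b; split; auto; revert Hz;
    destruct (excluded_middle_informative (b ∈ a)); try tauto; now rewrite powE.
Qed.

Lemma trcl_mono x y : x ∈ y -> trcl x ⊆ trcl y.
Proof.
  intros H. apply trcl_least; [apply trcl_trans|].
  now apply (trcl_trans y x), trcl_sub.
Qed.

Context {theta : U} (Hr : regular theta).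

Lemma hereditary_in_level x :
  small theta (trcl x) -> exists a, a ∈ theta /\ x ⊆ rank_level a.
Proof.
  induction x as [x IH] using (well_founded_induction mem_wf). intros Hx.
  assert (IH' : forall y, y ∈ x -> exists a, a ∈ theta /\ y ⊆ rank_level a).
  { intros y Hy. apply IH; auto. apply (small_sub _ _ (trcl x)); auto. now apply trcl_mono. }
  apply class_choice in IH' as [A HA].
  destruct (small_bounded theta (img A x) Hr) as (b & Hb & Hb').
  - intros a Ha. apply imgE in Ha as (y & Hy & ->). now apply HA.
  - apply (small_le _ _ x); [apply img_le|]. apply (small_sub _ _ (trcl x)); auto.
    apply trcl_sub.
  - exists b. split; auto. intros y Hy. apply rank_levelE. exists (A y). split.
    + apply Hb', img_in, Hy.
    + now apply HA.
Qed.

Lemma HE x : x ∈ H theta <-> small theta (trcl x).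
Proof.
  unfold H. rewrite comprE.
  - apply card_small, regular_cardinal, Hr.
  - exists (rank_level theta). intros y Hy. apply card_small in Hy; [|now apply regular_cardinal].
    apply rank_levelE, hereditary_in_level, Hy.
Qed.

Lemma H_trans x y : x ∈ H theta -> y ∈ x -> y ∈ H theta.
Proof.
  rewrite !HE. intros Hx Hy. apply (small_sub _ _ (trcl x)); auto. now apply trcl_mono.
Qed.

Lemma H_small x : x ∈ H theta -> small theta x.
Proof. rewrite HE. apply small_sub, trcl_sub. Qed.

Lemma H_sub x y : x ∈ H theta -> y ⊆ x -> y ∈ H theta.
Proof.
  rewrite !HE. intros Hx Hy. apply (small_sub _ _ (trcl x)); auto.
  apply trcl_least; [apply trcl_trans|]. intros z Hz. apply trcl_sub. auto.
Qed.

Lemma H_intro x : x ⊆ H theta -> small theta x -> x ∈ H theta.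
Proof.
  intros Hs Hx. apply HE. apply (small_sub _ _ (un x (fam x trcl))).
  - apply trcl_least; [|intros z Hz; apply unE; auto].
    intros y Hy z Hz. apply unE. right. apply famE.
    apply unE in Hy as [Hy|Hy].
    + exists y. split; auto. now apply trcl_sub.
    + apply famE in Hy as (w & Hw & Hy). exists w. split; auto. now apply (trcl_trans w y).
  - apply small_un, small_fam; auto. intros y Hy. apply HE. auto.
Qed.

Lemma H_upair a b : a ∈ H theta -> b ∈ H theta -> upair a b ∈ H theta.
Proof.
  intros Ha Hb. apply H_intro; [|now apply small_upair].
  intros z Hz. apply upairE in Hz as [-> | ->]; auto.
Qed.

Lemma H_opair a b : a ∈ H theta -> b ∈ H theta -> ⟨a, b⟩ ∈ H theta.
Proof. intros Ha Hb. apply H_upair; now apply H_upair. Qed.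

Lemma H_opair_inv a b : ⟨a, b⟩ ∈ H theta -> a ∈ H theta /\ b ∈ H theta.
Proof.
  intros Hp. assert (Hq : upair a b ∈ H theta).
  { apply (H_trans _ _ Hp). apply upairE; auto. }
  split; apply (H_trans _ _ Hq); apply upairE; auto.
Qed.

Lemma H_ord a : a ∈ theta -> a ∈ H theta.
Proof.
  intros Ha. apply HE. apply (small_sub _ _ a); [|now apply small_elem].
  apply trcl_least; auto. apply (ord_in theta); auto. now apply regular_ord.
Qed.

Lemma H_num n : num n ∈ H theta.
Proof. apply H_ord. now apply regular_num. Qed.

Lemma H_img F a : small theta a -> (forall x, x ∈ a -> F x ∈ H theta) -> img F a ∈ H theta.
Proof.
  intros Ha HF. apply H_intro.
  - intros z Hz. apply imgE in Hz as (x & Hx & ->). auto.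
  - apply (small_le _ _ a); auto. apply img_le.
Qed.

Lemma H_lam d F : small theta d -> d ⊆ H theta ->
  (forall x, x ∈ d -> F x ∈ H theta) -> lam d F ∈ H theta.
Proof.
  intros Hd Hs HF. assert (E : lam d F = img (fun x => ⟨x, F x⟩) d).
  { apply ext. intros p. now rewrite lamE, imgE. }
  rewrite E. apply H_img; auto. intros x Hx. apply H_opair; auto.
Qed.

Lemma H_fam F a : small theta a -> (forall x, x ∈ a -> F x ∈ H theta) -> fam a F ∈ H theta.
Proof.
  intros Ha HF. apply H_intro.
  - intros z Hz. apply famE in Hz as (x & Hx & Hz). apply (H_trans (F x)); auto.
  - apply small_fam; auto. intros x Hx. apply H_small. auto.
Qed.

Lemma H_prod a b : a ∈ H theta -> b ∈ H theta -> prod a b ∈ H theta.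
Proof.
  intros Ha Hb. apply H_intro.
  - intros p Hp. apply prodE in Hp as (x & y & Hx & Hy & ->).
    apply H_opair; [apply (H_trans a)|apply (H_trans b)]; auto.
  - apply small_prod; auto using H_small.
Qed.

End Hereditary.

Lemma H_eventually {U : ZFC} (x : U) :
  exists l, is_ordinal l /\ forall theta, regular theta -> l ∈ theta -> x ∈ H theta.
Proof.
  exists (card (trcl x)). split; [apply card_ord|]. intros theta Hr Hl.
  apply HE; auto. apply card_small; auto. now apply regular_cardinal.
Qed.

(** * Definable predicates *)

Section Definability.
Context {U : ZFC}.
Implicit Types (M N x : U) (e : nat -> U) (P Q : U -> (nat -> U) -> Prop).

Fixpoint var_bound (phi : form) : nat :=
  match phi with
  | fMem i j | fEq i j => S (max i j)
  | fNot p => var_bound p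
  | fAnd p q => max (var_bound p) (var_bound q)
  | fAll i p => max (S i) (var_bound p)
  end.

Local Arguments Nat.max : simpl never.

Lemma sat_ext M phi : forall e e', (forall n, n < var_bound phi -> e n = e' n) ->
  sat M e phi <-> sat M e' phi.
Proof.
  induction phi as [i j|i j|p IH|p IHp q IHq|i p IH]; simpl; intros e e' E.
  - rewrite !E by lia. tauto.
  - rewrite !E by lia. tauto.
  - now rewrite (IH e e').
  - rewrite (IHp e e'), (IHq e e'); [tauto| |]; intros n Hn; apply E; lia.
  - assert (IH' : forall x, sat M (update e i x) p <-> sat M (update e' i x) p).
    { intros x. apply IH. intros n Hn. unfold update. destruct (Nat.eqb_spec n i); auto.
      apply E. lia. }
    split; intros Hx x Hxm; apply IH'; auto.
Qed.

Lemma nat_bound (r : nat -> nat) n : exists k, forall i, i < n -> r i < k.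
Proof.
  induction n as [|n [k IH]].
  - exists 0. lia.
  - exists (max k (S (r n))). intros i Hi.
    destruct (Nat.eq_dec i n) as [->|]; [lia|]. specialize (IH i). lia.
Qed.

(** By induction on the formula; each bound variable becomes a fresh one. *)
Lemma sat_rename phi : forall r : nat -> nat, exists phi', forall M e,
  sat M e phi' <-> sat M (fun n => e (r n)) phi.
Proof.
  induction phi as [i j|i j|p IH|p IHp q IHq|i p IH]; intros r.
  - exists (fMem (r i) (r j)). reflexivity.
  - exists (fEq (r i) (r j)). reflexivity.
  - destruct (IH r) as [p' Hp]. exists (fNot p'). intros M e. simpl. now rewrite Hp.
  - destruct (IHp r) as [p' Hp], (IHq r) as [q' Hq]. exists (fAnd p' q').
    intros M e. simpl. now rewrite Hp, Hq.
  - destruct (nat_bound r (var_bound p)) as [k Hk].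
    destruct (IH (update r i k)) as [p' Hp]. exists (fAll k p'). intros M e. simpl.
    assert (E : forall x, sat M (update e k x) p' <->
                          sat M (update (fun n => e (r n)) i x) p).
    { intros x. rewrite Hp. apply sat_ext. intros n Hn. unfold update.
      destruct (Nat.eqb n i); [now rewrite Nat.eqb_refl|].
      specialize (Hk n Hn). destruct (Nat.eqb_spec (r n) k); auto; lia. }
    split; intros Hx x Hxm; apply E; auto.
Qed.

(** One formula has to serve all structures, so that a predicate can be carried along
    elementary embeddings. *)
Definition Dfn P := exists phi, forall M e, sat M e phi <-> P M e.

Lemma dfn_ext P Q : (forall M e, P M e <-> Q M e) -> Dfn P -> Dfn Q.
Proof. intros E [phi Hp]. exists phi. intros M e. now rewrite Hp, E. Qed.

Lemma dfn_sat phi : Dfn (fun M e => sat M e phi).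
Proof. exists phi. reflexivity. Qed.

Lemma dfn_mem i j : Dfn (fun M e => e i ∈ e j).
Proof. exists (fMem i j). reflexivity. Qed.

Lemma dfn_eq i j : Dfn (fun M e => e i = e j).
Proof. exists (fEq i j). reflexivity. Qed.

Lemma dfn_not P : Dfn P -> Dfn (fun M e => ~ P M e).
Proof. intros [p Hp]. exists (fNot p). intros M e. simpl. now rewrite Hp. Qed.

Lemma dfn_and P Q : Dfn P -> Dfn Q -> Dfn (fun M e => P M e /\ Q M e).
Proof.
  intros [p Hp] [q Hq]. exists (fAnd p q). intros M e. simpl. now rewrite Hp, Hq.
Qed.

Lemma dfn_or P Q : Dfn P -> Dfn Q -> Dfn (fun M e => P M e \/ Q M e).
Proof.
  intros HP HQ. apply (dfn_ext (fun M e => ~ (~ P M e /\ ~ Q M e))).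
  - intros M e. tauto.
  - apply dfn_not, dfn_and; now apply dfn_not.
Qed.

Lemma dfn_imp P Q : Dfn P -> Dfn Q -> Dfn (fun M e => P M e -> Q M e).
Proof.
  intros HP HQ. apply (dfn_ext (fun M e => ~ (P M e /\ ~ Q M e))).
  - intros M e. tauto.
  - apply dfn_not, dfn_and; auto. now apply dfn_not.
Qed.

Lemma dfn_iff P Q : Dfn P -> Dfn Q -> Dfn (fun M e => P M e <-> Q M e).
Proof. intros HP HQ. apply dfn_and; now apply dfn_imp. Qed.

Lemma dfn_rename P (r : nat -> nat) (f : (nat -> U) -> nat -> U) :
  Dfn P -> (forall e n, f e n = e (r n)) -> Dfn (fun M e => P M (f e)).
Proof.
  intros [p Hp] E. destruct (sat_rename p r) as [p' Hp']. exists p'. intros M e.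
  rewrite Hp', Hp. replace (fun n => e (r n)) with (f e); [reflexivity|].
  apply functional_extensionality. intros n. apply E.
Qed.

Lemma dfn_all_var P i : Dfn P -> Dfn (fun M e => forall x, x ∈ M -> P M (update e i x)).
Proof.
  intros [p Hp]. exists (fAll i p). intros M e. simpl.
  split; intros Hx x Hxm; apply Hp; auto.
Qed.

Lemma dfn_ex_var P i : Dfn P -> Dfn (fun M e => exists x, x ∈ M /\ P M (update e i x)).
Proof.
  intros HP. apply (dfn_ext (fun M e => ~ forall x, x ∈ M -> ~ P M (update e i x))).
  - intros M e. split.
    + intros N. apply NNPP. intros N'. apply N. intros x Hx Hp. eauto.
    + intros (x & Hx & Hp) N. now apply (N x).
  - apply dfn_not, (dfn_all_var (fun M e => ~ P M e)), dfn_not, HP.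
Qed.

(** The quantifiers are treated in de Bruijn style: [e 0] becomes the bound variable. *)
Lemma dfn_all (B : U -> U -> (nat -> U) -> Prop) :
  Dfn (fun M e => B M (e 0) (fun n => e (S n))) ->
  Dfn (fun M e => forall x, x ∈ M -> B M x e).
Proof.
  intros [p Hp].
  set (k := var_bound p).
  destruct (sat_rename p (fun n => match n with 0 => k | S n => n end)) as [p' Hp'].
  exists (fAll k p'). intros M e. simpl.
  assert (E : forall x, sat M (update e k x) p' <-> B M x e).
  { intros x. rewrite Hp'.
    rewrite (sat_ext M p _ (fun n => match n with 0 => x | S n => e n end)).
    - rewrite Hp. reflexivity.
    - intros [|n] Hn; unfold update.
      + now rewrite Nat.eqb_refl.
      + destruct (Nat.eqb_spec n k); auto. unfold k in *. lia. }
  split; intros Hx x Hxm; apply E; auto.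
Qed.

Lemma dfn_ex (B : U -> U -> (nat -> U) -> Prop) :
  Dfn (fun M e => B M (e 0) (fun n => e (S n))) ->
  Dfn (fun M e => exists x, x ∈ M /\ B M x e).
Proof.
  intros HB. apply (dfn_ext (fun M e => ~ forall x, x ∈ M -> ~ B M x e)).
  - intros M e. split.
    + intros N. apply NNPP. intros N'. apply N. intros x Hx Hp. eauto.
    + intros (x & Hx & Hp) N. now apply (N x).
  - now apply dfn_not, dfn_all, dfn_not.
Qed.

Lemma upair_in_dfn i j k : Dfn (fun M e => upair_in M (e i) (e j) (e k)).
Proof.
  unfold upair_in. apply dfn_all. apply dfn_iff; [apply dfn_mem|].
  apply dfn_or; apply dfn_eq.
Qed.

Lemma rel_in_dfn i j k : Dfn (fun M e => rel_in M (e i) (e j) (e k)).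
Proof.
  apply (dfn_ext (fun M e => exists p, p ∈ M /\ exists s, s ∈ M /\ exists t, t ∈ M /\
    (p ∈ e i /\ upair_in M s (e j) (e j) /\ upair_in M t (e j) (e k) /\ upair_in M p s t))).
  - intros M e. unfold rel_in. split.
    + intros (p & Hp & s & Hs & t & Ht & H1). exists p, s, t. tauto.
    + intros (p & s & t & Hp & Hs & Ht & H1). exists p. split; auto. exists s. split; auto.
      exists t. tauto.
  - do 3 apply dfn_ex.
    repeat (apply dfn_and; [apply dfn_mem || apply upair_in_dfn|]). apply upair_in_dfn.
Qed.

(** * Elementary substructures and embeddings *)

(** The list is padded with [empty], which is in all structures considered. *)
Definition ev (l : list U) : nat -> U := fun n => nth n l empty.

Lemma ev_in M l : empty ∈ M -> Forall (fun x => x ∈ M) l -> env_in M (ev l).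
Proof.
  intros H0 Hl. unfold env_in, ev. induction Hl as [|x l Hx Hl IH]; intros [|n]; simpl; auto.
Qed.

Lemma elem_dfn P M N e : Dfn P -> elem_sub M N -> env_in M e -> (P M e <-> P N e).
Proof. intros [p Hp] [_ HE] He. rewrite <- !Hp. now apply HE. Qed.

Lemma embedding_dfn P j M N e : Dfn P -> elem_embedding j M N -> env_in M e ->
  (P M e <-> P N (fun n => app j (e n))).
Proof. intros [p Hp] [_ HE] He. rewrite <- !Hp. now apply HE. Qed.

Definition scons x e : nat -> U := fun n => match n with 0 => x | S n => e n end.

Lemma dfn_ex_scons P : Dfn P -> Dfn (fun M e => exists x, x ∈ M /\ P M (scons x e)).
Proof.
  intros HP. apply dfn_ex. apply (dfn_rename P (fun n => n) (fun e => scons (e 0) (fun n => e (S n)))); auto.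
  intros e [|n]; reflexivity.
Qed.

(** This is how objects enter [M]: exhibit one in [N] that has a definable property. *)
Lemma elem_witness P M N e : Dfn P -> elem_sub M N -> env_in M e ->
  (exists x, x ∈ N /\ P N (scons x e)) -> exists x, x ∈ M /\ P N (scons x e).
Proof.
  intros HP HE He Hx.
  assert (Hx' : exists x, x ∈ M /\ P M (scons x e)).
  { now apply (elem_dfn _ M N e (dfn_ex_scons P HP) HE He). }
  destruct Hx' as (x & Hx' & Hp). exists x. split; auto.
  apply (elem_dfn P M N (scons x e) HP HE); auto. intros [|n]; simpl; auto.
Qed.

Lemma elem_witness_ev P M N l : Dfn P -> elem_sub M N -> empty ∈ M ->
  Forall (fun x => x ∈ M) l ->
  (exists x, x ∈ N /\ P N (ev (x :: l))) -> exists x, x ∈ M /\ P N (ev (x :: l)).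
Proof.
  intros HP HE H0 Hl Hx.
  assert (E : forall x, ev (x :: l) = scons x (ev l)).
  { intros x. apply functional_extensionality. intros [|n]; reflexivity. }
  destruct (elem_witness P M N (ev l) HP HE) as (x & Hx' & Hp).
  - now apply ev_in.
  - destruct Hx as (x & Hx & Hp). exists x. now rewrite <- E.
  - exists x. now rewrite E.
Qed.

(** The structures can only disagree at a quantifier. *)
Lemma tarski_vaught M N : M ⊆ N ->
  (forall phi e i, env_in M e -> (exists x, x ∈ N /\ sat N (update e i x) phi) ->
     exists x, x ∈ M /\ sat N (update e i x) phi) ->
  elem_sub M N.
Proof.
  intros Hs HT. split; auto.
  induction phi as [i j|i j|p IH|p IHp q IHq|i p IH]; simpl; intros e He; try tauto.
  - now rewrite IH.
  - now rewrite IHp, IHq.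
  - assert (Hu : forall x, x ∈ M -> env_in M (update e i x)).
    { intros x Hx n. unfold update. destruct (Nat.eqb n i); auto. }
    split.
    + intros HM x Hx. apply NNPP. intros N'.
      destruct (HT (fNot p) e i He) as (y & Hy & Hn); [now exists x|].
      apply Hn. apply IH; auto.
    + intros HN x Hx. apply IH; auto.
Qed.

End Definability.

(** Reads off the formula from the shape of a relativized predicate. *)
Ltac dfn :=
  cbv beta;
  lazymatch goal with
  | |- Dfn (fun M e => upair_in M _ _ _) => apply upair_in_dfn
  | |- Dfn (fun M e => rel_in M _ _ _) => apply rel_in_dfn
  | |- Dfn (fun M e => sat M e _) => apply dfn_sat
  | |- Dfn (fun M e => _ ∈ _) => apply dfn_mem
  | |- Dfn (fun M e => _ = _) => apply dfn_eq
  | |- Dfn (fun M e => ~ _) => apply dfn_not; dfn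
  | |- Dfn (fun M e => _ /\ _) => apply dfn_and; dfn
  | |- Dfn (fun M e => _ \/ _) => apply dfn_or; dfn
  | |- Dfn (fun M e => _ <-> _) => apply dfn_iff; dfn
  | |- Dfn (fun M e => exists x, _) => apply dfn_ex; dfn
  | |- Dfn (fun M e => forall x, x ∈ M -> _) => apply dfn_all; dfn
  | |- Dfn (fun M e => _ -> _) => apply dfn_imp; dfn
  | _ => idtac
  end.

(** * Elementary substructures of [H theta] *)

Section InH.
Context {U : ZFC}.
Implicit Types a b c d f k p r x y z M : U.
Context {theta : U} (Hr : regular theta).

Lemma upair_in_H p a b : p ∈ H theta -> a ∈ H theta -> b ∈ H theta ->
  (upair_in (H theta) p a b <-> p = upair a b).
Proof.
  intros Hp Ha Hb. split.
  - intros Hu. apply ext. intros z. rewrite upairE. split; intros Hz.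
    + apply Hu; auto. now apply (H_trans Hr p).
    + apply Hu; auto. destruct Hz as [-> | ->]; auto.
  - intros -> z _. apply upairE.
Qed.

Lemma rel_in_H r a b : r ∈ H theta -> a ∈ H theta -> b ∈ H theta ->
  (rel_in (H theta) r a b <-> ⟨a, b⟩ ∈ r).
Proof.
  intros Hr' Ha Hb. split.
  - intros (p & s & t & Hp & Hs & Ht & Hpr & Es & Et & Ep).
    apply upair_in_H in Es, Et, Ep; auto. subst. exact Hpr.
  - intros Hp. exists ⟨a, b⟩, (upair a a), (upair a b).
    repeat split; auto using H_upair, H_opair; apply upair_in_H; auto using H_upair, H_opair.
Qed.

Lemma fun_value_H f d x : f ∈ H theta -> fun_on f d -> x ∈ d ->
  x ∈ H theta /\ app f x ∈ H theta /\ ⟨x, app f x⟩ ∈ f.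
Proof.
  intros Hf Hfd Hx. assert (Hp : ⟨x, app f x⟩ ∈ f) by now apply (fun_pair f d).
  destruct (H_opair_inv Hr x (app f x)); auto. now apply (H_trans Hr f).
Qed.

Lemma ex_value_H f d x (P : U -> Prop) : f ∈ H theta -> fun_on f d -> x ∈ d ->
  ((exists y, y ∈ H theta /\ (rel_in (H theta) f x y /\ P y)) <-> P (app f x)).
Proof.
  intros Hf Hfd Hx. destruct (fun_value_H f d x Hf Hfd Hx) as (xH & vH & Hp). split.
  - intros (y & yH & R & Hy). apply rel_in_H in R; auto.
    apply (fun_pair f d) in R as [_ ->]; auto.
  - intros Hv. exists (app f x). split; auto. split; auto. now apply rel_in_H.
Qed.

Lemma H_ZFCminus : omega ∈ theta -> models_ZFCminus (H theta).
Proof.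
  intros Hom. split.
  - intros x y Hx Hy E. apply ext. intros z. split; intros Hz.
    + apply E; auto. now apply (H_trans Hr x).
    + apply E; auto. now apply (H_trans Hr y).
  - intros x Hx (y & Hy & Hyx). destruct (foundation U x (ex_intro _ y Hyx)) as (u & Hu & Hm).
    exists u. split; [now apply (H_trans Hr x)|]. split; auto.
  - intros a b Ha Hb. exists (upair a b). split; [now apply H_upair|].
    apply upair_in_H; auto using H_upair.
  - intros x Hx. exists (bigU x). split.
    + apply H_fam; auto; [now apply H_small|]. intros y Hy. now apply (H_trans Hr x).
    + intros z Hz. rewrite bigUE. split; intros (y & Hy).
      * exists y. split; [|tauto]. now apply (H_trans Hr x).
      * exists y. tauto.
  - exists omega. split; [now apply H_ord|]. split.
    + exists empty. split; [apply (H_num Hr 0)|]. split; [apply (num_omega 0)|].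
      intros z _. rewrite emptyE. tauto.
    + intros n _ Hn. apply omegaE in Hn as [n' ->]. exists (num (S n')).
      split; [now apply H_num|]. split; [apply num_omega|]. intros z _. apply succE.
  - intros phi e a He Ha.
    exists {{ x in a | sat (H theta) (update e 0 x) phi }}.
    assert (E := sepE (fun x => sat (H theta) (update e 0 x) phi) a). split.
    + apply (H_sub Hr a); auto. intros z Hz. now apply E in Hz.
    + intros x _. apply E.
  - intros phi e a He Ha HC.
    destruct (class_choice (fun x y => y ∈ H theta /\
                sat (H theta) (update (update e 0 x) 1 y) phi) a) as [W HW].
    { intros x Hx. apply HC; auto. now apply (H_trans Hr a). }
    exists (img W a). split.
    + apply H_img; auto; [now apply H_small|]. intros x Hx. now apply HW.
    + intros x _ Hx. exists (W x). split; [now apply HW|]. split; [now apply img_in|now apply HW].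
  - intros x Hx. destruct (well_ordering x) as (o & Oo & Ho).
    apply equinumerous_le in Ho as [(h & h1 & h2) _].
    set (r := {{ p in prod x x | exists y z, p = ⟨y, z⟩ /\ h y ∈ h z }}).
    assert (Er : forall y z, ⟨y, z⟩ ∈ r <-> y ∈ x /\ z ∈ x /\ h y ∈ h z).
    { intros y z. unfold r. rewrite (sepE (fun p => exists y z, p = ⟨y, z⟩ /\ h y ∈ h z)).
      rewrite prod_in. split.
      - intros ((Hy & Hz) & y' & z' & E & Hh). apply opair_inj in E as [-> ->]. auto.
      - intros (Hy & Hz & Hh). split; eauto. }
    assert (HrH : r ∈ H theta).
    { apply (H_sub Hr (prod x x)); [now apply H_prod|]. intros p Hp.
      now apply (sepE (fun p => exists y z, p = ⟨y, z⟩ /\ h y ∈ h z)) in Hp. }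
    assert (Oh : forall y, y ∈ x -> is_ordinal (h y)) by (intros y Hy; apply (ord_in o); auto).
    exists r. split; auto. split; [|split; [|split]].
    + intros a Ha _ Ha'. apply rel_in_H, Er in Ha'; auto. now apply (no_self (h a)).
    + intros a b c Ha Hb Hc Hax Hbx Hcx. rewrite !rel_in_H, !Er by auto.
      intros (_ & _ & H1) (_ & _ & H2). repeat split; auto. now apply (ord_trans (h c) (h b)); auto.
    + intros a b Ha Hb Hax Hbx. rewrite !rel_in_H, !Er by auto.
      destruct (ord_total (h a) (h b)) as [E|[E|E]]; auto.
    + intros y Hy Hyx (z & Hz & Hzy).
      assert (Hyx' : y ⊆ x) by (intros w Hw; apply Hyx; auto; now apply (H_trans Hr y)).
      destruct (ord_least (fun a => exists w, w ∈ y /\ h w = a)) as (a & Oa & (w & Hw & <-) & La).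
      { exists (h z). split; [now apply Oh, Hyx'|]. eauto. }
      assert (wH : w ∈ H theta) by now apply (H_trans Hr y).
      exists w. split; auto. split; auto.
      intros v Hv Hvy. rewrite rel_in_H, Er by auto.
      intros (_ & _ & Hh). apply (La _ Hh). eauto.
Qed.

(** Each axiom is a definable statement, and so are the instances of the schemes for
    given parameters. *)
Lemma elem_ZFCminus M : omega ∈ theta -> elem_sub M (H theta) -> empty ∈ M ->
  models_ZFCminus M.
Proof.
  intros Hom HE H0. destruct (H_ZFCminus Hom) as [Z1 Z2 Z3 Z4 Z5 Z6 Z7 Z8].
  assert (T : forall P, Dfn P -> P (H theta) (ev []) -> P M (ev [])).
  { intros P HP. apply (elem_dfn P M (H theta)); auto. apply ev_in; auto. }
  split.
  - intros x y Hx Hy. revert x Hx y Hy.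
    apply (T (fun M _ => forall x, x ∈ M -> forall y, y ∈ M ->
      (forall z, z ∈ M -> (z ∈ x <-> z ∈ y)) -> x = y)); [dfn|].
    intros x Hx y Hy. now apply Z1.
  - apply (T (fun M _ => forall x, x ∈ M -> (exists y, y ∈ M /\ y ∈ x) ->
      exists y, y ∈ M /\ y ∈ x /\ forall z, z ∈ M -> z ∈ y -> ~ z ∈ x)); [dfn|exact Z2].
  - intros a b Ha Hb. revert a Ha b Hb.
    apply (T (fun M _ => forall a, a ∈ M -> forall b, b ∈ M ->
      exists p, p ∈ M /\ upair_in M p a b)); [dfn|]. intros a Ha b Hb. now apply Z3.
  - apply (T (fun M _ => forall x, x ∈ M -> exists u, u ∈ M /\
      forall z, z ∈ M -> (z ∈ u <-> exists y, y ∈ M /\ y ∈ x /\ z ∈ y))); [dfn|exact Z4].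
  - apply (T (fun M _ => exists w, w ∈ M /\
      ((exists e, e ∈ M /\ e ∈ w /\ forall z, z ∈ M -> ~ z ∈ e) /\
      (forall n, n ∈ M -> n ∈ w -> exists s, s ∈ M /\ s ∈ w /\
         forall z, z ∈ M -> (z ∈ s <-> z ∈ n \/ z = n))))); [dfn|exact Z5].
  - intros phi e a He Ha.
    assert (HP : Dfn (fun M e => exists b, b ∈ M /\ forall x, x ∈ M ->
      (x ∈ b <-> x ∈ e 0 /\ sat M (update (fun n => e (S n)) 0 x) phi))).
    { dfn. apply (dfn_rename (fun M e => sat M e phi) (fun n => match n with 0 => 0 | S m => S (S (S n)) end)
        (fun e => update (fun n => e (S (S (S n)))) 0 (e 0))); [dfn|].
      intros e' [|n]; reflexivity. }
    apply (elem_dfn _ M (H theta) (scons a e) HP HE).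
    + intros [|n]; simpl; auto.
    + simpl. apply Z6; [|now apply HE]. intros n. apply HE, He.
  - intros phi e a He Ha.
    assert (HP : Dfn (fun M e =>
     (forall x, x ∈ M -> x ∈ e 0 ->
       exists y, y ∈ M /\ sat M (update (update (fun n => e (S n)) 0 x) 1 y) phi) ->
     exists b, b ∈ M /\ forall x, x ∈ M -> x ∈ e 0 -> exists y, y ∈ M /\
        (y ∈ b /\ sat M (update (update (fun n => e (S n)) 0 x) 1 y) phi))).
    { dfn.
      - apply (dfn_rename (fun M e => sat M e phi)
          (fun n => match n with 0 => 1 | 1 => 0 | _ => S (S (S n)) end)
          (fun e => update (update (fun n => e (S (S (S n)))) 0 (e 1)) 1 (e 0))); [dfn|].
        intros e' [|[|n]]; reflexivity.
      - apply (dfn_rename (fun M e => sat M e phi)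
          (fun n => match n with 0 => 1 | 1 => 0 | _ => S (S (S (S n))) end)
          (fun e => update (update (fun n => e (S (S (S (S n))))) 0 (e 1)) 1 (e 0))); [dfn|].
        intros e' [|[|n]]; reflexivity. }
    apply (elem_dfn _ M (H theta) (scons a e) HP HE).
    + intros [|n]; simpl; auto.
    + simpl. apply Z7; [|now apply HE]. intros n. apply HE, He.
  - intros x Hx.
    destruct (T (fun M _ => forall x, x ∈ M -> exists r, r ∈ M /\
      ((forall a, a ∈ M -> a ∈ x -> ~ rel_in M r a a) /\
       (forall a, a ∈ M -> forall b, b ∈ M -> forall c, c ∈ M -> a ∈ x -> b ∈ x -> c ∈ x ->
          rel_in M r a b -> rel_in M r b c -> rel_in M r a c) /\
       (forall a, a ∈ M -> forall b, b ∈ M -> a ∈ x -> b ∈ x ->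
          rel_in M r a b \/ a = b \/ rel_in M r b a) /\
       (forall y, y ∈ M -> (forall z, z ∈ M -> z ∈ y -> z ∈ x) ->
          (exists z, z ∈ M /\ z ∈ y) ->
          exists a, a ∈ M /\ (a ∈ y /\ forall z, z ∈ M -> z ∈ y -> ~ rel_in M r z a)))))
      with (x := x) as (r & Hr' & W1 & W2 & W3 & W4); [dfn| |auto|].
    + intros y Hy. destruct (Z8 y Hy) as (r & Hr' & W1 & W2 & W3 & W4).
      exists r. split; auto. split; [exact W1|]. split; [|split; [|exact W4]].
      * intros a Ha b Hb c Hc. now apply W2.
      * intros a Ha b Hb. now apply W3.
    + exists r. split; auto. split; [exact W1|]. split; [|split; [|exact W4]].
      * intros a b c Ha Hb Hc. now apply W2.
      * intros a b Ha Hb. now apply W3.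
Qed.

(** * Definable closure *)

Context {M : U} (HE : elem_sub M (H theta)) (H0 : empty ∈ M).

Lemma elem_in_H x : x ∈ M -> x ∈ H theta.
Proof. apply (proj1 HE). Qed.

(** By extensionality, a set is defined by any description of its elements. *)
Lemma elem_set_env P e y : Dfn P -> env_in M e -> y ∈ H theta ->
  (forall z, z ∈ H theta -> (z ∈ y <-> P (H theta) (scons z e))) -> y ∈ M.
Proof.
  intros HP He Hy E.
  assert (HQ : Dfn (fun K e => forall z, z ∈ K ->
    (z ∈ e 0 <-> P K (scons z (fun n => e (S n)))))).
  { dfn. apply (dfn_rename P (fun n => match n with 0 => 0 | S m => S n end)
      (fun e => scons (e 0) (fun n => e (S (S n))))); auto.
    intros e' [|n]; reflexivity. }
  destruct (elem_witness _ M (H theta) e HQ HE He) as (y' & Hy' & E').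
  - exists y. split; [exact Hy|]. intros z Hz. now apply E.
  - replace y with y'; auto. apply ext. intros z.
    assert (H1 : z ∈ H theta -> z ∈ y' <-> z ∈ y).
    { intros Hz. rewrite (E z Hz). apply (E' z Hz). }
    split; intros Hz; apply H1; auto.
    + apply (H_trans Hr y'); auto. now apply (proj1 HE).
    + now apply (H_trans Hr y).
Qed.

Lemma elem_set P l y : Dfn P -> Forall (fun x => x ∈ M) l -> y ∈ H theta ->
  (forall z, z ∈ H theta -> (z ∈ y <-> P (H theta) (ev (z :: l)))) -> y ∈ M.
Proof.
  intros HP Hl Hy E. apply (elem_set_env P (ev l)); auto. now apply ev_in.
Qed.

Lemma elem_diff a b : a ∈ M -> b ∈ M -> diff a b ∈ M.
Proof.
  intros Ha Hb. apply (elem_set (fun K e => e 0 ∈ e 1 /\ ~ e 0 ∈ e 2) [a; b]).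
  - dfn.
  - auto.
  - apply (H_sub Hr a); [now apply elem_in_H|]. intros z Hz. now apply diffE in Hz.
  - intros z _. apply diffE.
Qed.

Lemma elem_value f x y : f ∈ M -> x ∈ M -> ⟨x, y⟩ ∈ f ->
  (forall z, ⟨x, z⟩ ∈ f -> z = y) -> y ∈ M.
Proof.
  intros Hf Hx Hp Hu.
  assert (Hf' := elem_in_H f Hf). assert (Hx' := elem_in_H x Hx).
  assert (Hy : y ∈ H theta).
  { now apply (H_opair_inv Hr x y), (H_trans Hr f). }
  destruct (elem_witness_ev (fun K e => rel_in K (e 1) (e 2) (e 0)) M (H theta) [f; x])
    as (z & Hz & E); auto.
  - dfn.
  - exists y. split; auto. now apply rel_in_H.
  - apply rel_in_H in E; auto; [|now apply elem_in_H]. apply Hu in E. now subst.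
Qed.

Lemma elem_app f d x : f ∈ M -> fun_on f d -> x ∈ M -> x ∈ d -> app f x ∈ M.
Proof.
  intros Hf Hfd Hx Hd. apply (elem_value f x); auto.
  - now apply (fun_pair f d).
  - intros z Hz. now apply (fun_pair f d) in Hz.
Qed.

(** Having an enumeration is a property of [k] and [y] that is first-order in [H theta]. *)
Lemma elem_enum k y : k ∈ M -> y ∈ M -> inj_le y k ->
  exists t, t ∈ M /\ (forall x, x ∈ y -> exists i, i ∈ k /\ ⟨i, x⟩ ∈ t) /\
    (forall i x x', ⟨i, x⟩ ∈ t -> ⟨i, x'⟩ ∈ t -> x = x').
Proof.
  intros Hk Hy (F & F1 & F2).
  set (P := fun (K : U) (e : nat -> U) =>
    (forall x, x ∈ K -> x ∈ e 2 -> exists i, i ∈ K /\ (i ∈ e 1 /\ rel_in K (e 0) i x)) /\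
    (forall i, i ∈ K -> forall x, x ∈ K -> forall x', x' ∈ K ->
       rel_in K (e 0) i x -> rel_in K (e 0) i x' -> x = x')).
  assert (HP : Dfn P) by (unfold P; dfn).
  assert (yH := elem_in_H y Hy). assert (kH := elem_in_H k Hk).
  set (s := img (fun x => ⟨F x, x⟩) y).
  assert (Es : forall i x, ⟨i, x⟩ ∈ s <-> x ∈ y /\ i = F x).
  { intros i x. unfold s. rewrite imgE. split.
    - intros (x' & Hx & E). apply opair_inj in E as [-> ->]. auto.
    - intros [Hx ->]. eauto. }
  assert (sH : s ∈ H theta).
  { apply H_img; auto; [now apply H_small|]. intros x Hx. apply H_opair; auto.
    - apply (H_trans Hr k); auto.
    - apply (H_trans Hr y); auto. }
  destruct (elem_witness_ev P M (H theta) [k; y] HP HE H0) as (t & Ht & Ht1 & Ht2); auto.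
  - exists s. split; auto. split; simpl.
    + intros x Hx Hxy. exists (F x). split; [|split]; auto.
      * apply (H_trans Hr k); auto.
      * apply rel_in_H; auto; [apply (H_trans Hr k); auto|]. now apply Es.
    + intros i Hi x Hx x' Hx'. unfold ev; simpl. rewrite !rel_in_H, !Es by auto.
      intros [H1 ->] [H2 E]. now apply F2.
  - unfold ev in Ht1, Ht2; simpl in Ht1, Ht2.
    assert (tH := elem_in_H t Ht). exists t. split; auto. split.
    + intros x Hx. assert (xH : x ∈ H theta) by now apply (H_trans Hr y).
      destruct (Ht1 x xH Hx) as (i & Hi & Hik & Hix). exists i. split; auto.
      now apply rel_in_H in Hix.
    + intros i x x' Hx Hx'.
      destruct (H_opair_inv Hr i x) as [iH xH]; [now apply (H_trans Hr t)|].
      destruct (H_opair_inv Hr i x') as [_ xH']; [now apply (H_trans Hr t)|].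
      apply (Ht2 i iH x xH x' xH'); now apply rel_in_H.
Qed.

Lemma elem_subset k y : k ∈ M -> k ⊆ M -> y ∈ M -> inj_le y k -> y ⊆ M.
Proof.
  intros Hk Hkm Hy L x Hx. destruct (elem_enum k y Hk Hy L) as (t & Ht & Ht1 & Ht2).
  destruct (Ht1 x Hx) as (i & Hi & Hix). apply (elem_value t i x); eauto.
Qed.

End InH.

(** * A first-order description of winning strategies *)

Section Tree.
Context {U : ZFC}.
Implicit Types (K S mm GG k w b m G F q x : U).

Definition functional_in K f :=
  forall x, x ∈ K -> forall y, y ∈ K -> forall z, z ∈ K ->
    rel_in K f x y -> rel_in K f x z -> y = z.

(** The moves [F] of the judge that the coded strategy has to answer, where [m] is the
    last model and [G] the union of the earlier filters. All of them are legal, and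
    the trace of a derived ultrafilter on [m] is one of them. Directedness and
    unboundedness together stand for finite intersections having size [k]. *)
Definition answer_in K k m G F :=
  (forall A, A ∈ K -> A ∈ F -> forall z, z ∈ K -> z ∈ A -> z ∈ k) /\
  (forall A, A ∈ K -> A ∈ F -> forall B, B ∈ K -> B ∈ F ->
     exists C, C ∈ K /\ (C ∈ F /\ forall z, z ∈ K -> z ∈ C -> z ∈ A /\ z ∈ B)) /\
  (forall A, A ∈ K -> A ∈ F -> forall c, c ∈ K -> c ∈ k ->
     exists d, d ∈ K /\ (d ∈ A /\ ~ d ∈ c)) /\
  (forall A, A ∈ K -> A ∈ m -> (forall z, z ∈ K -> z ∈ A -> z ∈ k) ->
     A ∈ F \/ exists B, B ∈ K /\ (B ∈ F /\ forall z, z ∈ K -> (z ∈ B <-> z ∈ k /\ ~ z ∈ A))) /\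
  (forall A, A ∈ K -> A ∈ G -> A ∈ F).

Definition steps_in K S mm GG k :=
  forall q, q ∈ K -> forall m, m ∈ K -> forall G, G ∈ K ->
    rel_in K mm q m -> rel_in K GG q G ->
    (exists t, t ∈ K /\ (functional_in K t /\
       forall x, x ∈ K -> x ∈ m -> exists i, i ∈ K /\ (i ∈ k /\ rel_in K t i x))) /\
    (forall A, A ∈ K -> A ∈ m -> forall B, B ∈ K -> B ∈ m ->
       exists C, C ∈ K /\ (C ∈ m /\ forall z, z ∈ K -> (z ∈ C <-> z ∈ A /\ ~ z ∈ B))) /\
    k ∈ m /\
    forall F, F ∈ K -> answer_in K k m G F ->
      exists q', q' ∈ K /\ exists m', m' ∈ K /\
        (rel_in K S q q' /\ rel_in K mm q' m' /\ rel_in K GG q' F /\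
         forall x, x ∈ K -> x ∈ m -> x ∈ m').

Definition along K w b mm x :=
  exists i, i ∈ K /\ (i ∈ w /\ exists q, q ∈ K /\ exists m, m ∈ K /\
    (rel_in K b i q /\ rel_in K mm q m /\ x ∈ m)).

(** [X] is a sequence of members of the final filter and [D] its diagonal intersection. *)
Definition not_normal_in K k w b mm GG :=
  exists X, X ∈ K /\ exists D, D ∈ K /\
    (along K w b mm X /\ along K w b mm D /\ functional_in K X /\
     (forall i, i ∈ K -> i ∈ k -> exists A, A ∈ K /\ (rel_in K X i A /\ along K w b GG A)) /\
     (forall a, a ∈ K -> (a ∈ D <-> a ∈ k /\ forall i, i ∈ K -> i ∈ a ->
        exists A, A ∈ K /\ (rel_in K X i A /\ a ∈ A))) /\
     ~ along K w b GG D).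

(** [Z] is a set of functions that represents a set without minimal element in the
    ultrapower by the final filter. *)
Definition ill_founded_in K k w b mm GG :=
  exists Z, Z ∈ K /\ ((exists f, f ∈ K /\ f ∈ Z) /\
    forall f, f ∈ K -> f ∈ Z ->
      along K w b mm f /\ functional_in K f /\
      (forall x, x ∈ K -> x ∈ k -> exists y, y ∈ K /\ rel_in K f x y) /\
      exists g, g ∈ K /\ (g ∈ Z /\ exists A, A ∈ K /\ (along K w b GG A /\
        forall x, x ∈ K -> x ∈ A -> exists u, u ∈ K /\ exists v, v ∈ K /\
          (rel_in K g x u /\ rel_in K f x v /\ u ∈ v)))).

(** The structure [K] believes that a winning strategy of the challenger is coded as
    follows. Positions are nodes; [mm] and [GG] attach to a node the challenger's next
    model and the union of the judge's filters so far; [S] leads from a node to its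
    successors, at least one for each answer of the judge; and every branch of length [w] from
    [c0] is lost by the judge. *)
Definition strategy_in K (c0 : U) S mm GG k w :=
  functional_in K mm /\ functional_in K GG /\
  (exists m, m ∈ K /\ exists G, G ∈ K /\
     (rel_in K mm c0 m /\ rel_in K GG c0 G /\ forall x, x ∈ K -> ~ x ∈ G)) /\
  steps_in K S mm GG k /\
  forall b, b ∈ K -> functional_in K b ->
    (forall i, i ∈ K -> i ∈ w -> (forall x, x ∈ K -> ~ x ∈ i) -> rel_in K b i c0) ->
    (forall i, i ∈ K -> i ∈ w -> forall i', i' ∈ K -> i' ∈ w ->
       (forall x, x ∈ K -> (x ∈ i' <-> x ∈ i \/ x = i)) ->
       exists q, q ∈ K /\ exists q', q' ∈ K /\
         (rel_in K b i q /\ rel_in K b i' q' /\ rel_in K S q q')) ->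
    not_normal_in K k w b mm GG \/ ill_founded_in K k w b mm GG.

Lemma strategy_dfn :
  Dfn (fun K (e : nat -> U) => strategy_in K (e 0) (e 1) (e 2) (e 3) (e 4) (e 5)).
Proof.
  unfold strategy_in, not_normal_in, ill_founded_in, along, steps_in, answer_in, functional_in.
  dfn.
Qed.

Lemma dependent_choice {T : Type} (I : T -> Prop) (R : T -> T -> Prop) :
  (forall a, I a -> exists a', I a' /\ R a a') -> forall a0, I a0 ->
  exists f : nat -> T, f 0 = a0 /\ forall n, I (f n) /\ R (f n) (f (Datatypes.S n)).
Proof.
  intros HR a0 H0.
  set (next := fun a => epsilon (inhabits a0) (fun a' => I a' /\ R a a')).
  set (f := fix f n := match n with 0 => a0 | Datatypes.S n => next (f n) end).
  assert (Hn : forall a, I a -> I (next a) /\ R a (next a)).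
  { intros a Ha. apply (epsilon_spec (inhabits a0) (fun a' => I a' /\ R a a')). auto. }
  assert (HI : forall n, I (f n)) by (induction n as [|n IH]; simpl; auto; now apply Hn).
  exists f. split; auto. intros n. split; auto. simpl. now apply Hn.
Qed.

End Tree.

(** * Powerset preserving embeddings *)

Section Embedding.
Context {U : ZFC}.
Implicit Types a b c d f r x y z A B X : U.
Context {k theta : U} (Hk : regular k) (Hr : regular theta) (Hkt : k ∈ theta).
Context {M j N : U} (Hw : weak_model k M) (HE : elem_sub M (H theta))
  (Hj : elem_embedding j M N) (Hpp : powerset_preserving k j M N).

Lemma emb_k_sub : k ⊆ M.
Proof. apply Hw. Qed.

Lemma emb_k_in : k ∈ M.
Proof. apply Hw. Qed.

Lemma emb_empty : empty ∈ M.
Proof. apply emb_k_sub, (regular_num k 0 Hk). Qed.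

Lemma emb_in x : x ∈ M -> app j x ∈ N.
Proof. apply (proj2 (proj1 Hj)). Qed.

Lemma emb_fix a : a ∈ k -> app j a = a.
Proof. intros Ha. apply Hpp; auto. now apply emb_k_sub. Qed.

Lemma emb_small_in a : a ∈ k -> a ∈ N.
Proof. intros Ha. rewrite <- (emb_fix a Ha). now apply emb_in, emb_k_sub. Qed.

Lemma emb_pow A : A ⊆ k -> (A ∈ M <-> A ∈ N).
Proof.
  intros HA. destruct Hpp as (_ & E & _).
  assert (H1 : A ∈ cap (pow k) M <-> A ∈ cap (pow k) N) by now rewrite E.
  rewrite !capE, powE in H1. tauto.
Qed.

Lemma emb_k_N : k ∈ N.
Proof. apply emb_pow; auto. apply emb_k_in. Qed.

Lemma emb_transfer P l : Dfn P -> Forall (fun x => x ∈ M) l ->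
  P (H theta) (ev l) -> P N (fun n => app j (ev l n)).
Proof.
  intros HP Hl Hp. assert (He : env_in M (ev l)) by (apply ev_in; auto using emb_empty).
  apply (embedding_dfn P j M N); auto. now apply (elem_dfn P M (H theta)).
Qed.

Lemma emb_mem x y : x ∈ M -> y ∈ M -> (x ∈ y <-> app j x ∈ app j y).
Proof.
  intros Hx Hy. split.
  - intros Hxy. apply (emb_transfer (fun _ e => e 0 ∈ e 1) [x; y]); auto. dfn.
  - intros Hxy. apply NNPP. intros Nxy.
    apply (emb_transfer (fun _ e => ~ e 0 ∈ e 1) [x; y]) in Nxy; auto. dfn.
Qed.

Lemma emb_inj x y : x ∈ M -> y ∈ M -> app j x = app j y -> x = y.
Proof.
  intros Hx Hy E. apply NNPP. intros Nxy.
  apply (emb_transfer (fun _ e => ~ e 0 = e 1) [x; y]) in Nxy; auto. dfn.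
Qed.

Lemma emb_rel f x y : f ∈ M -> x ∈ M -> y ∈ M -> ⟨x, y⟩ ∈ f ->
  rel_in N (app j f) (app j x) (app j y).
Proof.
  intros Hf Hx Hy Hp.
  apply (emb_transfer (fun K e => rel_in K (e 0) (e 1) (e 2)) [f; x; y]); auto.
  - dfn.
  - apply rel_in_H; auto; now apply HE.
Qed.

(** [N] believes that [k] and [j k] are ordinals, hence comparable; [j k] is not below
    [k], because the ordinals below [k] are fixed. *)
Lemma emb_k_jk : k ∈ app j k.
Proof.
  assert (Ok := regular_ord k Hk).
  assert (C : k ∈ app j k \/ k = app j k \/ app j k ∈ k).
  { set (P := fun (K : U) (e : nat -> U) => forall x, x ∈ K ->
      (forall y, y ∈ K -> y ∈ x -> forall z, z ∈ K -> z ∈ y -> z ∈ x) ->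
      (forall y, y ∈ K -> y ∈ x -> forall z, z ∈ K -> z ∈ y ->
         forall w, w ∈ K -> w ∈ z -> w ∈ y) ->
      x ∈ e 0 \/ x = e 0 \/ e 0 ∈ x).
    assert (HP : Dfn P) by (unfold P; dfn).
    apply (emb_transfer P [k] HP) with (x := k); auto using emb_k_in, emb_k_N.
    - intros x Hx T1 T2. unfold ev; simpl. apply ord_total; auto. split.
      + intros y Hy z Hz. assert (yH : y ∈ H theta) by now apply (H_trans Hr x).
        apply (T1 y yH Hy z); auto. now apply (H_trans Hr y).
      + intros y Hy z Hz w Hzw. assert (yH : y ∈ H theta) by now apply (H_trans Hr x).
        assert (zH : z ∈ H theta) by now apply (H_trans Hr y).
        apply (T2 y yH Hy z zH Hz w); auto. now apply (H_trans Hr z).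
    - intros y _ Hy z _ Hz. now apply (ord_trans k y).
    - intros y _ Hy z _ Hz w _ Hzw. apply (ord_trans y z); auto. now apply (ord_in k). }
  destruct C as [C|[C|C]]; auto; exfalso.
  - destruct Hpp as [(_ & _ & H1 & _) _]. auto.
  - assert (E : app j (app j k) = app j k) by now apply emb_fix.
    apply emb_inj in E; auto using emb_k_in, emb_k_sub.
    rewrite E in C. now apply (no_self k).
Qed.

(** [N] satisfies the definition of [j A], with the images of the parameters. *)
Lemma emb_los P l A : Dfn P -> Forall (fun x => x ∈ M) l -> A ∈ M ->
  (forall z, z ∈ H theta -> (z ∈ A <-> z ∈ k /\ P (H theta) (ev (z :: l)))) ->
  (k ∈ app j A <-> P N (scons k (fun n => app j (ev l n)))).
Proof.
  intros HP Hl HA E.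
  set (Q := fun (K : U) (e : nat -> U) => forall z, z ∈ K ->
    (z ∈ e 0 <-> z ∈ e 1 /\ P K (scons z (fun n => e (S (S n)))))).
  assert (HQ : Dfn Q).
  { unfold Q. dfn. apply (dfn_rename P (fun n => match n with 0 => 0 | S m => S (S n) end)
      (fun e => scons (e 0) (fun n => e (S (S (S n)))))); auto.
    intros e [|n]; reflexivity. }
  assert (HN : Q N (fun n => app j (ev (A :: k :: l) n))).
  { apply emb_transfer; [exact HQ|auto using emb_k_in|]. intros z Hz. exact (E z Hz). }
  assert (HN' := HN k emb_k_N). unfold ev at 1 2 in HN'. simpl in HN'.
  rewrite HN'. split; [tauto|]. intros Hp. split; auto using emb_k_jk.
Qed.

(** Weak amenability: [N] can define subsets of [k] with [k] as a parameter, and by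
    powerset preservation they are in [M]. *)
Lemma emb_amenable P l : Dfn P -> Forall (fun x => x ∈ M) l ->
  exists B, B ∈ M /\ B ⊆ k /\ forall a, a ∈ k ->
    (a ∈ B <-> P N (scons a (scons k (fun n => app j (ev l n))))).
Proof.
  intros HP Hl.
  set (Q := fun (K : U) (e : nat -> U) => forall y, y ∈ K -> forall a, a ∈ K ->
    exists b, b ∈ K /\ forall x, x ∈ K -> (x ∈ b <-> x ∈ a /\ P K (scons x (scons y e)))).
  assert (HQ : Dfn Q).
  { unfold Q. dfn. apply (dfn_rename P (fun n => match n with 0 => 0 | 1 => 3 | _ => S (S n) end)
      (fun e => scons (e 0) (scons (e 3) (fun n => e (S (S (S (S n)))))))); auto.
    intros e [|[|n]]; reflexivity. }
  destruct (emb_transfer Q l HQ Hl) with (y := k) (a := k) as (B & HB & EB); auto using emb_k_N.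
  - intros y Hy a Ha.
    assert (E := sepE (fun x => P (H theta) (scons x (scons y (ev l)))) a).
    exists {{ x in a | P (H theta) (scons x (scons y (ev l))) }}. split.
    + apply (H_sub Hr a); auto. intros z Hz. now apply E in Hz.
    + intros x _. apply E.
  - assert (HBk : B ⊆ k).
    { destruct Hpp as (_ & _ & H3). apply H3; auto. intros z Hz Hzb. now apply EB in Hzb. }
    exists B. split; [now apply emb_pow|]. split; auto.
    intros a Ha. rewrite EB by now apply emb_small_in. tauto.
Qed.

Definition derived A := A ∈ M /\ A ⊆ k /\ k ∈ app j A.

Lemma derived_diff A B : A ∈ M -> B ∈ M -> A ⊆ k -> B ⊆ k ->
  (derived (diff A B) <-> derived A /\ ~ derived B).
Proof.
  intros HA HB HAk HBk.
  assert (HD : diff A B ∈ M) by (apply (elem_diff Hr); auto using emb_empty).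
  assert (E : k ∈ app j (diff A B) <-> k ∈ app j A /\ ~ k ∈ app j B).
  { apply (emb_los (fun K e => e 0 ∈ e 1 /\ ~ e 0 ∈ e 2) [A; B]); auto.
    - dfn.
    - intros z _. rewrite diffE. unfold ev; simpl. split; [|tauto].
      intros [H1 H2]. auto. }
  unfold derived. rewrite E. assert (diff A B ⊆ k); [|tauto].
  intros z Hz. apply diffE in Hz as [Hz _]. auto.
Qed.

Lemma derived_k : derived k.
Proof. split; [apply emb_k_in|]. split; auto. apply emb_k_jk. Qed.

Lemma derived_measures A : A ∈ M -> A ⊆ k -> derived A \/ derived (diff k A).
Proof.
  intros HA HAk. destruct (classic (derived A)) as [|Na]; auto. right.
  apply derived_diff; auto using emb_k_in, derived_k.
Qed.

Lemma derived_unbounded A c : derived A -> c ∈ k -> exists b, b ∈ A /\ ~ b ∈ c.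
Proof.
  intros (HA & HAk & HkA) Hc. apply NNPP. intros NA.
  assert (Hs : forall z, z ∈ A -> z ∈ c) by (intros z Hz; apply NNPP; eauto).
  assert (H1 : k ∈ app j c).
  { apply (emb_transfer (fun K e => forall z, z ∈ K -> z ∈ e 0 -> z ∈ e 1) [A; c]);
      auto using emb_k_N, emb_k_sub. dfn. }
  rewrite emb_fix in H1 by auto. apply (no_self k).
  apply (ord_trans k c); auto. now apply regular_ord.
Qed.

(** Apply weak amenability to the sequence of sets given by an enumeration of [m] in [M]. *)
Lemma derived_amenable m : m ∈ M -> inj_le m k ->
  exists F, F ∈ M /\ forall A, A ∈ F <-> A ∈ m /\ derived A.
Proof.
  intros Hm Lm. assert (Hms : m ⊆ M).
  { apply (elem_subset Hr HE emb_empty k); auto using emb_k_in, emb_k_sub. }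
  destruct (elem_enum Hr HE emb_empty k m) as (t & Ht & Ht1 & Ht2);
    auto using emb_k_in.
  destruct (emb_amenable (fun K e => exists x, x ∈ K /\ (rel_in K (e 2) (e 0) x /\ e 1 ∈ x)) [t])
    as (B & HB & HBk & EB); auto; [dfn|].
  assert (Htf : forall i, i ∈ N -> forall x, x ∈ N -> forall x', x' ∈ N ->
       rel_in N (app j t) i x -> rel_in N (app j t) i x' -> x = x').
  { apply (emb_transfer (fun K e => forall i, i ∈ K -> forall x, x ∈ K -> forall x', x' ∈ K ->
       rel_in K (e 0) i x -> rel_in K (e 0) i x' -> x = x') [t]); auto; [dfn|].
    assert (tH : t ∈ H theta) by now apply HE.
    unfold ev; simpl. intros i Hi x Hx x' Hx'. rewrite !rel_in_H by auto. apply Ht2. }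
  assert (EB' : forall i x, i ∈ k -> x ∈ m -> ⟨i, x⟩ ∈ t -> (i ∈ B <-> k ∈ app j x)).
  { intros i x Hi Hx Hix. rewrite EB by auto. unfold ev; simpl.
    assert (R : rel_in N (app j t) i (app j x)).
    { rewrite <- (emb_fix i Hi). apply emb_rel; auto using emb_k_sub. }
    split.
    - intros (y & Hy & Ry & Hky). rewrite <- (Htf i (emb_small_in i Hi) y Hy (app j x)); auto.
      now apply emb_in, Hms.
    - intros H1. exists (app j x). split; auto. now apply emb_in, Hms. }
  assert (mH : m ∈ H theta) by now apply HE.
  assert (EF := sepE derived m).
  set (F := {{ A in m | derived A }}) in *. exists F. split; auto.
  assert (BH : B ∈ H theta) by now apply HE. assert (kH : k ∈ H theta) by now apply H_ord.
  assert (tH : t ∈ H theta) by now apply HE.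
  apply (elem_set Hr HE emb_empty (fun K e => e 0 ∈ e 1 /\
    (forall z, z ∈ K -> z ∈ e 0 -> z ∈ e 4) /\
    exists i, i ∈ K /\ (i ∈ e 2 /\ rel_in K (e 3) i (e 0))) [m; B; t; k]).
  - dfn.
  - repeat constructor; auto using emb_k_in.
  - apply (H_sub Hr m); auto. intros z Hz. now apply EF in Hz.
  - intros A HA. rewrite EF. unfold ev; simpl. split.
    + intros (HAm & HAM & HAk & HkA). split; [|split]; auto.
      destruct (Ht1 A HAm) as (i & Hi & Hit). exists i.
      assert (iH : i ∈ H theta) by now apply (H_trans Hr k).
      split; [auto|]. split; [|now apply rel_in_H]. now apply (EB' i A).
    + intros (HAm & HAk & i & Hi & HiB & Hit). apply rel_in_H in Hit; auto.
      split; auto. split; auto. split.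
      * intros z Hz. apply HAk; auto. now apply (H_trans Hr A).
      * apply (EB' i A); auto.
Qed.

(** [N] sees that [k] belongs to [j D]: for [b] below [k], it belongs to the image of the
    set with index [b], which is the set with index [b = j b] in [j X]. *)
Lemma derived_normal X D : X ∈ M -> (forall b x x', ⟨b, x⟩ ∈ X -> ⟨b, x'⟩ ∈ X -> x = x') ->
  (forall b, b ∈ k -> exists A, ⟨b, A⟩ ∈ X /\ derived A) ->
  D ∈ M -> D ⊆ k ->
  (forall a, a ∈ k -> (a ∈ D <-> forall b, b ∈ a -> exists A, ⟨b, A⟩ ∈ X /\ a ∈ A)) ->
  derived D.
Proof.
  intros HX HXf HXd HD HDk ED. split; [|split]; auto.
  assert (XH : X ∈ H theta) by now apply HE.
  assert (T : k ∈ app j D <-> forall b, b ∈ N -> b ∈ k ->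
                exists A, A ∈ N /\ (rel_in N (app j X) b A /\ k ∈ A)).
  { apply (emb_los (fun K e => forall b, b ∈ K -> b ∈ e 0 ->
                exists A, A ∈ K /\ (rel_in K (e 1) b A /\ e 0 ∈ A)) [X]); auto.
    - dfn.
    - intros z Hz. unfold ev; simpl. split.
      + intros HzD. split; auto. intros b Hb Hbz.
        destruct (proj1 (ED z (HDk z HzD)) HzD b Hbz) as (A & HA & HzA).
        exists A. assert (AH : A ∈ H theta).
        { apply (H_opair_inv Hr b A), (H_trans Hr X); auto. }
        split; auto. split; auto. now apply rel_in_H.
      + intros [Hzk Hz']. apply ED; auto. intros b Hbz.
        assert (bH : b ∈ H theta) by now apply (H_trans Hr z).
        destruct (Hz' b bH Hbz) as (A & HA & R & HzA). apply rel_in_H in R; eauto. }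
  apply T. intros b _ Hb. destruct (HXd b Hb) as (A & HbA & HA & HAk & HkA).
  exists (app j A). split; [now apply emb_in|]. split; auto.
  rewrite <- (emb_fix b Hb). apply emb_rel; auto. now apply emb_k_sub.
Qed.

Definition total_fun f d :=
  (forall x, x ∈ d -> exists y, ⟨x, y⟩ ∈ f) /\
  (forall x y z, ⟨x, y⟩ ∈ f -> ⟨x, z⟩ ∈ f -> y = z).

(** The value of [j f] at [k]. It represents [f] in [N], so that [N] takes the place of the
    ultrapower by the derived ultrafilter. *)
Definition value f : U := the (fun y => y ∈ N /\ rel_in N (app j f) k y).

Lemma value_spec f : f ∈ M -> total_fun f k ->
  value f ∈ N /\ forall y, y ∈ N -> (rel_in N (app j f) k y <-> y = value f).
Proof.
  intros Hf [Hft Hfu]. assert (fH : f ∈ H theta) by now apply HE.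
  assert (kH : k ∈ H theta) by now apply H_ord.
  assert (V : value f ∈ N /\ rel_in N (app j f) k (value f)).
  { apply (the_spec (fun y => y ∈ N /\ rel_in N (app j f) k y)).
    apply (emb_transfer (fun K e => forall x, x ∈ K -> x ∈ e 1 ->
             exists y, y ∈ K /\ rel_in K (e 0) x y) [f; k]);
      auto using emb_k_in, emb_k_N, emb_k_jk; [dfn|].
    unfold ev; simpl. intros x Hx Hxk. destruct (Hft x Hxk) as [y Hp].
    assert (yH : y ∈ H theta).
    { apply (H_opair_inv Hr x), (H_trans Hr f); auto. }
    exists y. split; auto. now apply rel_in_H. }
  split; [apply V|]. intros y Hy. split; [|intros ->; apply V].
  intros R. apply (emb_transfer (fun K e => forall x, x ∈ K -> forall y, y ∈ K -> forall z, z ∈ K ->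
    rel_in K (e 0) x y -> rel_in K (e 0) x z -> y = z) [f]) with (x := k);
    auto using emb_k_N; try apply V; [dfn|].
  unfold ev; simpl. intros x Hx u Hu v Hv. rewrite !rel_in_H by auto. apply Hfu.
Qed.

Lemma value_mem f g A : f ∈ M -> total_fun f k -> g ∈ M -> total_fun g k -> derived A ->
  (forall a, a ∈ A -> exists u v, ⟨a, u⟩ ∈ g /\ ⟨a, v⟩ ∈ f /\ u ∈ v) -> value g ∈ value f.
Proof.
  intros Hf Hfk Hg Hgk (HA & HAk & HkA) Hlt.
  destruct (value_spec f Hf Hfk) as [_ Vf]. destruct (value_spec g Hg Hgk) as [_ Vg].
  assert (T : exists u, u ∈ N /\ exists v, v ∈ N /\
    (rel_in N (app j g) k u /\ rel_in N (app j f) k v /\ u ∈ v)).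
  { apply (emb_transfer (fun K e => forall x, x ∈ K -> x ∈ e 2 ->
             exists u, u ∈ K /\ exists v, v ∈ K /\
             (rel_in K (e 1) x u /\ rel_in K (e 0) x v /\ u ∈ v)) [f; g; A]);
      auto using emb_k_N; [dfn|].
    unfold ev; simpl. intros x Hx HxA.
    assert (fH : f ∈ H theta) by now apply HE. assert (gH : g ∈ H theta) by now apply HE.
    destruct (Hlt x HxA) as (u & v & Hu & Hv & Huv).
    assert (vH : v ∈ H theta).
    { apply (H_opair_inv Hr x), (H_trans Hr f); auto. }
    assert (uH : u ∈ H theta).
    { apply (H_opair_inv Hr x), (H_trans Hr g); auto. }
    exists u. split; auto. exists v. split; auto.
    rewrite !rel_in_H by auto. auto. }
  destruct T as (u & Hu & v & Hv & Ru & Rv & Huv).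
  apply Vg in Ru; auto. apply Vf in Rv; auto. now subst.
Qed.

(** * omega-Ramsey cardinals are uncountable and satisfy [k = k^{<k}] *)

(** If [k] were [omega], then [N] would take [k] for zero or a successor. *)
Lemma emb_uncountable : omega ∈ k.
Proof.
  destruct (proj1 (ord_sub omega k ord_omega (regular_ord k Hk)) (regular_omega k Hk)) as [|E]; auto.
  exfalso.
  set (P := fun (K : U) (e : nat -> U) => forall n, n ∈ K -> n ∈ e 0 ->
       (forall u, u ∈ K -> ~ u ∈ n) \/
       exists m, m ∈ K /\ forall u, u ∈ K -> (u ∈ n <-> u ∈ m \/ u = m)).
  assert (HP : Dfn P) by (unfold P; dfn).
  destruct (emb_transfer P [k] HP) with (n := k) as [C|(m & Hm & C)];
    eauto using emb_k_in, emb_k_N, emb_k_jk.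
  - intros n _ Hn. unfold ev in Hn; simpl in Hn. rewrite <- E in Hn.
    apply omegaE in Hn as [[|n'] ->].
    + left. intros u _. simpl. rewrite emptyE. tauto.
    + right. exists (num n'). split; [now apply H_num|]. intros u _. apply succE.
  - apply (C (num 0)); [|now apply regular_num].
    apply (emb_small_in). now apply regular_num.
  - assert (Hmk : m ∈ k) by (apply C; auto).
    assert (Hs : succ m ∈ k) by now apply regular_succ.
    apply C in Hs as [Hs|Hs].
    + apply (no_self m). apply (ord_trans m (succ m)); [|auto|apply succE; auto].
      apply (ord_in k); auto. now apply regular_ord.
    + apply (no_self m). rewrite <- Hs at 2. apply succE; auto.
    + now apply (emb_small_in).
Qed.

(** An injection [s] from [k] to the power set of [a] could be taken in [M]. Then [j s]
    maps [k] to a subset [B] of [a], which belongs to [M] and is fixed by [j]; so [s]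
    takes the value [B] almost everywhere, which contradicts injectivity. *)
Lemma emb_strong_limit a : a ∈ k -> small k (pow a).
Proof.
  intros Ha. apply NNPP. intros Ns.
  destruct (not_small k (pow a) (regular_cardinal k Hk) Ns) as (F & F1 & F2).
  assert (HaM : a ∈ M) by now apply (emb_k_sub).
  assert (HkM : k ∈ M) by now apply (emb_k_in).
  assert (H0 : empty ∈ M) by now apply (emb_empty).
  assert (aH : a ∈ H theta) by now apply HE. assert (kH : k ∈ H theta) by now apply HE.
  set (P := fun (K : U) (e : nat -> U) =>
    (forall i, i ∈ K -> i ∈ e 1 -> exists x, x ∈ K /\
        (rel_in K (e 0) i x /\ forall z, z ∈ K -> z ∈ x -> z ∈ e 2)) /\
    (forall i, i ∈ K -> forall x, x ∈ K -> forall x', x' ∈ K ->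
       rel_in K (e 0) i x -> rel_in K (e 0) i x' -> x = x') /\
    (forall i, i ∈ K -> forall i', i' ∈ K -> forall x, x ∈ K ->
       rel_in K (e 0) i x -> rel_in K (e 0) i' x -> i = i')).
  assert (HP : Dfn P) by (unfold P; dfn).
  assert (FH : forall i, i ∈ k -> F i ∈ H theta).
  { intros i Hi. apply (H_sub Hr a); auto. now apply powE, F1. }
  destruct (elem_witness_ev P M (H theta) [k; a] HP HE H0) as (s & Hs & PH); auto.
  { exists (lam k F).
    assert (sH : lam k F ∈ H theta).
    { apply H_lam; auto using small_elem. intros i Hi. now apply (H_trans Hr k). }
    split; auto. split; [|split]; unfold ev; simpl.
    - intros i Hi Hik. exists (F i). split; auto. split.
      + apply rel_in_H; auto. now apply lam_pair.
      + intros z _. now apply powE, F1.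
    - intros i Hi x Hx x' Hx'. rewrite !rel_in_H, !lam_pair by auto.
      intros [_ ->] [_ ->]. auto.
    - intros i Hi i' Hi' x Hx. rewrite !rel_in_H, !lam_pair by auto.
      intros [H1 ->] [H2 E]. auto. }
  assert (sH : s ∈ H theta) by now apply HE.
  assert (PN := emb_transfer P [s; k; a] HP
    ltac:(auto) PH).
  destruct PH as (PH1 & PH2 & PH3), PN as (PN1 & PN2 & _).
  unfold ev in *; simpl in *.
  assert (kN : k ∈ N) by now apply (emb_k_N).
  assert (aN : forall z, z ∈ k -> z ∈ N) by now apply (emb_small_in).
  assert (fix_ : forall z, z ∈ k -> app j z = z) by now apply (emb_fix).
  assert (ak : forall z, z ∈ a -> z ∈ k).
  { intros z Hz. apply (ord_trans k a); auto. now apply regular_ord. }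
  assert (kjk : k ∈ app j k) by now apply (emb_k_jk).
  destruct (PN1 k kN kjk) as (y & Hy & Ry & Ya). rewrite fix_ in Ya by auto.
  destruct (emb_amenable
    (fun K e => e 0 ∈ e 3 /\ exists x, x ∈ K /\ (rel_in K (e 2) (e 1) x /\ e 0 ∈ x)) [s; a])
    as (B & HB & HBk & EB); auto; [dfn|].
  unfold ev in EB; simpl in EB.
  (* [B] is the value [y] of [j s] at [k] *)
  assert (EB' : forall z, z ∈ N -> (z ∈ y <-> z ∈ app j B)).
  { assert (HBM : forall z, z ∈ k -> (z ∈ B <-> z ∈ app j B)).
    { intros z Hz. rewrite <- (fix_ z Hz) at 2. apply (emb_mem); auto.
      now apply (emb_k_sub). }
    assert (BA : forall z, z ∈ B -> z ∈ a).
    { intros z Hz. assert (Hzk := HBk z Hz). apply EB in Hz as [Hz _]; auto.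
      now rewrite fix_ in Hz. }
    assert (BAN : forall z, z ∈ N -> z ∈ app j B -> z ∈ app j a).
    { apply (emb_transfer
        (fun K e => forall z, z ∈ K -> z ∈ e 0 -> z ∈ e 1) [B; a]); [dfn|auto|].
      intros z _. apply BA. }
    intros z Hz. split.
    - intros Hzy. assert (Hza := Ya z Hz Hzy). apply HBM; auto. apply EB; auto.
      rewrite fix_ by auto. split; eauto.
    - intros Hzb. assert (Hza := BAN z Hz Hzb). rewrite fix_ in Hza by auto.
      apply HBM, EB in Hzb as [_ (x & Hx & Rx & Hzx)]; auto.
      rewrite (PN2 k kN y Hy x Hx Ry Rx). exact Hzx. }
  assert (BH : B ∈ H theta) by now apply HE.
  set (Q := fun (K : U) (e : nat -> U) =>
    exists x, x ∈ K /\ (rel_in K (e 1) (e 0) x /\ forall z, z ∈ K -> (z ∈ x <-> z ∈ e 2))).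
  assert (HQ : Dfn Q) by (unfold Q; dfn).
  set (E := {{ i in k | Q (H theta) (ev [i; s; B]) }}).
  assert (EE := sepE (fun i => Q (H theta) (ev [i; s; B])) k). fold E in EE.
  assert (HEM : E ∈ M).
  { apply (elem_set Hr HE H0 (fun K e => e 0 ∈ e 3 /\ Q K e) [s; B; k]).
    - dfn. exact HQ.
    - auto.
    - apply (H_sub Hr k); auto. intros z Hz. now apply EE in Hz.
    - intros z _. apply EE. }
  assert (DE : derived E).
  { split; auto. split; [intros z Hz; now apply EE in Hz|].
    apply (emb_los Q [s; B]); auto.
    exists y. unfold ev; simpl. auto. }
  assert (Val : forall i, i ∈ E -> i ∈ k /\ rel_in (H theta) s i B).
  { intros i Hi. apply EE in Hi as [Hi (x & Hx & Rx & Ex)]. split; auto.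
    replace B with x; auto. apply ext. intros z. split; intros Hz; apply Ex; auto.
    - now apply (H_trans Hr x).
    - now apply (H_trans Hr B). }
  (* two points at which [s] has the value [B] *)
  destruct (derived_unbounded E (num 0) DE) as (i & Hi & _).
  { now apply regular_num. }
  destruct (Val i Hi) as [Hik Ri].
  destruct (derived_unbounded E (succ i) DE) as (i' & Hi' & Ni).
  { now apply regular_succ. }
  destruct (Val i' Hi') as [Hik' Ri'].
  apply Ni, succE. right. apply (PH3 i' (H_trans Hr k i' kH Hik') i (H_trans Hr k i kH Hik) B); auto.
Qed.

Lemma pow_le x y : inj_le x y -> inj_le (pow x) (pow y).
Proof.
  intros (F & F1 & F2). exists (img F). split.
  - intros a Ha. rewrite powE in *. intros z Hz. apply imgE in Hz as (w & Hw' & ->). auto.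
  - intros a b Ha Hb E. rewrite powE in *. apply ext. intros z. split; intros Hz.
    + assert (H1 : F z ∈ img F b) by (rewrite <- E; now apply img_in).
      apply imgE in H1 as (w & Hw' & E'). apply F2 in E'; auto. now subst.
    + assert (H1 : F z ∈ img F a) by (rewrite E; now apply img_in).
      apply imgE in H1 as (w & Hw' & E'). apply F2 in E'; auto. now subst.
Qed.

Lemma emb_pow_small x : x ∈ M -> small k x -> pow x ∈ H theta ->
  pow x ∈ M /\ small k (pow x) /\ pow x ⊆ M.
Proof.
  intros Hx (a & Ha & La) HpH. assert (H0 : empty ∈ M) by now apply (emb_empty).
  assert (HpM : pow x ∈ M).
  { apply (elem_set Hr HE H0 (fun K e => forall z, z ∈ K -> z ∈ e 0 -> z ∈ e 1) [x]).
    - dfn.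
    - auto.
    - auto.
    - intros z Hz. rewrite powE. unfold ev; simpl. split; auto.
      intros Hs w Hwz. apply Hs; auto. now apply (H_trans Hr z). }
  assert (Hsp : small k (pow x)).
  { apply (small_le k _ (pow a)); [now apply pow_le|now apply emb_strong_limit]. }
  split; auto. split; auto.
  apply (elem_subset Hr HE H0 k); auto.
  - now apply (emb_k_in).
  - now apply (emb_k_sub).
  - destruct Hsp as (b & Hb & Lb). eapply inj_le_trans; [exact Lb|].
    apply inj_le_sub. exact (proj1 (regular_ord k Hk) b Hb).
Qed.

Lemma pow_mono x y : x ⊆ y -> pow x ⊆ pow y.
Proof. intros Hs z. rewrite !powE. auto. Qed.

Lemma opair_in_pow x a b : a ∈ x -> b ∈ x -> ⟨a, b⟩ ∈ pow (pow x).
Proof.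
  intros Ha Hb. apply powE. intros z Hz. apply powE. intros w Hwz.
  apply upairE in Hz as [-> | ->]; apply upairE in Hwz as [-> | ->]; auto.
Qed.

(** A function from [a] in [k] to [k] is a set of pairs of elements of some [d] in [k], and
    the iterated power sets of [d] are subsets of [M]. So all these functions are in [M],
    which has size [k]. *)
Lemma emb_lt_power : pow (pow (pow k)) ∈ H theta -> k = lt_power k.
Proof.
  intros Hp3. assert (Ok := regular_ord k Hk).
  assert (HS : forall f, (exists a, a ∈ k /\ fun_to f a k) -> f ∈ M).
  { intros f (a & Ha & Hf). destruct (proj2 Hk a f Ha Hf) as (b & Hb & Hfb).
    destruct Hf as [Hfa _].
    assert (Hd : exists d, d ∈ k /\ a ⊆ d /\ b ⊆ d).
    { destruct (ord_total a b) as [E|[E|E]]; eauto using ord_in.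
      - exists b. split; [|split]; auto. now apply (ord_in k).
      - subst. eauto.
      - exists a. split; [|split]; auto. now apply (ord_in k). }
    destruct Hd as (d & Hd & Had & Hbd).
    assert (dk : d ⊆ k) by exact (proj1 Ok d Hd).
    assert (Hp2 : pow (pow k) ∈ H theta) by (apply (H_trans Hr _ _ Hp3); now apply powE).
    assert (Hp1 : pow k ∈ H theta) by (apply (H_trans Hr _ _ Hp2); now apply powE).
    destruct (emb_pow_small d) as (M1 & S1 & _).
    { now apply (emb_k_sub). }
    { now apply small_elem. }
    { apply (H_sub Hr (pow k)); auto. now apply pow_mono. }
    destruct (emb_pow_small (pow d)) as (M2 & S2 & _); auto.
    { apply (H_sub Hr (pow (pow k))); auto. now apply pow_mono, pow_mono. }
    destruct (emb_pow_small (pow (pow d))) as (_ & _ & Sub); auto.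
    { apply (H_sub Hr (pow (pow (pow k)))); auto. now apply pow_mono, pow_mono, pow_mono. }
    apply Sub, powE. intros p Hp. rewrite (fun_on_lam f a Hfa) in Hp.
    apply lamE in Hp as (x & Hx & ->). apply opair_in_pow; auto. }
  unfold lt_power. symmetry.
  assert (ES : forall f, f ∈ {{ f | exists a, a ∈ k /\ fun_to f a k }} <->
                         exists a, a ∈ k /\ fun_to f a k).
  { apply comprE. exists M. exact HS. }
  apply card_eq.
  - now apply regular_cardinal.
  - apply (inj_le_trans _ M).
    + apply inj_le_sub. intros f Hf. now apply HS, ES.
    + destruct Hw as [E _]. rewrite <- E. apply le_card.
  - exists (fun i => lam (num 1) (fun _ => i)). split.
    + intros i Hi. apply ES. exists (num 1). split; [now apply regular_num|].
      split; [apply lam_fun_on|]. intros x Hx. now rewrite app_lam.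
    + intros i i' Hi Hi' E. assert (H0 : (num 0 : U) ∈ num 1) by (apply num_lt; eauto).
      rewrite <- (app_lam (num 1) (fun _ => i) (num 0)), E, app_lam; auto.
Qed.

(** * The judge beats every strategy that lies in the domain of an embedding *)

(** The judge plays the derived ultrafilter [D]. The challenger's models are elements,
    hence subsets, of [M], so that the traces of [D] on them are in [M] and the play
    does not leave [M]. On the union of these models [D] is normal, and its ultrapower
    maps into [N]. The next node is chosen by what [M] believes, while the
    outcome of the infinite play, which need not be in [M], is judged in [H theta]. *)
Lemma no_strategy (c0 S mm GG : U) :
  c0 ∈ M -> S ∈ M -> mm ∈ M -> GG ∈ M ->
  strategy_in M c0 S mm GG k omega -> strategy_in (H theta) c0 S mm GG k omega -> False.
Proof.
  intros Hc0 HS Hmm HGG HQM HQH.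
  assert (HkM : k ∈ M) by now apply (emb_k_in).
  assert (HkS : k ⊆ M) by now apply (emb_k_sub).
  assert (H0 : empty ∈ M) by now apply (emb_empty).
  assert (MH : forall x, x ∈ M -> x ∈ H theta) by apply (proj1 HE).
  assert (Rel : forall r a b, r ∈ M -> a ∈ M -> b ∈ M -> (rel_in M r a b <-> ⟨a, b⟩ ∈ r)).
  { intros r a b Hr' Ha Hb. rewrite <- (rel_in_H Hr r a b) by auto.
    apply (elem_dfn (fun K e => rel_in K (e 0) (e 1) (e 2)) M (H theta) (ev [r; a; b]));
      auto; [dfn|apply ev_in; auto]. }
  pose (D := derived).
  destruct HQM as (_ & _ & (m0 & Hm0 & G0 & HG0 & Rm0 & RG0 & EG0) & Steps & _).
  destruct HQH as (Fmm & FGG & _ & StepsH & Lose).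
  rewrite Rel in Rm0, RG0 by auto.
  assert (sub : forall q m G, q ∈ M -> m ∈ M -> G ∈ M -> ⟨q, m⟩ ∈ mm -> ⟨q, G⟩ ∈ GG ->
            inj_le m k /\ m ⊆ M).
  { intros q m G Hq Hm HG Rm RG.
    destruct (StepsH q (MH q Hq) m (MH m Hm) G (MH G HG)) as ((t & Ht & Ft & Et) & _);
      try (apply rel_in_H; auto; fail).
    assert (L : inj_le m k).
    { destruct (class_choice (fun x i => i ∈ k /\ ⟨i, x⟩ ∈ t) m) as [i Sp].
      { intros x Hx. assert (xH : x ∈ H theta) by (apply (H_trans Hr m); auto).
        destruct (Et x xH Hx) as (i & Hi & Hik & Ri). exists i. split; auto.
        now apply rel_in_H in Ri. }
      exists i. split; [intros x Hx; now apply Sp|].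
      intros x y Hx Hy E. destruct (Sp x Hx) as [I1 T1], (Sp y Hy) as [I2 T2].
      assert (xH : x ∈ H theta) by (apply (H_trans Hr m); auto).
      assert (yH : y ∈ H theta) by (apply (H_trans Hr m); auto).
      rewrite <- E in T2.
      apply (Ft _ (MH _ (HkS _ I1)) x xH y yH); apply rel_in_H; auto. }
    split; auto. now apply (elem_subset Hr HE H0 k). }
  (* [G], the last answer, is a subset of [m], so the next answer, which is the trace of
     [D] on [m], extends it *)
  set (I := fun s : U * U * U => let '(q, m, G) := s in
     q ∈ M /\ m ∈ M /\ G ∈ M /\ ⟨q, m⟩ ∈ mm /\ ⟨q, G⟩ ∈ GG /\ G ⊆ m /\ forall A, A ∈ G -> D A).
  set (R := fun s s' : U * U * U => let '(q, m, G) := s in let '(q', m', F) := s' in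
     ⟨q, q'⟩ ∈ S /\ m ⊆ m' /\ forall A, A ∈ F <-> A ∈ m /\ D A).
  assert (Round : forall s, I s -> exists s', I s' /\ R s s').
  { intros [[q m] G] (Hq & Hm & HG & Rm & RG & GS & GD).
    destruct (sub q m G) as [L mS]; auto.
    destruct (derived_amenable m Hm L) as (F & HF & EF).
    assert (mH : m ∈ H theta) by auto.
    destruct (Steps q Hq m Hm G HG) as (_ & Cl & km & Ans); try (apply Rel; auto; fail).
    assert (Diff : forall A B, A ∈ m -> B ∈ m -> diff A B ∈ m).
    { intros A B HA HB. destruct (Cl A (mS A HA) HA B (mS B HB) HB) as (C & HC & HCm & EC).
      assert (DM : diff A B ∈ M) by (apply (elem_diff Hr HE H0); auto).
      replace (diff A B) with C; auto.
      assert (Zm := zm_extensionality M (proj2 (proj2 (proj2 Hw)))).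
      apply Zm; auto. intros z Hz. rewrite EC by auto. now rewrite diffE. }
    destruct (Ans F HF) as (q' & Hq' & m' & Hm' & Rq & Rm' & RF & Hs).
    - split; [|split; [|split; [|split]]].
      + intros A HA HAF z _ HzA. apply EF in HAF as [_ (_ & HAk & _)]. auto.
      + intros A HA HAF B HB HBF. apply EF in HAF as [HAm DA], HBF as [HBm DB].
        exists (diff A (diff A B)).
        assert (Cm : diff A (diff A B) ∈ m) by auto.
        split; [auto|]. split.
        * apply EF. split; auto. assert (HAk := proj1 (proj2 DA)).
          apply (derived_diff); auto.
          { intros z Hz. apply diffE in Hz as [Hz _]. auto. }
          split; auto. intros DAB.
          apply (derived_diff) in DAB; auto; [tauto|].
          exact (proj1 (proj2 DB)).
        * intros z _ Hz. rewrite !diffE in Hz. destruct Hz as [HzA N1]. split; auto.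
          apply NNPP. intros N2. apply N1. auto.
      + intros A HA HAF c Hc Hck. apply EF in HAF as [HAm DA].
        destruct (derived_unbounded A c DA Hck) as (d & Hd & Nd).
        exists d. split; auto. apply HkS. now apply DA.
      + intros A HA HAm HAk.
        assert (HAk' : A ⊆ k).
        { intros z Hz. assert (As : A ⊆ H theta).
          { intros u Hu. apply (H_trans Hr A); auto. }
          assert (T : forall z, z ∈ H theta -> z ∈ A -> z ∈ k).
          { apply (elem_dfn (fun K e => forall z, z ∈ K -> z ∈ e 0 -> z ∈ e 1) M (H theta)
              (ev [A; k])); auto; [dfn|apply ev_in; auto]. }
          auto. }
        destruct (derived_measures A HA HAk') as [DA|DA].
        * left. apply EF. auto.
        * right. exists (diff k A). split; [now apply DA|]. split.
          { apply EF. auto. }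
          intros z _. apply diffE.
      + intros A HA HAG. apply EF. split; [auto|now apply GD].
    - rewrite Rel in Rq, Rm', RF by auto.
      assert (Hs' : m ⊆ m') by (intros x Hx; auto).
      exists (q', m', F). split; [|split; [|split]]; auto.
      split; [|split; [|split; [|split; [|split; [|split]]]]]; auto.
      + intros A HA. apply EF in HA as [HA _]. auto.
      + intros A HA. apply EF in HA as [_ HA]. auto. }
  destruct (dependent_choice I R Round (c0, m0, G0)) as (s & s0 & Hs).
  { assert (G0e : forall x, ~ x ∈ G0).
    { intros x Hx.
      assert (T : forall z, z ∈ H theta -> ~ z ∈ G0).
      { apply (elem_dfn (fun K e => forall z, z ∈ K -> ~ z ∈ e 0) M (H theta)
              (ev [G0])); auto; [dfn|apply ev_in; auto]. }
      apply (T x); auto. apply (H_trans Hr G0); auto. }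
    split; [|split; [|split; [|split; [|split; [|split]]]]]; auto;
      intros A HA; now apply G0e in HA. }
  set (q := fun n => fst (fst (s n))). set (m := fun n => snd (fst (s n))).
  set (G := fun n => snd (s n)).
  assert (Inv : forall n, q n ∈ M /\ m n ∈ M /\ G n ∈ M /\ ⟨q n, m n⟩ ∈ mm /\
     ⟨q n, G n⟩ ∈ GG /\ G n ⊆ m n /\ forall A, A ∈ G n -> D A).
  { intros n. generalize (proj1 (Hs n)). unfold q, m, G. destruct (s n) as [[? ?] ?]. auto. }
  assert (Stp : forall n, ⟨q n, q (Datatypes.S n)⟩ ∈ S /\ m n ⊆ m (Datatypes.S n) /\
     forall A, A ∈ G (Datatypes.S n) <-> A ∈ m n /\ D A).
  { intros n. generalize (proj2 (Hs n)). unfold q, m, G.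
    destruct (s n) as [[? ?] ?], (s (Datatypes.S n)) as [[? ?] ?]. auto. }
  assert (omH : omega ⊆ H theta).
  { intros z Hz. apply omegaE in Hz as [n ->]. now apply H_num. }
  assert (omt : omega ∈ theta).
  { apply (ord_trans theta k); auto using regular_ord.
    now apply (emb_uncountable). }
  set (b := lam omega (fun i => q (unnum i))).
  assert (qH : forall n, q n ∈ H theta) by (intros n; apply MH, Inv).
  assert (bH : b ∈ H theta) by (apply H_lam; auto using small_elem).
  assert (Rb : forall i x, ⟨i, x⟩ ∈ b <-> exists n, i = num n /\ x = q n).
  { intros i x. unfold b. rewrite lam_pair. split.
    - intros [Hi ->]. apply omegaE in Hi as [n ->]. exists n. now rewrite unnumK.
    - intros (n & -> & ->). rewrite unnumK. split; auto using num_omega. }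
  assert (mmH := MH mm Hmm). assert (GGH := MH GG HGG).
  assert (AlM : forall x, along (H theta) omega b mm x -> exists n, x ∈ m n).
  { intros x (i & Hi & Hio & q' & Hq' & m' & Hm' & Rq' & Rm' & Hx).
    apply rel_in_H in Rq'; auto. apply Rb in Rq' as (n & -> & ->).
    exists n. replace (m n) with m'; auto. apply (Fmm (q n) (qH n) m' Hm' (m n)); auto.
    - apply MH, Inv.
    - apply rel_in_H; auto; [apply MH, Inv|apply Inv]. }
  assert (AlG : forall x, along (H theta) omega b GG x <-> exists n, x ∈ G n).
  { intros x. split.
    - intros (i & Hi & Hio & q' & Hq' & G' & HG' & Rq' & RG' & Hx).
      apply rel_in_H in Rq'; auto. apply Rb in Rq' as (n & -> & ->).
      exists n. replace (G n) with G'; auto. apply (FGG (q n) (qH n) G' HG' (G n)); auto.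
      + apply MH, Inv.
      + apply rel_in_H; auto; [apply MH, Inv|apply Inv].
    - intros (n & Hx). exists (num n). split; [now apply H_num|]. split; [apply num_omega|].
      exists (q n). split; auto. exists (G n). split; [apply MH, Inv|].
      split; [|split]; auto; apply rel_in_H; auto using H_num; try (apply MH, Inv); try apply Inv.
      apply Rb. eauto. }
  assert (mM : forall n, m n ⊆ M).
  { intros n. destruct (Inv n) as (I1 & I2 & I3 & I4 & I5 & _). now apply (sub (q n) (m n) (G n)). }
  assert (GD : forall A, (exists n, A ∈ G n) -> D A) by (intros A [n HA]; now apply (Inv n)).
  assert (DG : forall A n, A ∈ m n -> D A -> exists n, A ∈ G n).
  { intros A n HA DA. exists (Datatypes.S n). apply Stp. auto. }
  destruct (Lose b bH) as [L|L].
  - intros i Hi x Hx y Hy. rewrite !rel_in_H, !Rb by auto.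
    intros (n & E1 & ->) (n' & E2 & ->). rewrite E1 in E2. apply num_inj in E2. now subst.
  - intros i Hi Hio Ei. apply rel_in_H; auto. apply Rb. exists 0.
    apply omegaE in Hio as [[|n] ->].
    + unfold q. now rewrite s0.
    + exfalso. apply (Ei (num n)); [now apply H_num|]. apply succE; auto.
  - intros i Hi Hio i' Hi' Hio' E. apply omegaE in Hio as [n ->].
    assert (i' = num (Datatypes.S n)) as ->.
    { apply ext. intros z. simpl. rewrite succE. split; intros Hz.
      - apply E; auto. now apply (H_trans Hr i').
      - apply E; auto. destruct Hz as [Hz| ->]; auto. now apply (H_trans Hr (num n)). }
    exists (q n). split; auto. exists (q (Datatypes.S n)). split; auto.
    rewrite !rel_in_H by auto. split; [apply Rb; eauto|]. split; [apply Rb; eauto|apply Stp].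
  - destruct L as (X & HX & Dg & HDg & AX & AD & FX & VX & ED & ND).
    apply ND, AlG. apply AlM in AX as [n HXn], AD as [n' HDn].
    apply (DG Dg n'); auto. apply (mM n) in HXn as HXM.
    apply (derived_normal X); auto.
    + intros i x x' H1 H2.
      assert (T1 : ⟨i, x⟩ ∈ H theta) by now apply (H_trans Hr X).
      assert (T2 : ⟨i, x'⟩ ∈ H theta) by now apply (H_trans Hr X).
      apply (H_opair_inv Hr) in T1 as [iH xH], T2 as [_ xH'].
      apply (FX i iH x xH x' xH'); now apply rel_in_H.
    + intros i Hi. destruct (VX i (MH i (HkS i Hi)) Hi) as (A & HA & RA & AA).
      exists A. split; [now apply rel_in_H in RA; auto|]. apply GD, AlG, AA.
    + now apply (mM n').
    + intros a Ha. apply ED in Ha as [Ha _]; auto. now apply (H_trans Hr Dg).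
    + intros a Ha. assert (aH : a ∈ H theta) by auto. rewrite (ED a aH). split.
      * intros [_ Hi] i Hia. assert (iH : i ∈ H theta) by now apply (H_trans Hr a).
        destruct (Hi i iH Hia) as (A & HA & RA & HaA). exists A. split; auto.
        now apply rel_in_H in RA.
      * intros Hi. split; auto. intros i iH Hia. destruct (Hi i Hia) as (A & RA & HaA).
        assert (T : ⟨i, A⟩ ∈ H theta) by now apply (H_trans Hr X).
        apply (H_opair_inv Hr) in T as [_ AH].
        exists A. split; auto. split; auto. now apply rel_in_H.
  - destruct L as (Z & HZ & (f0 & Hf0 & Hf0Z) & EZ).
    assert (Good : forall f, f ∈ Z -> f ∈ M /\ total_fun f k).
    { intros f Hf. assert (fH : f ∈ H theta) by now apply (H_trans Hr Z).
      destruct (EZ f fH Hf) as (Af & Ff & Tf & _). apply AlM in Af as [n Hfn].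
      split; [now apply (mM n)|]. split.
      - intros x Hx. destruct (Tf x (MH x (HkS x Hx)) Hx) as (y & Hy & Ry). exists y.
        now apply rel_in_H in Ry; auto.
      - intros x y z Hy Hz.
        assert (T1 : ⟨x, y⟩ ∈ H theta) by now apply (H_trans Hr f).
        assert (T2 : ⟨x, z⟩ ∈ H theta) by now apply (H_trans Hr f).
        apply (H_opair_inv Hr) in T1 as [xH yH], T2 as [_ zH].
        apply (Ff x xH y yH z zH); now apply rel_in_H. }
    assert (NoMin : forall y f, f ∈ Z -> value f = y -> False).
    { intros y. induction y as [y IH] using (well_founded_induction mem_wf).
      intros f Hf Ey. assert (fH : f ∈ H theta) by now apply (H_trans Hr Z).
      destruct (EZ f fH Hf) as (_ & _ & _ & g & gH & Hg & A & AH & AA & Lt).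
      destruct (Good f Hf) as [fM fT], (Good g Hg) as [gM gT].
      apply (IH (value g)) with (f := g); auto. rewrite <- Ey.
      apply (value_mem f g A); auto.
      - apply GD, AlG, AA.
      - intros x Hx. assert (xH : x ∈ H theta) by now apply (H_trans Hr A).
        destruct (Lt x xH Hx) as (u & Hu & v & Hv & Ru & Rv & Huv).
        rewrite rel_in_H in Ru, Rv by auto. eauto 6. }
    eapply NoMin; eauto.
Qed.

End Embedding.

(** * Finite sets and filters *)

Section Filters.
Context {U : ZFC}.
Implicit Types a b c d f k r x y z A B C F M X : U.

Lemma finite_le a n : inj_le a (num n) -> finite a.
Proof.
  intros L. unfold finite. assert (Oc := card_ord a).
  assert (S : card a ⊆ num n).
  { apply ord_nsub; auto using ord_num. intros Hn.
    apply (cardinal_not_le _ _ (card_cardinal a) Hn).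
    eapply inj_le_trans; [apply card_le|exact L]. }
  apply ord_sub in S as [S|S]; auto using ord_num.
  - now apply (ord_trans omega (num n)); auto using ord_omega, num_omega.
  - rewrite S. apply num_omega.
Qed.

Lemma add_le a x n : inj_le a (num n) -> inj_le (un a (sing x)) (num (S n)).
Proof.
  intros (F & F1 & F2).
  exists (fun z => if excluded_middle_informative (z ∈ a) then F z else num n).
  assert (Hn : forall z, z ∈ a -> F z <> num n).
  { intros z Hz E. apply F1 in Hz. rewrite E in Hz. now apply no_self in Hz. }
  split.
  - intros z Hz. apply succE. destruct (excluded_middle_informative (z ∈ a)); auto.
  - intros z w Hz Hw E. rewrite unE, singE in Hz, Hw.
    destruct (excluded_middle_informative (z ∈ a)) as [H1|H1],
             (excluded_middle_informative (w ∈ a)) as [H2|H2]; auto.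
    + now apply Hn in H1.
    + symmetry in E. now apply Hn in H2.
    + destruct Hz, Hw; congruence.
Qed.

Lemma finite_ind (P : U -> Prop) : P empty ->
  (forall a x, P a -> P (un a (sing x))) -> forall a, finite a -> P a.
Proof.
  intros P0 PS.
  assert (Hn : forall n a, inj_le a (num n) -> P a).
  { induction n as [|n IH]; intros a (F & F1 & F2).
    - replace a with (empty : U); auto. apply ext. intros z. rewrite emptyE. split; [tauto|].
      intros Hz. apply F1 in Hz. now apply emptyE in Hz.
    - destruct (classic (exists x, x ∈ a /\ F x = num n)) as [(x & Hx & Ex)|N].
      + replace a with (un (diff a (sing x)) (sing x)).
        * apply PS, IH. exists F. split.
          { intros z Hz. apply diffE in Hz as [Hz Nz]. rewrite singE in Nz.
            assert (Hz' := F1 z Hz). apply succE in Hz' as [|E]; auto.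
            exfalso. apply Nz, F2; auto. rewrite Ex. exact E. }
          { intros z w Hz Hw. rewrite diffE in *. apply F2; tauto. }
        * apply ext. intros z. rewrite unE, diffE, singE.
          destruct (classic (z = x)) as [->|]; tauto.
      + apply IH. exists F. split; auto.
        intros z Hz. assert (Hz' := F1 z Hz). apply succE in Hz' as [|E]; auto.
        exfalso. eauto. }
  intros a Ha. unfold finite in Ha. apply omegaE in Ha as [n E].
  apply (Hn n). rewrite <- E. apply le_card.
Qed.

Lemma bigcapE k a x : x ∈ bigcap k a <-> x ∈ k /\ forall y, y ∈ a -> x ∈ y.
Proof. apply (sepE (fun x => forall y, y ∈ a -> x ∈ y)). Qed.

Lemma unbounded_card k x : regular k -> x ⊆ k ->
  (forall c, c ∈ k -> exists d, d ∈ x /\ ~ d ∈ c) -> card x = k.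
Proof.
  intros Hk Hs Hu. apply card_small_eq; auto using regular_cardinal. intros Sx.
  destruct (small_bounded k x Hk Hs Sx) as (b & Hb & Hxb).
  destruct (Hu b Hb) as (d & Hd & Nd). auto.
Qed.

(** Finite intersections contain members of the family, and unbounded subsets of a
    regular cardinal [k] have size [k]. *)
Lemma filter_base k F : regular k -> F ⊆ pow k ->
  (forall A B, A ∈ F -> B ∈ F -> exists C, C ∈ F /\ forall z, z ∈ C -> z ∈ A /\ z ∈ B) ->
  (forall A c, A ∈ F -> c ∈ k -> exists d, d ∈ A /\ ~ d ∈ c) ->
  filter k F.
Proof.
  intros Hk Fk Fd Fu. split; auto. intros a Has Ha.
  assert (HC : exists C, (C ∈ F \/ C = k) /\ C ⊆ bigcap k a).
  { revert Has. apply (finite_ind (fun a => a ⊆ F -> exists C, (C ∈ F \/ C = k) /\ C ⊆ bigcap k a)); auto.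
    - intros _. exists k. split; auto. intros z Hz. apply bigcapE. split; auto.
      intros y Hy. now apply emptyE in Hy.
    - intros b x IH Hb.
      destruct IH as (C & HC & HCb); [intros y Hy; apply Hb, unE; auto|].
      assert (Hx : x ∈ F) by (apply Hb, unE; right; now apply singE).
      assert (HD : exists D, D ∈ F /\ forall z, z ∈ D -> z ∈ C /\ z ∈ x).
      { destruct HC as [HC| ->]; auto. exists x. split; auto. intros z Hz. split; auto.
        apply Fk in Hx. rewrite powE in Hx. auto. }
      destruct HD as (D & HD & HDz). exists D. split; auto. intros z Hz.
      destruct (HDz z Hz) as [H1 H2]. apply HCb, bigcapE in H1 as [H1 H3].
      apply bigcapE. split; auto. intros y Hy. apply unE in Hy as [Hy|Hy]; auto.
      apply singE in Hy as ->. auto. }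
  destruct HC as (C & HC & HCa). apply unbounded_card; auto.
  - intros z Hz. now apply bigcapE in Hz.
  - intros c Hc. assert (Hd : exists d, d ∈ C /\ ~ d ∈ c).
    { destruct HC as [HC| ->]; auto. exists c. split; auto. apply no_self. }
    destruct Hd as (d & Hd & Nd). eauto.
Qed.

Lemma filter_meet k F A B D : regular k -> filter k F -> A ∈ F -> B ∈ F -> D ∈ F ->
  exists x, x ∈ k /\ x ∈ A /\ x ∈ B /\ x ∈ D.
Proof.
  intros Hk [_ HF] HA HB HD.
  set (a := un (un (un empty (sing A)) (sing B)) (sing D)).
  assert (Ea : forall x, x ∈ a <-> x = A \/ x = B \/ x = D).
  { intros x. unfold a. rewrite !unE, !singE, emptyE. tauto. }
  assert (E : card (bigcap k a) = k).
  { apply HF.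
    - intros x Hx. apply Ea in Hx as [->|[->| ->]]; auto.
    - apply (finite_le a 3). do 3 apply add_le. apply inj_le_refl. }
  destruct (card_le (bigcap k a)) as (G & G1 & _). rewrite E in G1.
  specialize (G1 (num 0) (regular_num k 0 Hk)). apply bigcapE in G1 as [G1 G2].
  exists (G (num 0)). split; [auto|]. split; [|split]; apply G2, Ea; auto.
Qed.

(** On the sets that it measures, a filter behaves like an ultrafilter. *)
Lemma filter_sup k F A B C : regular k -> filter k F -> A ∈ F -> B ∈ F ->
  (forall x, x ∈ k -> x ∈ A -> x ∈ B -> x ∈ C) -> C ∈ F \/ diff k C ∈ F -> C ∈ F.
Proof.
  intros Hk HF HA HB HABC [|HD]; auto. exfalso.
  destruct (filter_meet k F A B (diff k C) Hk HF HA HB HD) as (x & H1 & H2 & H3 & H4).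
  apply diffE in H4 as [_ H4]. auto.
Qed.

Lemma filter_k k F : regular k -> filter k F -> (k ∈ F \/ diff k k ∈ F) -> k ∈ F.
Proof.
  intros Hk HF Hm. destruct Hm as [|Hm]; auto.
  apply (filter_sup k F (diff k k) (diff k k)); auto.
Qed.

Lemma filter_union k (g : U -> U) :
  (forall n, filter k (g (num n))) ->
  (forall m n, m <= n -> g (num m) ⊆ g (num n)) -> filter k (fam omega g).
Proof.
  intros Hg Mon.
  assert (Ef := fam_omegaE g).
  split.
  - intros x Hx. apply Ef in Hx as [n Hn]. now apply (Hg n).
  - intros a Has Ha.
    assert (Hn : exists n, a ⊆ g (num n)).
    { revert Has. apply (finite_ind (fun a => a ⊆ fam omega g -> exists n, a ⊆ g (num n))); auto.
      - intros _. exists 0. intros z Hz. now apply emptyE in Hz.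
      - intros b x IH Hb.
        destruct IH as (n & Hn); [intros y Hy; apply Hb, unE; auto|].
        assert (Hx : x ∈ fam omega g) by (apply Hb, unE; right; now apply singE).
        apply Ef in Hx as [m Hm]. exists (max m n). intros z Hz.
        apply unE in Hz as [Hz|Hz].
        + apply (Mon n); auto. lia.
        + apply singE in Hz as ->. apply (Mon m); auto. lia. }
    destruct Hn as [n Hn]. now apply (Hg n).
Qed.

End Filters.

(** * Runs of the game *)

Section Runs.
Context {U : ZFC}.
Implicit Types a b c d r x y z A B C F M X xi e : U.
Implicit Types (f g : U -> U).
Context (k eta sigma : U).

(** Runs are handled as class functions [f] and [g] of the stage, whose restrictions to
    [e] are the positions of the game. *)
Definition stage f g e :=
  challenger_legal k eta e (lam e f) (lam e g) (f e) /\
  judge_legal k e (lam e g) (f e) (g e) /\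
  f e = app sigma ⟨lam e f, lam e g⟩.

Lemma stage_ext f g f' g' e : (forall x, x ∈ e -> f x = f' x) -> (forall x, x ∈ e -> g x = g' x) ->
  f e = f' e -> g e = g' e -> stage f g e -> stage f' g' e.
Proof.
  intros E1 E2 E3 E4. unfold stage.
  rewrite (lam_ext e f f'), (lam_ext e g g'), E3, E4 by auto. auto.
Qed.

Lemma run_stages f g xi : is_ordinal xi ->
  (legal_run k eta xi (lam xi f) (lam xi g) /\ follows sigma xi (lam xi f) (lam xi g)
   <-> forall e, e ∈ xi -> stage f g e).
Proof.
  intros Oxi.
  assert (E : forall e h, e ∈ xi -> restr (lam xi h) e = lam e h /\ app (lam xi h) e = h e).
  { intros e h He. rewrite app_lam, restr_lam; auto. exact (proj1 Oxi e He). }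
  split.
  - intros [(_ & _ & HL) HF] e He. destruct (HL e He) as [H1 H2]. specialize (HF e He).
    destruct (E e f He) as [E1 E2], (E e g He) as [E3 E4].
    rewrite E1, ?E2, ?E3, ?E4 in *. unfold stage. auto.
  - intros HS. split; [split; [apply lam_fun_on|split; [apply lam_fun_on|]]|]; intros e He;
      destruct (HS e He) as (H1 & H2 & H3);
      destruct (E e f He) as [E1 E2], (E e g He) as [E3 E4]; rewrite E1, E2, E3, ?E4; auto.
Qed.

Lemma stage_mono f g : (forall n, stage f g (num n)) -> forall m n, m <= n ->
  f (num m) ⊆ f (num n) /\ g (num m) ⊆ g (num n).
Proof.
  intros HS m n Hmn. destruct (Nat.eq_dec m n) as [->|Hne]; [auto|].
  assert (Hm : (num m : U) ∈ num n) by (apply num_lt; exists m; split; auto; lia).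
  destruct (HS n) as ((_ & _ & H1 & _) & (_ & _ & H2) & _).
  specialize (H1 _ Hm). specialize (H2 _ Hm). rewrite app_lam in H1, H2 by auto. auto.
Qed.

End Runs.

(** * Coding a winning strategy as a tree *)

Section Coding.
Context {U : ZFC}.
Implicit Types a b c d r x y z A B C F M X xi q : U.
Implicit Types (f g : U -> U).
Context (k eta sigma : U) (Hk : regular k) (Heta : regular eta)
  (Hwin : challenger_winning k eta omega sigma).

Definition position (n : nat) f g : U := ⟨lam (num n) f, lam (num n) g⟩.

Definition reached (n : nat) f g := forall i, i < n -> stage k eta sigma f g (num i).

Lemma position_inj n f g n' f' g' : position n f g = position n' f' g' ->
  n = n' /\ forall i, i < n -> f (num i) = f' (num i) /\ g (num i) = g' (num i).
Proof.
  intros E. apply opair_inj in E as [E1 E2].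
  assert (D : forall h h' x, lam (num n) h = lam (num n') h' -> x ∈ num n -> x ∈ num n' /\ h x = h' x).
  { intros h h' x E Hx. assert (Hp : ⟨x, h x⟩ ∈ lam (num n') h') by (rewrite <- E; now apply lam_pair).
    now apply lam_pair in Hp. }
  assert (D' : forall x, x ∈ num n' -> x ∈ num n).
  { intros x Hx. assert (Hp : ⟨x, f' x⟩ ∈ lam (num n) f) by (rewrite E1; now apply lam_pair).
    now apply lam_pair in Hp. }
  split.
  - apply (@num_inj U), ext. intros x. split; auto. intros Hx. now apply (D f f' x).
  - intros i Hi. assert (Hx : (num i : U) ∈ num n) by (apply num_lt; eauto).
    split; [now apply (D f f')|now apply (D g g')].
Qed.

Lemma reached_run n f g : reached n f g <->
  legal_run k eta (num n) (lam (num n) f) (lam (num n) g) /\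
  follows sigma (num n) (lam (num n) f) (lam (num n) g).
Proof.
  rewrite run_stages by apply ord_num. split.
  - intros HR e He. apply num_lt in He as (i & Hi & ->). auto.
  - intros HR i Hi. apply HR, num_lt. eauto.
Qed.

Lemma reached_ext n f g f' g' :
  (forall i, i < n -> f (num i) = f' (num i) /\ g (num i) = g' (num i)) ->
  reached n f g -> reached n f' g'.
Proof.
  intros E HR i Hi. apply (stage_ext k eta sigma f g); auto; try now apply E.
  - intros x Hx. apply num_lt in Hx as (l & Hl & ->). apply E. lia.
  - intros x Hx. apply num_lt in Hx as (l & Hl & ->). apply E. lia.
Qed.

Lemma reached_legal n f g : reached n f g ->
  challenger_legal k eta (num n) (lam (num n) f) (lam (num n) g) (app sigma (position n f g)).
Proof.
  intros HR. apply reached_run in HR as [H1 H2].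
  apply (proj1 (proj2 Hwin)) in H2; auto using num_omega. apply H2.
Qed.

Definition nodes : U := {{ q | exists n f g, reached n f g /\ q = position n f g }}.

Lemma nodesE q : q ∈ nodes <-> exists n f g, reached n f g /\ q = position n f g.
Proof.
  apply (comprE (fun q => exists n f g, reached n f g /\ q = position n f g)).
  set (X := un omega (un (pow (H eta)) (pow (pow k)))).
  assert (HX : forall n h, (forall i, i < n -> h (num i) ∈ X) -> lam (num n) h ∈ pow (pow (pow X))).
  { intros n h Hh. apply powE. intros p Hp. apply lamE in Hp as (x & Hx & ->).
    apply num_lt in Hx as (i & Hi & ->). apply opair_in_pow; auto.
    apply unE. left. apply num_omega. }
  exists (pow (pow (pow (pow (pow X))))). intros q' (n & f & g & HR & ->).
  apply opair_in_pow; apply HX; intros i Hi; destruct (HR i Hi) as ((_ & H1 & _) & (H2 & _) & _);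
    apply unE; right; apply unE.
  - left. apply powE, H1.
  - right. apply powE, H2.
Qed.

(** The union of the filters in a position, which does not depend on the functions that
    present the position. *)
Definition filter_at q : U :=
  the (fun G => exists n f g, q = position n f g /\ G = fam (num n) g).

Lemma filter_atE n f g : filter_at (position n f g) = fam (num n) g.
Proof.
  apply the_eq; [now exists n, f, g|].
  intros G (n' & f' & g' & E & ->). apply position_inj in E as [<- E].
  apply ext. intros z. rewrite !famE.
  split; intros (x & Hx & Hz); exists x; split; auto;
    apply num_lt in Hx as (i & Hi & ->); specialize (E i Hi) as [_ E]; congruence.
Qed.

Definition tree_models : U := lam nodes (app sigma).
Definition tree_filters : U := lam nodes filter_at.
Definition tree_steps : U :=
  {{ p in prod nodes nodes |
     exists n f g, reached (S n) f g /\ p = ⟨position n f g, position (S n) f g⟩ }}.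
(** The position of length 0, presented by arbitrary functions. *)
Definition tree_root : U := position 0 (fun x => x) (fun x => x).

Lemma tree_stepsE q q' : ⟨q, q'⟩ ∈ tree_steps <->
  exists n f g, reached (S n) f g /\ q = position n f g /\ q' = position (S n) f g.
Proof.
  unfold tree_steps. rewrite (sepE (fun p => exists n f g, reached (S n) f g /\
     p = ⟨position n f g, position (S n) f g⟩)). split.
  - intros (_ & n & f & g & HR & E). apply opair_inj in E as [-> ->]. now exists n, f, g.
  - intros (n & f & g & HR & -> & ->). split; [|now exists n, f, g].
    apply prod_in. split; apply nodesE; [exists n, f, g|exists (S n), f, g]; auto.
    split; auto. intros i Hi. apply HR. lia.
Qed.

Lemma reached_zero f g : reached 0 f g.
Proof. intros i Hi. lia. Qed.

Lemma filter_at_step n f g : reached (S n) f g -> filter_at (position (S n) f g) = g (num n).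
Proof.
  intros HR. rewrite filter_atE. apply ext. intros z. rewrite famE. split.
  - intros (x & Hx & Hz). simpl in Hx. apply succE in Hx as [Hx| ->]; auto.
    destruct (HR n) as (_ & (_ & _ & H2) & _); [lia|].
    specialize (H2 x Hx). rewrite app_lam in H2 by auto. auto.
  - intros Hz. exists (num n). split; auto. apply succE; auto.
Qed.

(** Along every infinite run the judge keeps to the rules, so the union of the filters is
    a filter that measures the union of the models. As the judge loses, normality or
    well-foundedness fails. *)
Lemma run_lost f g : (forall n, stage k eta sigma f g (num n)) ->
  (exists X, X ∈ fam omega f /\ fun_on X k /\ (forall b, b ∈ k -> app X b ∈ fam omega g) /\
     {{ a in k | forall b, b ∈ a -> a ∈ app X b }} ∈ fam omega f /\
     ~ {{ a in k | forall b, b ∈ a -> a ∈ app X b }} ∈ fam omega g) \/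
  (exists Z, (exists h, h ∈ Z) /\ forall h, h ∈ Z -> ult_fun k (fam omega f) h /\
     exists h', h' ∈ Z /\ {{ a in k | app h' a ∈ app h a }} ∈ fam omega g).
Proof.
  intros HS. set (M := fam omega f). set (F := fam omega g).
  assert (HM : forall x, x ∈ M <-> exists n, x ∈ f (num n)) by apply fam_omegaE.
  assert (HF : forall x, x ∈ F <-> exists n, x ∈ g (num n)) by apply fam_omegaE.
  assert (Mon := stage_mono k eta sigma f g HS).
  assert (FF : filter k F).
  { apply filter_union.
    - intros n. apply (HS n).
    - intros m n Hmn. now apply Mon. }
  assert (FM : measures k F (cap (pow k) M)).
  { intros A HA. apply capE in HA as [HA HAM]. apply HM in HAM as [n HAn].
    destruct (HS n) as (_ & (_ & H2 & _) & _).
    destruct (H2 A) as [H3|H3]; [now apply capE|left|right]; apply HF; eauto. }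
  assert (El : forall n, elem_sub (f (num n)) (H eta) /\ k ⊆ f (num n) /\ k ∈ f (num n)).
  { intros n. destruct (HS n) as (((H1 & _) & H2 & _) & _).
    split; auto. destruct H1 as (_ & H3 & H4 & _). auto. }
  assert (E0 : forall n, empty ∈ f (num n)).
  { intros n. apply (El n). apply (regular_num k 0 Hk). }
  assert (kF : k ∈ F).
  { apply (filter_k k F); auto. apply FM, capE. split; [now apply powE|].
    apply HM. exists 0. apply El. }
  assert (Run := proj2 (run_stages k eta sigma f g omega ord_omega)).
  destruct Run as [Run Fol].
  { intros e He. apply omegaE in He as [n ->]. auto. }
  assert (Lost := proj2 (proj2 Hwin) _ _ Run Fol).
  assert (EM : seq_union omega (lam omega f) = M).
  { apply compr_ext. intros x. split; intros (i & Hi & Hx); exists i; split; auto;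
      revert Hx; rewrite app_lam; auto. }
  assert (EF : seq_union omega (lam omega g) = F).
  { apply compr_ext. intros x. split; intros (i & Hi & Hx); exists i; split; auto;
      revert Hx; rewrite app_lam; auto. }
  unfold judge_wins in Lost. rewrite EM, EF in Lost.
  apply not_and_or in Lost as [Lost|Lost].
  - left. apply NNPP. intros No. apply Lost. split; [exact FF|]. split; [exact FM|].
    intros X HX HXk HXF. apply NNPP. intros ND. apply No. exists X.
    split; auto. split; auto. split; auto. split; auto.
    apply HM in HX as [n HXn]. apply HM. exists n. destruct (El n) as (En & kn & kn').
    assert (XH : X ∈ H eta) by now apply En. assert (kH : k ∈ H eta) by now apply En.
    assert (ED := sepE (fun a => forall b, b ∈ a -> a ∈ app X b) k).
    apply (elem_set Heta En (E0 n)
      (fun K e => e 0 ∈ e 1 /\ forall b, b ∈ K -> b ∈ e 0 ->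
         exists A, A ∈ K /\ (rel_in K (e 2) b A /\ e 0 ∈ A)) [k; X]).
    + dfn.
    + auto.
    + apply (H_sub Heta k); auto. intros z Hz. now apply ED in Hz.
    + intros z zH. rewrite ED. unfold ev; simpl.
      assert (Hb : forall b, z ∈ k -> b ∈ z -> b ∈ k).
      { intros b Hz Hb. apply (ord_trans k z); auto using regular_ord. }
      split; intros [Hz Hzb]; split; auto.
      * intros b bH Hbz. apply (ex_value_H Heta X k b (fun A => z ∈ A)); eauto.
      * intros b Hbz. apply (ex_value_H Heta X k b (fun A => z ∈ A)); eauto.
        apply Hzb; auto. apply (H_trans Heta z); auto.
  - right. apply not_all_ex_not in Lost as [S0 Lost].
    assert (Cls : S0 ⊆ ultrapower k M F /\ (exists c, c ∈ S0) /\
       forall c, c ∈ S0 -> exists d, d ∈ S0 /\ ult_mem k M F d c).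
    { apply imply_to_and in Lost as [L1 Lost]. apply imply_to_and in Lost as [L2 Lost].
      split; auto. split; auto. intros c Hc. apply NNPP. intros No. apply Lost.
      exists c. split; auto. intros d Hd Hdc. eauto. }
    destruct Cls as (Sub & [c0 Hc0] & Dn).
    assert (Ult : forall c, c ∈ ultrapower k M F -> exists h, ult_fun k M h /\ c = ult_class k M F h).
    { intros c Hc. unfold ultrapower in Hc. rewrite comprE in Hc; auto.
      exists (img (ult_class k M F) M). intros x (h & Hh & ->). apply img_in, Hh. }
    assert (EC : forall h h', h' ∈ ult_class k M F h <->
      ult_fun k M h' /\ {{ a in k | app h a = app h' a }} ∈ F).
    { intros h h'. apply (comprE (fun h' => ult_fun k M h' /\ {{ a in k | app h a = app h' a }} ∈ F)). exists M. intros x [[Hx _] _]. auto. }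
    assert (EZ := sepE (fun h => ult_fun k M h /\ ult_class k M F h ∈ S0) M).
    (* the functions whose classes form a set without minimal element *)
    set (Z := {{ h in M | ult_fun k M h /\ ult_class k M F h ∈ S0 }}) in *.
    exists Z. split.
    + destruct (Ult c0 (Sub c0 Hc0)) as (h & Hh & ->). exists h. apply EZ.
      split; auto. apply Hh.
    + intros h Hh. apply EZ in Hh as (HhM & Hh & HhS). split; auto.
      destruct (Dn _ HhS) as (d & Hd & (h1 & g1 & Hh1 & Hg1 & -> & E & Hlt)).
      exists h1. split; [apply EZ; split; auto; apply Hh1|].
      assert (Heq : {{ a in k | app h a = app g1 a }} ∈ F).
      { apply EC. rewrite E. apply EC. split; auto.
        replace {{ a in k | app g1 a = app g1 a }} with k; auto.
        apply ext. intros z. rewrite (sepE (fun a => app g1 a = app g1 a)). tauto. }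
      assert (E1 := sepE (fun a => app h a = app g1 a) k).
      assert (E2 := sepE (fun a => app h1 a ∈ app g1 a) k).
      assert (E3 := sepE (fun a => app h1 a ∈ app h a) k).
      apply (filter_sup k F _ _ _ Hk FF Heq Hlt).
      * intros x Hx H1 H2. apply E1 in H1 as [_ H1]. apply E2 in H2 as [_ H2].
        apply E3. rewrite H1. auto.
      * apply FM, capE. split; [apply powE; intros z Hz; now apply E3 in Hz|].
        destruct Hh as [_ Hhk], Hh1 as [Hh1M Hh1k].
        apply HM in HhM as [n1 Hn1], Hh1M as [n2 Hn2].
        apply HM. exists (max n1 n2). set (n := max n1 n2).
        assert (Hn1' : h ∈ f (num n)) by (apply (Mon n1 n); auto; lia).
        assert (Hn2' : h1 ∈ f (num n)) by (apply (Mon n2 n); auto; lia).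
        destruct (El n) as (En & kn & kn').
        assert (hH : h ∈ H eta) by now apply En. assert (h1H : h1 ∈ H eta) by now apply En.
        assert (kH : k ∈ H eta) by now apply En.
        apply (elem_set Heta En (E0 n)
          (fun K e => e 0 ∈ e 1 /\ exists u, u ∈ K /\ (rel_in K (e 3) (e 0) u /\
             exists v, v ∈ K /\ (rel_in K (e 2) (e 0) v /\ u ∈ v))) [k; h; h1]).
        { dfn. } { auto. }
        { apply (H_sub Heta k); auto. intros z Hz. now apply E3 in Hz. }
        intros z zH. rewrite E3. unfold ev; simpl.
        assert (V : z ∈ k -> (exists u, u ∈ H eta /\ (rel_in (H eta) h1 z u /\
           exists v, v ∈ H eta /\ (rel_in (H eta) h z v /\ u ∈ v))) <-> app h1 z ∈ app h z).
        { intros Hz. rewrite (ex_value_H Heta h1 k z (fun u => exists v, v ∈ H eta /\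
            (rel_in (H eta) h z v /\ u ∈ v))) by auto.
          now apply (ex_value_H Heta h k z (fun v => app h1 z ∈ v)). }
        tauto.
Qed.

Context (theta : U) (Hr : regular theta) (Hkt : k ∈ theta) (Hom : omega ∈ theta)
  (HmH : tree_models ∈ H theta) (HfH : tree_filters ∈ H theta)
  (HsH : tree_steps ∈ H theta) (HrH : tree_root ∈ H theta).

(** The node reached after the [n]-th round of a branch [b] determines the first [n] moves
    of both players; together these moves form a run. *)
Lemma branch_run b :
  (forall i x y, ⟨i, x⟩ ∈ b -> ⟨i, y⟩ ∈ b -> x = y) -> ⟨num 0, tree_root⟩ ∈ b ->
  (forall n, exists q q', ⟨num n, q⟩ ∈ b /\ ⟨num (S n), q'⟩ ∈ b /\ ⟨q, q'⟩ ∈ tree_steps) ->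
  exists f g, (forall n, stage k eta sigma f g (num n)) /\
    forall n, ⟨num n, position n f g⟩ ∈ b.
Proof.
  intros Hb H0 Hs.
  set (node := fun i => the (fun q => ⟨i, q⟩ ∈ b)).
  assert (Hn : forall n, ⟨num n, node (num n)⟩ ∈ b).
  { intros n. apply (the_spec (fun q => ⟨num n, q⟩ ∈ b)).
    destruct (Hs n) as (q & _ & Hq & _). eauto. }
  set (f := fun i => app sigma (node i)). set (g := fun i => filter_at (node (succ i))).
  exists f, g.
  assert (HR : forall n, reached n f g /\ node (num n) = position n f g).
  { induction n as [|n [IH1 IH2]].
    - split; [apply reached_zero|]. rewrite (Hb _ _ _ (Hn 0) H0).
      unfold tree_root, position. f_equal; apply lam_ext; intros x Hx; now apply emptyE in Hx.
    - destruct (Hs n) as (q & q' & Hq & Hq' & Hst).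
      apply tree_stepsE in Hst as (n' & f' & g' & HR' & -> & ->).
      assert (E := Hb _ _ _ Hq (Hn n)). rewrite IH2 in E. apply position_inj in E as [-> E].
      assert (E' := Hb _ _ _ Hq' (Hn (S n))).
      assert (Ef : f' (num n) = f (num n)).
      { destruct (HR' n) as (_ & _ & E3); [lia|]. rewrite E3. unfold f.
        rewrite <- (Hb _ _ _ Hq (Hn n)). reflexivity. }
      assert (Eg : g' (num n) = g (num n)).
      { unfold g. change (succ (num n)) with (num (S n) : U).
        rewrite <- E'. now rewrite filter_at_step. }
      assert (EE : forall i, i < S n -> f' (num i) = f (num i) /\ g' (num i) = g (num i)).
      { intros i Hi. destruct (Nat.eq_dec i n) as [->|]; auto. apply E. lia. }
      split; [now apply (reached_ext (S n) f' g')|]. rewrite <- E'.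
      unfold position. f_equal; apply lam_ext; intros x Hx;
        apply num_lt in Hx as (i & Hi & ->); now apply EE. }
  split.
  - intros n. apply (HR (S n)). lia.
  - intros n. rewrite <- (proj2 (HR n)). apply Hn.
Qed.

Lemma tree_modelsE q m : ⟨q, m⟩ ∈ tree_models <-> q ∈ nodes /\ m = app sigma q.
Proof. apply lam_pair. Qed.

Lemma tree_filtersE q G : ⟨q, G⟩ ∈ tree_filters <-> q ∈ nodes /\ G = filter_at q.
Proof. apply lam_pair. Qed.

Lemma answer_legal n f g F : reached n f g -> F ∈ H theta ->
  answer_in (H theta) k (app sigma (position n f g)) (fam (num n) g) F ->
  app sigma (position n f g) ∈ H theta ->
  judge_legal k (num n) (lam (num n) g) (app sigma (position n f g)) F.
Proof.
  intros HR HF (A1 & A2 & A3 & A4 & A5) HmtH.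
  assert (FH : forall A, A ∈ F -> A ∈ H theta) by (intros A HA; now apply (H_trans Hr F)).
  assert (kH : forall c, c ∈ k -> c ∈ H theta).
  { intros c Hc. apply (H_trans Hr k); auto. now apply H_ord. }
  assert (Fk : F ⊆ pow k).
  { intros A HA. apply powE. intros z Hz. apply (A1 A); auto. apply (H_trans Hr A); auto. }
  split; [|split].
  - apply filter_base; auto.
    + intros A B HA HB. destruct (A2 A (FH A HA) HA B (FH B HB) HB) as (C & HC & HCF & HCz).
      exists C. split; auto. intros z Hz. apply HCz; auto. now apply (H_trans Hr C).
    + intros A c HA Hc. destruct (A3 A (FH A HA) HA c (kH c Hc) Hc) as (d & _ & Hd). eauto.
  - intros A HA. apply capE in HA as [HAk HAm]. rewrite powE in HAk.
    assert (AH : A ∈ H theta) by now apply (H_trans Hr (app sigma (position n f g))).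
    destruct (A4 A AH HAm) as [|(B & HB & HBF & EB)]; auto.
    right. replace (diff k A) with B; auto. apply ext. intros z. rewrite diffE.
    split; intros Hz; apply EB; auto; [now apply (H_trans Hr B)|now apply kH].
  - intros e He A HA. rewrite app_lam in HA by auto.
    assert (HAF : A ∈ fam (num n) g) by (apply famE; eauto).
    apply A5; auto. destruct (proj1 (num_lt n e) He) as (i & Hi & ->).
    destruct (HR i Hi) as (_ & ((HG & _) & _) & _). apply HG in HA. rewrite powE in HA.
    apply (H_sub Hr k); auto. now apply H_ord.
Qed.

(** A node is followed by all positions that extend it by the challenger's move according
    to [sigma] and some legal answer. A branch of the tree thus is a run that is lost by
    the judge. Everything is in [H theta], so relativization changes nothing. *)
Lemma strategy_tree :
  strategy_in (H theta) tree_root tree_steps tree_models tree_filters k omega.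
Proof.
  assert (kH : k ∈ H theta) by now apply H_ord.
  assert (fun_lam : forall F : U -> U, lam nodes F ∈ H theta -> functional_in (H theta) (lam nodes F)).
  { intros F HF x Hx y Hy z Hz. rewrite !rel_in_H, !lam_pair by auto. intros [_ ->] [_ ->]. auto. }
  assert (pair1 : forall r x y, r ∈ H theta -> ⟨x, y⟩ ∈ r -> x ∈ H theta /\ y ∈ H theta).
  { intros r x y Hf Hp. apply (H_opair_inv Hr). now apply (H_trans Hr r). }
  assert (node_in : forall n f g, reached n f g ->
            position n f g ∈ nodes /\ position n f g ∈ H theta /\
            app sigma (position n f g) ∈ H theta /\ fam (num n) g ∈ H theta).
  { intros n f g HR. assert (Hq : position n f g ∈ nodes) by (apply nodesE; now exists n, f, g).
    assert (P1 : ⟨position n f g, app sigma (position n f g)⟩ ∈ tree_models) by now apply tree_modelsE.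
    assert (P2 : ⟨position n f g, fam (num n) g⟩ ∈ tree_filters).
    { apply tree_filtersE. split; auto. now rewrite filter_atE. }
    apply pair1 in P1 as [P1 P1']; auto. apply pair1 in P2 as [_ P2]; auto. }
  assert (node_rel : forall n f g, reached n f g ->
            rel_in (H theta) tree_models (position n f g) (app sigma (position n f g)) /\
            rel_in (H theta) tree_filters (position n f g) (fam (num n) g)).
  { intros n f g HR. destruct (node_in n f g HR) as (N1 & N2 & N3 & N4).
    rewrite !rel_in_H by auto. split; [now apply tree_modelsE|].
    apply tree_filtersE. split; auto. now rewrite filter_atE. }
  split; [now apply fun_lam|]. split; [now apply fun_lam|]. split; [|split].
  - destruct (node_in 0 (fun x => x) (fun x => x)) as (N1 & N2 & N3 & N4); [apply reached_zero|].
    destruct (node_rel 0 (fun x => x) (fun x => x)) as (R1 & R2); [apply reached_zero|].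
    exists (app sigma tree_root). split; auto. eexists. split; [exact N4|].
    split; auto. split; auto. intros x _ Hx. apply famE in Hx as (y & Hy & _). now apply emptyE in Hy.
  - intros q Hq m Hm G HG Rm RG. apply rel_in_H in Rm, RG; auto.
    apply tree_modelsE in Rm as [Hqn ->]. apply tree_filtersE in RG as [_ ->].
    apply nodesE in Hqn as (n & f & g & HR & ->). rewrite filter_atE in *.
    destruct (reached_legal n f g HR) as ((Hweak & Hclosed) & Hel & Hinc & _).
    set (m := app sigma (position n f g)) in *.
    assert (km : k ∈ m) by apply Hweak.
    assert (m0 : empty ∈ m) by (apply Hweak, (regular_num k 0 Hk)).
    split; [|split; [|split]]; auto.
    + assert (L : inj_le m k) by (rewrite <- (proj1 Hweak); apply le_card).
      destruct L as (F & F1 & F2). set (t := img (fun x => ⟨F x, x⟩) m).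
      assert (Et : forall i x, ⟨i, x⟩ ∈ t <-> x ∈ m /\ i = F x).
      { intros i x. unfold t. rewrite imgE. split.
        - intros (x' & Hx & E). apply opair_inj in E as [-> ->]. auto.
        - intros [Hx ->]. eauto. }
      assert (tH : t ∈ H theta).
      { apply H_img; auto; [now apply H_small|]. intros x Hx. apply H_opair; auto.
        - apply (H_trans Hr k); auto.
        - apply (H_trans Hr m); auto. }
      exists t. split; auto. split.
      * intros i Hi x Hx y Hy. rewrite !rel_in_H, !Et by auto. intros [H1 ->] [H2 E]. auto.
      * intros x Hx Hxm. assert (FH : F x ∈ H theta) by (apply (H_trans Hr k); auto).
        exists (F x). split; auto. split; auto. apply rel_in_H; auto. now apply Et.
    + intros A _ HA B _ HB. exists (diff A B).
      assert (D : diff A B ∈ m) by (apply (elem_diff Heta Hel m0); auto).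
      split; [now apply (H_trans Hr m)|]. split; auto. intros z _. apply diffE.
    + intros F HF Ans.
      assert (JL := answer_legal n f g F HR HF Ans Hm). fold m in JL.
      (* the run extended by [m] and [F] *)
      set (upd := fun (h : U -> U) v x =>
        if excluded_middle_informative (x = num n) then v else h x).
      assert (updE : forall h v, upd h v (num n) = v).
      { intros h v. unfold upd. destruct (excluded_middle_informative _); tauto. }
      assert (updN : forall h v x, x ∈ num n -> upd h v x = h x).
      { intros h v x Hx. unfold upd. destruct (excluded_middle_informative _) as [->|]; auto.
        now apply no_self in Hx. }
      assert (Pos : position n (upd f m) (upd g F) = position n f g).
      { unfold position. f_equal; apply lam_ext; auto. }
      assert (HR' : reached (S n) (upd f m) (upd g F)).
      { intros i Hi. destruct (Nat.eq_dec i n) as [->|Hne].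
        - unfold stage. rewrite !updE.
          rewrite (lam_ext (num n) (upd f m) f), (lam_ext (num n) (upd g F) g) by auto.
          split; [now apply reached_legal|]. split; auto.
        - assert (Hin : (num i : U) ∈ num n) by (apply num_lt; exists i; split; auto; lia).
          apply (stage_ext k eta sigma f g); auto.
          + intros x Hx. symmetry. apply updN. apply (ord_trans _ (num i)); auto. apply ord_num.
          + intros x Hx. symmetry. apply updN. apply (ord_trans _ (num i)); auto. apply ord_num.
          + symmetry. auto.
          + symmetry. auto.
          + apply HR. lia. }
      destruct (node_in _ _ _ HR') as (N1 & N2 & N3 & N4).
      destruct (node_rel _ _ _ HR') as (R1 & R2).
      rewrite <- (filter_atE (S n) (upd f m)), filter_at_step, updE in R2 by auto.
      exists (position (S n) (upd f m) (upd g F)). split; auto.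
      exists (app sigma (position (S n) (upd f m) (upd g F))). split; auto.
      split; [|split; [|split]]; auto.
      * apply rel_in_H; auto. apply tree_stepsE. exists n, (upd f m), (upd g F). auto.
      * destruct (reached_legal _ _ _ HR') as (_ & _ & Hinc' & _).
        assert (Hin : (num n : U) ∈ num (S n)) by (apply succE; auto).
        specialize (Hinc' _ Hin). rewrite app_lam, updE in Hinc' by auto. auto.
  - intros b Hb Fb B0 Bs.
    destruct (branch_run b) as (f & g & HS & Hpos).
    + intros i x y H1 H2. assert (T1 := pair1 b i x Hb H1). assert (T2 := pair1 b i y Hb H2).
      apply (Fb i (proj1 T1) x (proj2 T1) y (proj2 T2)); apply rel_in_H; tauto.
    + assert (H0 := H_num Hr 0). apply (rel_in_H Hr); auto.
      apply B0; auto using num_omega. intros x _. simpl. rewrite emptyE. tauto.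
    + intros n. destruct (Bs (num n) (H_num Hr n) (num_omega n)
        (num (S n)) (H_num Hr (S n)) (num_omega (S n))) as (q & Hq & q' & Hq' & R1 & R2 & R3).
      { intros x _. apply succE. }
      exists q, q'. rewrite rel_in_H in R1, R2, R3 by auto using H_num. auto.
    + assert (HR : forall n, reached n f g) by (intros n i _; apply HS).
      assert (AlM : forall x, x ∈ fam omega f -> along (H theta) omega b tree_models x).
      { intros x Hx. apply famE in Hx as (i & Hi & Hx). apply omegaE in Hi as [n ->].
        destruct (node_in n f g (HR n)) as (N1 & N2 & N3 & N4).
        exists (num n). split; [now apply H_num|]. split; [apply num_omega|].
        exists (position n f g). split; auto. exists (f (num n)).
        rewrite (proj2 (proj2 (HS n))) at 1. split; auto. split; [|split]; auto.
        - apply rel_in_H; auto. now apply H_num.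
        - rewrite (proj2 (proj2 (HS n))). apply (node_rel n f g (HR n)). }
      assert (AlG : forall x, along (H theta) omega b tree_filters x <-> x ∈ fam omega g).
      { intros x. split.
        - intros (i & Hi & Hio & q & Hq & G & HG & R1 & R2 & Hx).
          apply omegaE in Hio as [n ->]. rewrite rel_in_H in R1, R2 by auto.
          assert (T := proj1 (rel_in_H Hr _ _ _ Hb Hi Hq)).
          assert (q = position n f g) as ->.
          { destruct (node_in n f g (HR n)) as (N1 & N2 & N3 & N4).
            apply (Fb (num n) Hi q Hq (position n f g) N2); apply rel_in_H; auto. }
          apply tree_filtersE in R2 as [_ ->]. rewrite filter_atE in Hx.
          apply famE in Hx as (i & Hi' & Hx). apply famE. exists i. split; auto.
          now apply (ord_trans omega (num n)); auto using ord_omega, num_omega.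
        - intros Hx. apply famE in Hx as (i & Hi & Hx). apply omegaE in Hi as [n ->].
          destruct (node_in (S n) f g (HR (S n))) as (N1 & N2 & N3 & N4).
          exists (num (S n)). split; [now apply H_num|]. split; [apply num_omega|].
          exists (position (S n) f g). split; auto. exists (fam (num (S n)) g).
          split; auto. split; [|split].
          + apply rel_in_H; auto. now apply H_num.
          + apply (node_rel (S n) f g (HR (S n))).
          + apply famE. exists (num n). split; auto. apply succE; auto. }
      assert (MH : forall x, x ∈ fam omega f -> x ∈ H theta).
      { intros x Hx. apply AlM in Hx as (i & _ & _ & q & _ & m & Hm & _ & _ & Hx).
        now apply (H_trans Hr m). }
      assert (kxH : forall c, c ∈ k -> c ∈ H theta) by (intros c Hc; now apply (H_trans Hr k)).
      assert (fp : forall h, h ∈ fam omega f -> fun_on h k -> forall x, x ∈ k ->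
                app h x ∈ H theta /\ ⟨x, app h x⟩ ∈ h).
      { intros h Hh Hhk x Hx. apply (fun_value_H Hr h k x); auto. }
      assert (ffun : forall h, h ∈ fam omega f -> fun_on h k -> functional_in (H theta) h).
      { intros h Hh Hhk x Hx y Hy z Hz. rewrite !rel_in_H by auto. apply Hhk. }
      destruct (run_lost f g HS) as [(X & HX & HXk & HXF & HD & ND)|(Z & [h0 Hh0] & HZ)].
      * left. set (D := {{ a in k | forall b, b ∈ a -> a ∈ app X b }}) in *.
        assert (ED : forall a, a ∈ D <-> a ∈ k /\ forall b, b ∈ a -> a ∈ app X b)
          by apply (sepE (fun a => forall b, b ∈ a -> a ∈ app X b)).
        exists X. split; auto. exists D. split; auto.
        split; auto. split; auto. split; [now apply ffun|].
        split; [|split; [|now rewrite AlG]].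
        { intros i Hi Hik. destruct (fp X HX HXk i Hik) as [V1 V2].
          exists (app X i). split; auto. split; [apply rel_in_H; auto|].
          apply AlG. auto. }
        { intros a Ha. rewrite ED.
          assert (Hs : a ∈ k -> forall i, i ∈ a -> i ∈ k).
          { intros Hak i Hi. apply (ord_trans k a); auto. now apply regular_ord. }
          split; intros [Hak Hi]; split; auto.
          - intros i Hi' Hia. apply (ex_value_H Hr X k i (fun A => a ∈ A)); eauto.
          - intros i Hia. apply (ex_value_H Hr X k i (fun A => a ∈ A)); eauto. }
      * right.
        assert (ZM : forall h, h ∈ Z -> h ∈ fam omega f /\ fun_on h k) by (intros h Hh; now apply HZ).
        assert (ZH : Z ∈ H theta).
        { apply (H_sub Hr (fam omega f)).
          - apply H_fam; auto; [now apply small_elem|]. intros x Hx. apply omegaE in Hx as [n ->].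
            rewrite (proj2 (proj2 (HS n))). apply (node_in n f g (HR n)).
          - intros h Hh. now apply ZM. }
        exists Z. split; auto. split.
        { exists h0. split; auto. apply MH, ZM, Hh0. }
        intros h hH Hh. destruct (ZM h Hh) as [HhM Hhk].
        split; auto. split; [now apply ffun|]. split.
        { intros x Hx Hxk. destruct (fp h HhM Hhk x Hxk) as [V1 V2].
          exists (app h x). split; auto. apply rel_in_H; auto. }
        destruct (HZ h Hh) as (_ & h' & Hh' & HA). destruct (ZM h' Hh') as [Hh'M Hh'k].
        assert (EA := sepE (fun a => app h' a ∈ app h a) k).
        exists h'. split; [now apply MH|]. split; auto.
        exists {{ a in k | app h' a ∈ app h a }}. split.
        { apply (H_sub Hr k); auto. intros z Hz. now apply EA in Hz. }
        split; [now apply AlG|]. intros x Hx HxA. apply EA in HxA as [Hxk Hlt].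
        destruct (fp h HhM Hhk x Hxk) as [V1 V2], (fp h' Hh'M Hh'k x Hxk) as [V3 V4].
        exists (app h' x). split; auto. exists (app h x). split; auto.
        split; [|split]; auto; apply rel_in_H; auto.
Qed.

End Coding.

(** * omega-Ramsey cardinals have the well-founded filter property *)

Section Forward.
Context {U : ZFC}.
Context (k : U) (Hk : regular k) (HR : omega_Ramsey k).

Lemma cardinal_in_H theta : regular theta -> k ∈ H theta -> k ∈ theta.
Proof.
  intros Hr HkH. apply (H_small Hr) in HkH as (a & Ha & L).
  apply NNPP. intros N. apply (cardinal_not_le k a); auto using regular_cardinal.
  apply (ord_nsub k theta); auto using regular_ord.
Qed.

(** Every set [x] is in [H theta] for all sufficiently large [theta]. *)
Lemma ramsey_embedding (x : U) : exists theta M j N,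
  regular theta /\ k ∈ theta /\ x ∈ H theta /\
  weak_model k M /\ elem_sub M (H theta) /\
  elem_embedding j M N /\ powerset_preserving k j M N.
Proof.
  destruct (H_eventually ⟨x, k⟩) as (l & Ol & Hl).
  destruct (HR l Ol) as (theta & Hlt & Hr & HA).
  destruct (HA empty) as (M & Hw & HE & _ & N & j & Hj & Hpp).
  { intros z Hz. now apply emptyE in Hz. }
  assert (Hp := Hl theta Hr Hlt). apply (H_opair_inv Hr) in Hp as [Hx HkH].
  exists theta, M, j, N. assert (k ∈ theta) by now apply cardinal_in_H. auto 10.
Qed.

Lemma ramsey_uncountable : omega ∈ k.
Proof.
  destruct (ramsey_embedding empty) as (theta & M & j & N & Hr & Hkt & _ & Hw & HE & Hj & Hpp).
  now apply (emb_uncountable Hk Hr Hw HE Hj Hpp).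
Qed.

Lemma ramsey_lt_power : k = lt_power k.
Proof.
  destruct (ramsey_embedding (pow (pow (pow k))))
    as (theta & M & j & N & Hr & Hkt & Hx & Hw & HE & Hj & Hpp).
  now apply (emb_lt_power Hk Hr Hkt Hw HE Hj Hpp).
Qed.

(** A winning strategy would, by elementarity, be coded in the domain of some embedding,
    where the judge can beat it. *)
Lemma ramsey_filter_property : wf_filter_property omega k.
Proof.
  intros eta Heta Hke [sigma Hwin].
  destruct (ramsey_embedding ⟨⟨tree_models k eta sigma, tree_filters k eta sigma⟩,
                              ⟨tree_steps k eta sigma, tree_root⟩⟩)
    as (theta & M & j & N & Hr & Hkt & Hx & Hw & HE & Hj & Hpp).
  apply (H_opair_inv Hr) in Hx as [Hx1 Hx2].
  apply (H_opair_inv Hr) in Hx1 as [Hm Hf], Hx2 as [Hs Hrt].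
  assert (Hom : omega ∈ theta).
  { apply (ord_trans theta k); auto using regular_ord, ramsey_uncountable. }
  assert (T := strategy_tree k eta sigma Hk Heta Hwin theta Hr Hkt Hom Hm Hf Hs Hrt).
  assert (H0 : empty ∈ M) by now apply (emb_empty Hk Hw).
  assert (HkM : k ∈ M) by apply Hw.
  assert (HoM : omega ∈ M) by (apply Hw, ramsey_uncountable).
  set (P := fun K (e : nat -> U) => exists c, c ∈ K /\ exists S, S ∈ K /\ exists mm, mm ∈ K /\
    exists GG, GG ∈ K /\ strategy_in K c S mm GG (e 0) (e 1)).
  assert (HP : Dfn P).
  { (* the innermost quantifier binds [e 0], so the arguments come in reverse order *)
    unfold P. dfn. apply (dfn_rename _ (fun n => match n with 0 => 3 | 1 => 2 | 2 => 1 | 3 => 0 | _ => n end)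
      (fun e n => e (match n with 0 => 3 | 1 => 2 | 2 => 1 | 3 => 0 | _ => n end)) strategy_dfn).
    reflexivity. }
  assert (PM : P M (ev [k; omega])).
  { apply (elem_dfn P M (H theta)); auto; [apply ev_in; auto|].
    exists tree_root. split; auto. exists (tree_steps k eta sigma). split; auto.
    exists (tree_models k eta sigma). split; auto. exists (tree_filters k eta sigma). auto. }
  destruct PM as (c & Hc & S & HS & mm & Hmm & GG & HGG & Q).
  apply (no_strategy Hk Hr Hkt Hw HE Hj Hpp c S mm GG); auto.
  apply (elem_dfn _ M (H theta) (ev [c; S; mm; GG; k; omega]) strategy_dfn); auto.
  apply ev_in; auto 10.
Qed.

End Forward.

(** * Existence of [kappa]-models *)

(** Formulas are coded by numbers so that an [omega]-sequence can name one. *)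
Fixpoint form_code (phi : form) : nat :=
  match phi with
  | fMem i j => to_nat (0, to_nat (i, j))
  | fEq i j => to_nat (1, to_nat (i, j))
  | fNot p => to_nat (2, form_code p)
  | fAnd p q => to_nat (3, to_nat (form_code p, form_code q))
  | fAll i p => to_nat (4, to_nat (i, form_code p))
  end.

Local Opaque to_nat.

Lemma form_code_inj p q : form_code p = form_code q -> p = q.
Proof.
  assert (TI : forall x y, to_nat x = to_nat y -> x = y).
  { intros x y E. rewrite <- (cancel_of_to x), <- (cancel_of_to y). now rewrite E. }
  revert q. induction p; intros []; cbn [form_code]; intros E; apply TI in E;
    try discriminate; injection E; try intros E1; try (apply TI in E1; injection E1);
    intros; f_equal; auto.
Qed.

Section Models.
Context {U : ZFC}.
Implicit Types (a b c d r x y z A B C F M X xi s : U).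
Context (k theta : U) (Hk : regular k) (Hr : regular theta) (Hkt : k ∈ theta)
  (Hom : omega ∈ k) (Hlt : k = lt_power k).

Definition seqs X : U := {{ f | exists a, a ∈ k /\ fun_to f a X }}.

Lemma seqsE X f : f ∈ seqs X <-> exists a, a ∈ k /\ fun_to f a X.
Proof.
  apply (comprE (fun f => exists a, a ∈ k /\ fun_to f a X)).
  exists (pow (prod k X)). intros g (a & Ha & Hg & Hg'). apply powE. intros p Hp.
  rewrite (fun_on_lam g a Hg) in Hp. apply lamE in Hp as (x & Hx & ->).
  apply prod_in. split; auto. apply (ord_trans k a); auto. now apply regular_ord.
Qed.

Lemma lam_fun_to a X (G : U -> U) : (forall x, x ∈ a -> G x ∈ X) -> fun_to (lam a G) a X.
Proof. intros HG. split; [apply lam_fun_on|]. intros x Hx. rewrite app_lam; auto. Qed.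

Lemma seqs_le X : inj_le X k -> inj_le (seqs X) k.
Proof.
  intros (h & h1 & h2). apply (inj_le_trans _ (seqs k)).
  - destruct (class_choice (fun f a => a ∈ k /\ fun_to f a X) (seqs X)) as [dom Hd].
    { intros f. apply seqsE. }
    exists (fun f => lam (dom f) (fun x => h (app f x))). split.
    + intros f Hf. destruct (Hd f Hf) as [D1 D2]. apply seqsE. exists (dom f). split; auto.
      apply lam_fun_to. intros x Hx. now apply h1, D2.
    + intros f g Hf Hg E. destruct (Hd f Hf) as [D1 D2], (Hd g Hg) as [D3 D4].
      assert (V : forall x, x ∈ dom f -> x ∈ dom g /\ h (app f x) = h (app g x)).
      { intros x Hx. apply (lam_pair (dom g) (fun x => h (app g x))). rewrite <- E. now apply lam_pair. }
      assert (V' : forall x, x ∈ dom g -> x ∈ dom f).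
      { intros x Hx. apply (lam_pair (dom f) (fun x => h (app f x)) x (h (app g x))).
        rewrite E. now apply lam_pair. }
      assert (Ed : dom f = dom g).
      { apply ext. intros x. split; auto. intros Hx. now apply V. }
      apply (fun_on_ext f g (dom f)); [apply D2|rewrite Ed; apply D4|].
      intros x Hx. apply h2; [now apply D2| |now apply V].
      rewrite Ed in Hx. now apply D4.
  - rewrite Hlt at 2. apply le_card.
Qed.

(** A pair is a sequence of length 2. *)
Lemma k_square : inj_le (prod k k) k.
Proof.
  apply (inj_le_trans _ (seqs k)); [|apply seqs_le, inj_le_refl].
  set (pr := fun (a b i : U) => if excluded_middle_informative (i = num 0 :> U) then a else b).
  apply (surj_le (fun s => ⟨app s (num 0), app s (num 1)⟩)).
  intros p Hp. apply prodE in Hp as (a & b & Ha & Hb & ->).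
  assert (I0 : (num 0 : U) ∈ num 2) by (apply num_lt; exists 0; auto).
  assert (I1 : (num 1 : U) ∈ num 2) by (apply num_lt; exists 1; auto).
  exists (lam (num 2) (pr a b)). split.
  - apply seqsE. exists (num 2). split; [now apply regular_num|].
    apply lam_fun_to. intros x Hx. unfold pr. destruct (excluded_middle_informative _); auto.
  - rewrite !app_lam by auto. unfold pr.
    destruct (excluded_middle_informative (num 0 = num 0)) as [_|N]; [|tauto].
    destruct (excluded_middle_informative (num 1 = num 0)) as [E|_]; auto.
    apply num_inj in E. discriminate.
Qed.

(** An [omega]-sequence codes a formula, by its first entry, and an environment. *)
Definition seq_env s : nat -> U := fun n => app s (num (S n)).
Definition seq_code s phi := app s (num 0) = num (form_code phi).

(** One Skolem function serves all formulas and environments, by means of the coding; a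
    quantified formula [fAll i p] asks for a witness of [exists x_i, p]. *)
Definition skolem s : U := the (fun x => x ∈ H theta /\ forall i p, seq_code s (fAll i p) ->
  (exists y, y ∈ H theta /\ sat (H theta) (update (seq_env s) i y) p) ->
  sat (H theta) (update (seq_env s) i x) p).

Lemma skolem_spec s : skolem s ∈ H theta /\ forall i p, seq_code s (fAll i p) ->
  (exists y, y ∈ H theta /\ sat (H theta) (update (seq_env s) i y) p) ->
  sat (H theta) (update (seq_env s) i (skolem s)) p.
Proof.
  apply (the_spec (fun x => x ∈ H theta /\ forall i p, seq_code s (fAll i p) ->
  (exists y, y ∈ H theta /\ sat (H theta) (update (seq_env s) i y) p) ->
  sat (H theta) (update (seq_env s) i x) p)).
  destruct (classic (exists i p, seq_code s (fAll i p) /\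
     exists y, y ∈ H theta /\ sat (H theta) (update (seq_env s) i y) p))
    as [(i & p & Hc & y & Hy & Hp)|N].
  - exists y. split; auto. intros i' p' Hc' _. unfold seq_code in *. rewrite Hc in Hc'.
    apply num_inj, form_code_inj in Hc'. injection Hc'. intros -> ->. exact Hp.
  - exists empty. split; [apply (H_num Hr 0)|]. intros i p Hc Hy. exfalso. eauto.
Qed.

Definition hull_step X : U := un (un X (seqs X)) (img skolem (seqs X)).

Definition hull_stage X : U -> U :=
  wfrec mem_wf (fun a T => un X (fam a (fun b => hull_step (T b)))).

Lemma hull_stageE X a x : x ∈ hull_stage X a <->
  x ∈ X \/ exists b, b ∈ a /\ x ∈ hull_step (hull_stage X b).
Proof.
  unfold hull_stage at 1. rewrite wfrec_eq, unE, famE.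
  split; intros [Hx|(b & Hb & Hx)]; auto; right; exists b; split; auto; revert Hx;
    destruct (excluded_middle_informative (b ∈ a)); tauto.
Qed.

Definition hull X : U := fam k (hull_stage X).

Lemma hull_stage_mono X a b : b ∈ a -> hull_stage X b ⊆ hull_stage X a.
Proof.
  intros Hb x Hx. apply hull_stageE. right. exists b. split; auto.
  apply unE. left. apply unE. auto.
Qed.

Lemma seqs_in_H X : X ⊆ H theta -> seqs X ⊆ H theta.
Proof.
  intros HX f Hf. apply seqsE in Hf as (a & Ha & Hf & Hf'). rewrite (fun_on_lam f a Hf).
  assert (Hat : a ∈ theta) by (apply (ord_trans theta k); auto using regular_ord).
  apply H_lam; auto; [now apply small_elem|]. intros x Hx.
  apply (H_trans Hr a); auto. now apply H_ord.
Qed.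

Lemma hull_in_H X : X ⊆ H theta -> hull X ⊆ H theta.
Proof.
  intros HX.
  assert (T : forall a, hull_stage X a ⊆ H theta).
  { intros a. induction a as [a IH] using (well_founded_induction mem_wf).
    intros x Hx. apply hull_stageE in Hx as [Hx|(b & Hb & Hx)]; auto.
    apply unE in Hx as [Hx|Hx]; [apply unE in Hx as [Hx|Hx]|].
    - now apply (IH b).
    - exact (seqs_in_H _ (IH b Hb) x Hx).
    - apply imgE in Hx as (s & _ & ->). apply skolem_spec. }
  intros x Hx. apply famE in Hx as (a & _ & Hx). now apply (T a).
Qed.

Lemma elem_le_k a : a ∈ k -> inj_le a k.
Proof. intros Ha. apply inj_le_sub. exact (proj1 (regular_ord k Hk) a Ha). Qed.

Lemma hull_le X : inj_le X k -> inj_le (hull X) k.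
Proof.
  intros LX. assert (two : inj_le (num 2) k) by (apply elem_le_k; now apply regular_num).
  assert (sq := k_square).
  assert (T : forall a, a ∈ k -> inj_le (hull_stage X a) k).
  { intros a. induction a as [a IH] using (well_founded_induction mem_wf). intros Ha.
    apply (inj_le_trans _ (un X (fam a (fun b => hull_step (hull_stage X b))))).
    { apply inj_le_sub. intros x Hx. apply hull_stageE in Hx. now rewrite unE, famE. }
    apply un_le; auto. apply fam_le; auto using elem_le_k. intros b Hb.
    assert (Lb : inj_le (hull_stage X b) k).
    { apply IH; auto. apply (ord_trans k a); auto. now apply regular_ord. }
    apply un_le; auto.
    - apply un_le; auto. now apply seqs_le.
    - eapply inj_le_trans; [apply img_le|now apply seqs_le]. }
  apply fam_le; auto using inj_le_refl.
Qed.

(** By regularity of [k], a short sequence of elements of the hull appears at one of the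
    [k] stages of its construction, and the next stage takes care of it. *)
Lemma hull_seqs X f a : a ∈ k -> fun_to f a (hull X) ->
  f ∈ hull X /\ skolem f ∈ hull X.
Proof.
  intros Ha [Hf Hf'].
  destruct (class_choice (fun x b => b ∈ k /\ app f x ∈ hull_stage X b) a) as [st Hst].
  { intros x Hx. apply famE. now apply Hf'. }
  destruct (small_bounded k (img st a) Hk) as (b & Hb & Hsb).
  { intros z Hz. apply imgE in Hz as (x & Hx & ->). now apply Hst. }
  { apply (small_le k _ a); [apply img_le|now apply small_elem]. }
  assert (Hfs : f ∈ seqs (hull_stage X b)).
  { apply seqsE. exists a. split; auto. split; auto. intros x Hx.
    apply (hull_stage_mono X b (st x)); [now apply Hsb, img_in|now apply Hst]. }
  assert (St : forall x, x ∈ hull_step (hull_stage X b) -> x ∈ hull X).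
  { intros x Hx. apply famE. exists (succ b). split; [now apply regular_succ|].
    apply hull_stageE. right. exists b. split; auto. apply succE; auto. }
  split; apply St; apply unE.
  - left. apply unE. auto.
  - right. now apply img_in.
Qed.

Lemma hull_elem X : X ⊆ H theta -> k ⊆ X -> elem_sub (hull X) (H theta).
Proof.
  intros HX HkX. apply tarski_vaught; [now apply hull_in_H|].
  intros p e i He Hy.
  assert (XM : X ⊆ hull X).
  { intros x Hx. apply famE. exists (num 0). split; [now apply regular_num|].
    apply hull_stageE; auto. }
  set (val := fun n => match n with 0 => num (form_code (fAll i p)) | S n => e n end).
  set (s := lam omega (fun x => val (unnum x))).
  assert (Sv : forall n, app s (num n) = val n).
  { intros n. unfold s. rewrite app_lam by apply num_omega. now rewrite unnumK. }
  assert (Se : seq_env s = e).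
  { apply functional_extensionality. intros n. apply (Sv (S n)). }
  exists (skolem s). split.
  - apply (hull_seqs X s omega Hom). apply lam_fun_to. intros x Hx.
    apply omegaE in Hx as [n ->]. rewrite unnumK. destruct n; simpl; auto.
    apply XM, HkX. now apply regular_num.
  - destruct (skolem_spec s) as [_ Hs]. rewrite Se in Hs. apply Hs; auto. apply (Sv 0).
Qed.

(** Close under short sequences and Skolem functions in [k] stages. As [k = k^{<k}], there
    are only [k] short sequences of elements of a stage. *)
Lemma kappa_model_exists X : X ⊆ H theta -> inj_le X k ->
  exists M, kappa_model k M /\ elem_sub M (H theta) /\ X ⊆ M.
Proof.
  (* [succ k] puts [k] and its elements into the hull *)
  intros HX LX. set (Y := un X (succ k)).
  assert (kH : k ∈ H theta) by now apply H_ord.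
  assert (HY : Y ⊆ H theta).
  { intros y Hy. apply unE in Hy as [Hy|Hy]; auto. apply succE in Hy as [Hy| ->]; auto.
    now apply (H_trans Hr k). }
  assert (YM : Y ⊆ hull Y).
  { intros x Hx. apply famE. exists (num 0). split; [now apply regular_num|].
    apply hull_stageE; auto. }
  assert (two : inj_le (num 2) k) by (apply elem_le_k; now apply regular_num).
  assert (sq := k_square).
  assert (kY : k ⊆ Y) by (intros z Hz; apply unE; right; apply succE; auto).
  assert (El : elem_sub (hull Y) (H theta)) by now apply hull_elem.
  exists (hull Y). split; [split; [split; [|split; [|split]]|]|split]; auto.
  - apply card_eq; [now apply regular_cardinal| |apply inj_le_sub; auto].
    apply hull_le, un_le, succ_le; auto using inj_le_refl.
  - apply YM, unE. right. apply succE; auto.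
  - apply (elem_ZFCminus Hr); auto.
    + apply (ord_trans theta k); auto. now apply regular_ord.
    + apply YM, kY. apply (regular_num k 0 Hk).
  - intros f a Ha Hf. now apply (hull_seqs Y f a).
  - intros x Hx. apply YM, unE; auto.
Qed.

(** * The challenger's strategy *)

Lemma model_in_H M : weak_model k M -> M ⊆ H theta -> M ∈ H theta.
Proof.
  intros [E _] HM. apply H_intro; auto. exists k. split; auto.
  rewrite <- E. apply le_card.
Qed.

Lemma next_model A xi (Ms Fs : U) : A ⊆ k -> xi ∈ omega -> legal_run k theta xi Ms Fs ->
  exists M, challenger_legal k theta xi Ms Fs M /\ A ∈ M.
Proof.
  intros HA Hxi (HMs & HFs & HL).
  assert (Hxk : xi ∈ k) by (apply (ord_trans k omega); auto; now apply regular_ord).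
  assert (Hxt : xi ∈ theta) by (apply (ord_trans theta k); auto; now apply regular_ord).
  assert (Oxi : is_ordinal xi) by (apply (ord_in omega); auto using ord_omega).
  assert (MW : forall e, e ∈ xi -> weak_model k (app Ms e) /\ app Ms e ⊆ H theta).
  { intros e He. destruct (HL e He) as [((H1 & _) & H2 & _) _]. split; auto. apply H2. }
  assert (MH : forall e, e ∈ xi -> app Ms e ∈ H theta).
  { intros e He. now apply model_in_H; apply MW. }
  assert (xiH : xi ⊆ H theta).
  { intros z Hz. apply (H_trans Hr xi); auto. now apply H_ord. }
  set (tr := lam xi (fun e => cap (app Fs e) (app Ms e))).
  assert (MsH : Ms ∈ H theta).
  { rewrite (fun_on_lam Ms xi HMs). apply H_lam; auto. now apply small_elem. }
  assert (trH : tr ∈ H theta).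
  { apply H_lam; auto; [now apply small_elem|]. intros e He.
    apply (H_sub Hr (app Ms e)); auto. intros z Hz. now apply capE in Hz. }
  assert (AH : A ∈ H theta) by (apply (H_sub Hr k); auto; now apply H_ord).
  set (X := un (fam xi (app Ms)) (un (upair Ms tr) (upair A A))).
  assert (two : inj_le (num 2) k) by (apply elem_le_k; now apply regular_num).
  assert (pr : forall u v : U, inj_le (upair u v) k).
  { intros u v. eapply inj_le_trans; [apply upair_le|exact two]. }
  assert (sq := k_square).
  destruct (kappa_model_exists X) as (M & HM & El & XM).
  - intros z Hz. apply unE in Hz as [Hz|Hz]; [|apply unE in Hz as [Hz|Hz]].
    + apply famE in Hz as (e & He & Hz). now apply (MW e He).
    + apply upairE in Hz as [-> | ->]; auto.
    + apply upairE in Hz as [-> | ->]; auto.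
  - repeat apply un_le; auto. apply fam_le; auto using elem_le_k.
    intros e He. destruct (MW e He) as [[E _] _]. rewrite <- E. apply le_card.
  - exists M. split; [split; [|split; [|split; [|split]]]|]; auto.
    + intros e He z Hz. apply XM, unE. left. apply famE. eauto.
    + apply XM, unE. right. apply unE. left. apply upairE; auto.
    + apply XM, unE. right. apply unE. left. apply upairE; auto.
    + apply XM, unE. right. apply unE. right. apply upairE; auto.
Qed.

Lemma fun_on_dom f d d' : fun_on f d -> fun_on f d' -> d = d'.
Proof. intros [_ H1] [_ H2]. apply ext. intros x. now rewrite <- H1, <- H2. Qed.

(** Always making a move that contains [A] is a strategy of the challenger; since it does
    not win, some run against it is won by the judge. *)
Lemma winning_run A : A ⊆ k ->
  (~ exists sigma, challenger_winning k theta omega sigma) ->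
  exists f g sigma, (forall n, stage k theta sigma f g (num n)) /\ A ∈ f (num 0) /\
    normal_filter k (fam omega f) (fam omega g) /\
    well_founded_ultrapower k (fam omega f) (fam omega g).
Proof.
  intros HA NW.
  set (legal := fun p => exists xi Ms Fs, xi ∈ omega /\ legal_run k theta xi Ms Fs /\ p = ⟨Ms, Fs⟩).
  set (Pos := {{ p | legal p }}).
  assert (PosE : forall p, p ∈ Pos <-> legal p).
  { apply comprE. set (X := un omega (un (pow (H theta)) (pow (pow k)))).
    assert (HX : forall xi h, xi ∈ omega -> fun_on h xi -> (forall i, i ∈ xi -> app h i ∈ X) ->
              h ∈ pow (pow (pow X))).
    { intros xi h Hxi Hh Hv. apply powE. intros p Hp. rewrite (fun_on_lam h xi Hh) in Hp.
      apply lamE in Hp as (x & Hx & ->). apply opair_in_pow; auto.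
      apply unE. left. now apply (ord_trans omega xi); auto using ord_omega. }
    exists (pow (pow (pow (pow (pow X))))). intros p (xi & Ms & Fs & Hxi & (HMs & HFs & HL) & ->).
    apply opair_in_pow; apply (HX xi); auto; intros i Hi;
      destruct (HL i Hi) as ((_ & H1 & _) & (H2 & _) & _); apply unE; right; apply unE.
    - left. apply powE, H1.
    - right. apply powE, H2. }
  destruct (class_choice (fun p M => exists xi Ms Fs, legal_run k theta xi Ms Fs /\
     p = ⟨Ms, Fs⟩ /\ challenger_legal k theta xi Ms Fs M /\ A ∈ M) Pos) as [move Hm].
  { intros p Hp. apply PosE in Hp as (xi & Ms & Fs & Hxi & HL & ->).
    destruct (next_model A xi Ms Fs HA Hxi HL) as (M & H1 & H2). exists M, xi, Ms, Fs. auto. }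
  assert (Hmove : forall xi (Ms Fs : U), xi ∈ omega -> legal_run k theta xi Ms Fs ->
     challenger_legal k theta xi Ms Fs (move ⟨Ms, Fs⟩) /\ A ∈ move ⟨Ms, Fs⟩).
  { intros xi Ms Fs Hxi HL. destruct (Hm ⟨Ms, Fs⟩) as (xi' & Ms' & Fs' & HL' & E & H1 & H2).
    { apply PosE. exists xi, Ms, Fs. auto. }
    apply opair_inj in E as [<- <-].
    assert (E := fun_on_dom Ms xi' xi (proj1 HL') (proj1 HL)). subst xi'. split; auto. }
  set (sigma := lam Pos move).
  assert (Hsig : forall xi (Ms Fs : U), xi ∈ omega -> legal_run k theta xi Ms Fs ->
     ⟨Ms, Fs⟩ ∈ Pos /\ app sigma ⟨Ms, Fs⟩ = move ⟨Ms, Fs⟩).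
  { intros xi Ms Fs Hxi HL. assert (HP : ⟨Ms, Fs⟩ ∈ Pos) by (apply PosE; exists xi, Ms, Fs; auto).
    split; auto. unfold sigma. now rewrite app_lam. }
  assert (Run : exists Ms Fs, legal_run k theta omega Ms Fs /\ follows sigma omega Ms Fs /\
                  judge_wins k omega Ms Fs).
  { apply NNPP. intros No. apply NW. exists sigma. split; [apply lam_fun_on|]. split.
    - intros xi Ms Fs Hxi HL _. destruct (Hsig xi Ms Fs Hxi HL) as [H1 H2]. rewrite H2. split.
      + exists (move ⟨Ms, Fs⟩). now apply lam_pair.
      + now apply Hmove.
    - intros Ms Fs HL HF HJ. apply No. eauto. }
  destruct Run as (Ms & Fs & HL & HF & HJ).
  assert (EMs := fun_on_lam Ms omega (proj1 HL)).
  assert (EFs := fun_on_lam Fs omega (proj1 (proj2 HL))).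
  set (f := app Ms) in *. set (g := app Fs) in *. rewrite EMs, EFs in HL, HF.
  assert (HS := proj1 (run_stages k theta sigma f g omega ord_omega) (conj HL HF)).
  exists f, g, sigma. split; [intros n; apply HS, num_omega|]. split.
  - destruct (HS (num 0) (num_omega 0)) as (_ & _ & E0). rewrite E0.
    assert (L0 : legal_run k theta (num 0) (lam (num 0) f) (lam (num 0) g)).
    { split; [apply lam_fun_on|split; [apply lam_fun_on|]]. intros e He. now apply emptyE in He. }
    destruct (Hsig _ _ _ (num_omega 0) L0) as [_ E1]. rewrite E1.
    now apply (Hmove (num 0)); auto using num_omega.
  - exact HJ.
Qed.

End Models.

(** * Ultrapowers of elementary substructures *)

Section Functions.
Context {U : ZFC}.
Implicit Types (a b c d x y z A B C K f g h : U).
Context (k theta : U) (Hk : regular k) (Hr : regular theta) (Hkt : k ∈ theta).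

Definition pair_in K p x y := exists s, s ∈ K /\ exists t, t ∈ K /\
  (upair_in K s x x /\ upair_in K t x y /\ upair_in K p s t).

Definition fun_in K f d :=
  (forall p, p ∈ K -> p ∈ f -> exists x, x ∈ K /\ (x ∈ d /\ exists y, y ∈ K /\ pair_in K p x y)) /\
  (forall x, x ∈ K -> x ∈ d -> exists y, y ∈ K /\ rel_in K f x y) /\
  functional_in K f.

Lemma pair_in_H p x y : p ∈ H theta -> x ∈ H theta -> y ∈ H theta ->
  (pair_in (H theta) p x y <-> p = ⟨x, y⟩).
Proof.
  intros Hp Hx Hy. split.
  - intros (s & Hs & t & Ht & Es & Et & Ep). apply upair_in_H in Es, Et, Ep; auto.
    now subst.
  - intros ->. exists (upair x x). split; [now apply H_upair|].
    exists (upair x y). split; [now apply H_upair|].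
    split; [|split]; apply upair_in_H; auto using H_upair.
Qed.

Lemma fun_in_H f d : f ∈ H theta -> d ∈ H theta -> (fun_in (H theta) f d <-> fun_on f d).
Proof.
  intros Hf Hd.
  assert (pr : forall x y, ⟨x, y⟩ ∈ f -> x ∈ H theta /\ y ∈ H theta).
  { intros x y Hp. apply (H_opair_inv Hr). now apply (H_trans Hr f). }
  assert (dH : forall x, x ∈ d -> x ∈ H theta) by (intros x Hx; now apply (H_trans Hr d)).
  split.
  - intros (F1 & F2 & F3).
    assert (Q : forall p, p ∈ f -> exists x y, x ∈ d /\ p = ⟨x, y⟩).
    { intros p Hp. assert (pH : p ∈ H theta) by now apply (H_trans Hr f).
      destruct (F1 p pH Hp) as (x & Hx & Hxd & y & Hy & E). apply pair_in_H in E; eauto. }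
    split; [split|].
    + intros p Hp. destruct (Q p Hp) as (x & y & _ & E). eauto.
    + intros x y z Hy Hz. destruct (pr x y Hy) as [xH yH], (pr x z Hz) as [_ zH].
      apply (F3 x xH y yH z zH); now apply rel_in_H.
    + intros x. split.
      * intros [y Hy]. destruct (Q _ Hy) as (x' & y' & Hx & E). apply opair_inj in E as [-> _]. auto.
      * intros Hx. destruct (F2 x (dH x Hx) Hx) as (y & Hy & R). apply rel_in_H in R; auto.
        now exists y.
  - intros Hfd. split; [|split].
    + intros p pH Hp. rewrite (fun_on_lam f d Hfd) in Hp. apply lamE in Hp as (x & Hx & ->).
      exists x. split; auto. split; auto. exists (app f x).
      destruct (pr x (app f x)) as [xH yH]; [now apply (fun_pair f d)|].
      split; auto. now apply pair_in_H.
    + intros x xH Hx. assert (Hp : ⟨x, app f x⟩ ∈ f) by now apply (fun_pair f d).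
      destruct (pr _ _ Hp). exists (app f x). split; auto. now apply rel_in_H.
    + intros x Hx y Hy z Hz. rewrite !rel_in_H by auto. apply Hfd.
Qed.

(** The functions [e i] with [i < n] are replaced one by one, by quantifying over their
    values at [a]. *)
Lemma dfn_pointwise phi n : exists P, Dfn P /\ forall a e, a ∈ k ->
  (forall i, i < n -> e i ∈ H theta /\ fun_on (e i) k) ->
  (P (H theta) (scons a e) <->
   sat (H theta) (fun i => if i <? n then app (e i) a else e i) phi).
Proof.
  induction n as [|n (P & HP & EP)].
  - exists (fun K e => sat K (fun i => e (S i)) phi). split.
    + apply (dfn_rename (fun K e => sat K e phi) S (fun e i => e (S i))); [dfn|reflexivity].
    + intros a e _ _. reflexivity.
  - exists (fun K e => exists y, y ∈ K /\ (rel_in K (e (S n)) (e 0) y /\ P K (update e (S n) y))).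
    split.
    + dfn. apply (dfn_rename P (fun m => if m =? S n then 0 else S m)
        (fun e => update (fun m => e (S m)) (S n) (e 0))); auto.
      intros e m. unfold update. now destruct (m =? S n).
    + intros a e Ha He. simpl.
      assert (aH : a ∈ H theta) by (apply (H_trans Hr k); auto; now apply H_ord).
      assert (Hn : e n ∈ H theta /\ fun_on (e n) k) by (apply He; lia).
      assert (E : forall y, P (H theta) (update (scons a e) (S n) y) <->
        sat (H theta) (fun i => if i <? n then app (e i) a else update e n y i) phi).
      { intros y.
        assert (Eu : update (scons a e) (S n) y = scons a (update e n y)).
        { apply functional_extensionality. intros [|m]; reflexivity. }
        rewrite Eu, EP; auto.
        - apply sat_ext. intros i _. destruct (Nat.ltb_spec i n); auto. unfold update.
          destruct (Nat.eqb_spec i n); auto. lia.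
        - intros i Hi. unfold update. destruct (Nat.eqb_spec i n); [lia|]. apply He. lia. }
      assert (Ev : sat (H theta) (fun i => if i <? n then app (e i) a else update e n (app (e n) a) i) phi
               <-> sat (H theta) (fun i => if i <? S n then app (e i) a else e i) phi).
      { apply sat_ext. intros i _. unfold update.
        destruct (Nat.ltb_spec i n), (Nat.ltb_spec i (S n)), (Nat.eqb_spec i n); subst; auto; lia. }
      rewrite <- Ev, <- E. split.
      * intros (y & Hy & R & Hp). apply rel_in_H in R; try tauto.
        apply (fun_pair (e n) k) in R as [_ ->]; tauto.
      * intros Hp. exists (app (e n) a).
        assert (Hpr : ⟨a, app (e n) a⟩ ∈ e n) by (apply (fun_pair (e n) k); tauto).
        assert (yH : app (e n) a ∈ H theta).
        { apply (H_opair_inv Hr a), (H_trans Hr (e n)); tauto. }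
        split; auto. split; auto. apply rel_in_H; tauto.
Qed.

Lemma dfn_values phi : exists P, Dfn P /\ forall a e, a ∈ k ->
  (forall i, e i ∈ H theta /\ fun_on (e i) k) ->
  (P (H theta) (scons a e) <-> sat (H theta) (fun i => app (e i) a) phi).
Proof.
  destruct (dfn_pointwise phi (var_bound phi)) as (P & HP & EP).
  exists P. split; auto. intros a e Ha He. rewrite EP by auto.
  apply sat_ext. intros i Hi. destruct (Nat.ltb_spec i (var_bound phi)); auto. lia.
Qed.

End Functions.

Section Ultrapower.
Context {U : ZFC}.
Implicit Types (a b c d x y z A B C K f g h : U).
Context (k theta : U) (Hk : regular k) (Hr : regular theta) (Hkt : k ∈ theta).
Context (M F : U) (Hw : weak_model k M) (HE : elem_sub M (H theta))
  (HN : normal_filter k M F) (Hwf : well_founded_ultrapower k M F)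
  (Ham : forall Y, Y ∈ M -> fun_on Y k -> (forall b, b ∈ k -> app Y b ⊆ k) ->
     {{ b in k | app Y b ∈ F }} ∈ M).

Let FF : filter k F := proj1 HN.

Lemma ult_k_sub : k ⊆ M.
Proof. apply Hw. Qed.

Lemma ult_k_in : k ∈ M.
Proof. apply Hw. Qed.

Lemma ult_empty : empty ∈ M.
Proof. apply ult_k_sub, (regular_num k 0 Hk). Qed.

Lemma ult_H x : x ∈ M -> x ∈ H theta.
Proof. apply HE. Qed.

Lemma ult_k_H a : a ∈ k -> a ∈ H theta.
Proof. intros Ha. now apply ult_H, ult_k_sub. Qed.

Lemma ult_measures A : A ∈ M -> A ⊆ k -> A ∈ F \/ diff k A ∈ F.
Proof. intros HA HAk. apply (proj1 (proj2 HN)), capE. now rewrite powE. Qed.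

Lemma ult_meet A B : A ∈ F -> B ∈ F -> exists x, x ∈ k /\ x ∈ A /\ x ∈ B.
Proof.
  intros HA HB. destruct (filter_meet k F A B B Hk FF HA HB HB) as (x & H1 & H2 & H3 & _). eauto.
Qed.

Lemma ult_up A B C : A ∈ F -> B ∈ F -> C ∈ M -> C ⊆ k ->
  (forall x, x ∈ k -> x ∈ A -> x ∈ B -> x ∈ C) -> C ∈ F.
Proof.
  intros HA HB HC HCk HABC. apply (filter_sup k F A B C Hk FF); auto using ult_measures.
Qed.

Lemma ult_k_F : k ∈ F.
Proof. apply filter_k; auto. apply ult_measures; auto using ult_k_in. Qed.

(** Otherwise [b] itself, of size less than [k], would be in the filter. *)
Lemma ult_tail b : b ∈ k -> diff k b ∈ F.
Proof.
  intros Hb. assert (Hbk : b ⊆ k) by exact (proj1 (regular_ord k Hk) b Hb).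
  destruct (ult_measures b (ult_k_sub b Hb) Hbk) as [HbF|]; auto. exfalso.
  assert (E : card (bigcap k (sing b)) = k).
  { apply FF; [intros x Hx; apply singE in Hx as ->; auto|].
    apply (finite_le _ 2), upair_le. }
  assert (L : inj_le k b).
  { rewrite <- E. eapply inj_le_trans; [apply card_le|]. apply inj_le_sub.
    intros x Hx. apply bigcapE in Hx as [_ Hx]. apply Hx. now apply singE. }
  apply (cardinal_not_le k b); auto. now apply regular_cardinal.
Qed.

(** ** Functions and sets definable over [M] *)

Lemma ult_sep P e : Dfn P -> env_in M e -> {{ a in k | P (H theta) (scons a e) }} ∈ M.
Proof.
  intros HP He. assert (E := sepE (fun a => P (H theta) (scons a e)) k).
  apply (elem_set_env Hr HE (fun K e => e 0 ∈ e 1 /\ P K (scons (e 0) (fun n => e (S (S n)))))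
    (scons k e)).
  - dfn. apply (dfn_rename P (fun n => match n with 0 => 0 | S n => S (S n) end)
      (fun e => scons (e 0) (fun n => e (S (S n))))); auto. intros e' [|n]; reflexivity.
  - intros [|n]; [apply ult_k_in|apply He].
  - apply (H_sub Hr k); [apply ult_H, ult_k_in|]. intros z Hz. now apply E in Hz.
  - intros z _. apply E.
Qed.

Lemma ult_lam (G : U -> U) P e : Dfn P -> env_in M e ->
  (forall a, a ∈ k -> G a ∈ H theta) ->
  (forall a y, a ∈ k -> y ∈ H theta -> (y = G a <-> P (H theta) (scons y (scons a e)))) ->
  ult_fun k M (lam k G).
Proof.
  intros HP He HG EG. split; [|apply lam_fun_on].
  apply (elem_set_env Hr HE (fun K e => exists a, a ∈ K /\ (a ∈ e 1 /\
    exists y, y ∈ K /\ (pair_in K (e 0) a y /\ P K (scons y (scons a (fun n => e (S (S n)))))))) (scons k e)).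
  - unfold pair_in. dfn.
    apply (dfn_rename P (fun n => match n with 0 => 0 | 1 => 1 | S (S n) => S (S (S (S n))) end)
      (fun e => scons (e 0) (scons (e 1) (fun n => e (S (S (S (S n)))))))); auto.
    intros e' [|[|n]]; reflexivity.
  - intros [|n]; [apply ult_k_in|apply He].
  - apply H_lam; auto using ult_k_H. now apply small_elem.
  - intros z zH. rewrite lamE. simpl. split.
    + intros (a & Ha & ->). exists a. split; [now apply ult_k_H|]. split; auto.
      exists (G a). split; auto. split; [|apply EG; auto].
      apply pair_in_H; auto using ult_k_H.
    + intros (a & aH & Ha & y & yH & Hp & HPy). exists a. split; auto.
      apply pair_in_H in Hp; auto. apply EG in HPy; auto. now subst.
Qed.

Lemma ult_app f a : ult_fun k M f -> a ∈ k -> app f a ∈ M.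
Proof.
  intros [Hf Hfk] Ha. apply (elem_app Hr HE ult_empty f k); auto. now apply ult_k_sub.
Qed.

(** Equality and membership in the ultrapower are the special cases of atomic formulas. *)
Definition truth phi (e : nat -> U) : U :=
  {{ a in k | sat (H theta) (fun i => app (e i) a) phi }}.

Lemma truthE phi e a : a ∈ truth phi e <-> a ∈ k /\ sat (H theta) (fun i => app (e i) a) phi.
Proof. apply (sepE (fun a => sat (H theta) (fun i => app (e i) a) phi)). Qed.

Lemma truth_sub phi e : truth phi e ⊆ k.
Proof. intros a Ha. now apply truthE in Ha. Qed.

Lemma truth_in phi e : (forall i, ult_fun k M (e i)) -> truth phi e ∈ M.
Proof.
  intros He. destruct (dfn_values k theta Hr Hkt phi) as (P & HP & EP).
  replace (truth phi e) with {{ a in k | P (H theta) (scons a e) }}.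
  - apply ult_sep; auto. intros i. apply He.
  - apply ext. intros a. rewrite truthE, (sepE (fun a => P (H theta) (scons a e))).
    assert (E : a ∈ k -> P (H theta) (scons a e) <-> sat (H theta) (fun i => app (e i) a) phi).
    { intros Ha. apply EP; auto. intros i. split; [apply ult_H|]; apply He. }
    tauto.
Qed.

Definition true_F phi e := truth phi e ∈ F.

Lemma true_up phi e A B : (forall i, ult_fun k M (e i)) -> A ∈ F -> B ∈ F ->
  (forall a, a ∈ k -> a ∈ A -> a ∈ B -> sat (H theta) (fun i => app (e i) a) phi) ->
  true_F phi e.
Proof.
  intros He HA HB Hs. apply (ult_up A B); auto.
  - now apply truth_in.
  - apply truth_sub.
  - intros a Ha H1 H2. apply truthE. auto.
Qed.

Lemma true_mono phi psi e e' : (forall i, ult_fun k M (e' i)) -> true_F phi e ->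
  (forall a, a ∈ k -> sat (H theta) (fun i => app (e i) a) phi ->
     sat (H theta) (fun i => app (e' i) a) psi) ->
  true_F psi e'.
Proof.
  intros He H1 Hs. apply (true_up _ _ _ _ He H1 H1). intros a Ha H2 _.
  apply truthE in H2 as [_ H2]. auto.
Qed.

Lemma true_not phi e : (forall i, ult_fun k M (e i)) ->
  (true_F (fNot phi) e <-> ~ true_F phi e).
Proof.
  intros He. split.
  - intros H1 H2. destruct (ult_meet _ _ H1 H2) as (x & _ & Hx1 & Hx2).
    apply truthE in Hx1 as [_ Hx1], Hx2 as [_ Hx2]. now apply Hx1.
  - intros N. destruct (ult_measures _ (truth_in phi e He) (truth_sub phi e)) as [H1|H1]; [tauto|].
    apply (true_up _ _ _ _ He H1 H1). intros x Hx Hd _. apply diffE in Hd as [_ Hd].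
    intros Hs. apply Hd, truthE. auto.
Qed.

Lemma true_and phi psi e : (forall i, ult_fun k M (e i)) ->
  (true_F (fAnd phi psi) e <-> true_F phi e /\ true_F psi e).
Proof.
  intros He. split.
  - intros H1. split; apply (true_mono _ _ _ _ He H1); simpl; tauto.
  - intros [H1 H2]. apply (true_up _ _ _ _ He H1 H2).
    intros x Hx H3 H4. apply truthE in H3, H4. simpl. tauto.
Qed.

Lemma update_app e i f a :
  (fun n => app (update e i f n) a) = update (fun n => app (e n) a) i (app f a).
Proof.
  apply functional_extensionality. intros n. unfold update. now destruct (n =? i).
Qed.

(** In [H theta] such a function is obtained by choosing for each [a], and its defining
    property is first-order, so there is one in [M]. *)
Lemma counterexample i phi e : (forall n, ult_fun k M (e n)) ->
  exists f, ult_fun k M f /\ forall a, a ∈ k ->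
    sat (H theta) (fun n => app (e n) a) (fAll i phi) \/
    ~ sat (H theta) (update (fun n => app (e n) a) i (app f a)) phi.
Proof.
  intros He.
  destruct (dfn_values k theta Hr Hkt (fAll i phi)) as (P & HP & EP).
  destruct (dfn_values k theta Hr Hkt (fNot phi)) as (Q & HQ & EQ).
  (* [e 0] is the function sought, [e 1] is [k], and the rest are the given functions *)
  set (W := fun (K : U) (e : nat -> U) => fun_in K (e 0) (e 1) /\
    forall a, a ∈ K -> a ∈ e 1 -> P K (scons a (fun n => e (S (S n)))) \/
      Q K (scons a (update (fun n => e (S (S n))) i (e 0)))).
  assert (HW : Dfn W).
  { unfold W, fun_in, functional_in, pair_in. dfn.
    - apply (dfn_rename P (fun n => match n with 0 => 0 | S n => S (S (S n)) end)
        (fun e => scons (e 0) (fun n => e (S (S (S n)))))); auto. intros e' [|n]; reflexivity.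
    - apply (dfn_rename Q (fun n => match n with 0 => 0
        | S n => if n =? i then 1 else S (S (S n)) end)
        (fun e => scons (e 0) (update (fun n => e (S (S (S n)))) i (e 1)))); auto.
      intros e' [|n]; [reflexivity|]. simpl. unfold update. now destruct (n =? i). }
  assert (EW : forall f, f ∈ H theta -> (W (H theta) (scons f (scons k e)) <->
    fun_on f k /\ forall a, a ∈ k ->
      sat (H theta) (fun n => app (e n) a) (fAll i phi) \/
      ~ sat (H theta) (update (fun n => app (e n) a) i (app f a)) phi)).
  { intros f Hf. unfold W. cbn [scons]. rewrite fun_in_H by (auto; apply ult_H, ult_k_in).
    assert (He' : forall n, e n ∈ H theta /\ fun_on (e n) k).
    { intros n. split; [apply ult_H|]; apply He. }
    assert (Eq : fun_on f k -> forall a, a ∈ k ->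
      (P (H theta) (scons a e) \/ Q (H theta) (scons a (update e i f)) <->
       sat (H theta) (fun n => app (e n) a) (fAll i phi) \/
       ~ sat (H theta) (update (fun n => app (e n) a) i (app f a)) phi)).
    { intros Hfk a Ha.
      assert (Hu : forall n, update e i f n ∈ H theta /\ fun_on (update e i f n) k).
      { intros n. unfold update. destruct (n =? i); auto. }
      rewrite EP, EQ by auto. rewrite update_app. reflexivity. }
    split; intros [Hfk Ha]; split; auto.
    - intros a Hak. apply Eq; auto. apply Ha; auto. now apply ult_k_H.
    - intros a aH Hak. apply (Eq Hfk a Hak). auto. }
  destruct (elem_witness W M (H theta) (scons k e) HW HE) as (f & Hf & Wf).
  - intros [|n]; [apply ult_k_in|apply He].
  - set (wit := fun a => the (fun x => x ∈ H theta /\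
      ((exists y, y ∈ H theta /\ ~ sat (H theta) (update (fun n => app (e n) a) i y) phi) ->
       ~ sat (H theta) (update (fun n => app (e n) a) i x) phi))).
    assert (Hwit : forall a, wit a ∈ H theta /\
      ((exists y, y ∈ H theta /\ ~ sat (H theta) (update (fun n => app (e n) a) i y) phi) ->
       ~ sat (H theta) (update (fun n => app (e n) a) i (wit a)) phi)).
    { intros a. apply (the_spec (fun x => x ∈ H theta /\
      ((exists y, y ∈ H theta /\ ~ sat (H theta) (update (fun n => app (e n) a) i y) phi) ->
       ~ sat (H theta) (update (fun n => app (e n) a) i x) phi))).
      destruct (classic (exists y, y ∈ H theta /\ ~ sat (H theta) (update (fun n => app (e n) a) i y) phi))
        as [(y & Hy & Ny)|N].
      - exists y. auto.
      - exists k. split; [apply ult_H, ult_k_in|]. tauto. }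
    exists (lam k wit).
    assert (LH : lam k wit ∈ H theta).
    { apply H_lam; auto using ult_k_H; [now apply small_elem|]. intros a _. apply Hwit. }
    split; auto. apply EW; auto. split; [apply lam_fun_on|]. intros a Ha.
    destruct (classic (sat (H theta) (fun n => app (e n) a) (fAll i phi))) as [|N]; auto.
    right. rewrite app_lam by auto. apply Hwit. apply NNPP. intros N'. apply N.
    intros y Hy. apply NNPP. eauto.
  - exists f. apply EW in Wf as [Hfk Ha]; [|now apply ult_H]. split; auto. now split.
Qed.

(** The step of Los for quantifiers; the nontrivial direction uses [counterexample]. *)
Lemma true_all i phi e : (forall n, ult_fun k M (e n)) ->
  (true_F (fAll i phi) e <-> forall f, ult_fun k M f -> true_F phi (update e i f)).
Proof.
  intros He.
  assert (Hu : forall f, ult_fun k M f -> forall n, ult_fun k M (update e i f n)).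
  { intros f Hf n. unfold update. destruct (n =? i); auto. }
  split.
  - intros H1 f Hf. apply (true_mono _ _ _ _ (Hu f Hf) H1). intros a Ha H2.
    rewrite update_app. apply H2. apply ult_H. now apply ult_app.
  - intros Hall. destruct (counterexample i phi e He) as (f & Hf & Hc).
    apply (true_mono _ _ _ _ He (Hall f Hf)).
    intros a Ha H2. rewrite update_app in H2. destruct (Hc a Ha); tauto.
Qed.

(** ** The collapse of the ultrapower *)

Definition ult_rel g f :=
  ult_fun k M g /\ ult_fun k M f /\ {{ a in k | app g a ∈ app f a }} ∈ F.

Lemma ult_rel_wf : well_founded ult_rel.
Proof.
  intros f. apply NNPP. intros Nf.
  assert (Hf : ult_fun k M f).
  { apply NNPP. intros N. apply Nf. constructor. intros g (_ & Hf & _). tauto. }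
  set (S := {{ c in ultrapower k M F | exists g, ult_fun k M g /\ c = ult_class k M F g /\ ~ Acc ult_rel g }}).
  assert (ES := sepE (fun c => exists g, ult_fun k M g /\ c = ult_class k M F g /\ ~ Acc ult_rel g)
    (ultrapower k M F)). fold S in ES.
  assert (EU : forall g, ult_fun k M g -> ult_class k M F g ∈ ultrapower k M F).
  { intros g Hg. apply (comprE (fun c => exists f, ult_fun k M f /\ c = ult_class k M F f)); eauto.
    exists (img (ult_class k M F) M). intros x (h & Hh & ->). apply img_in, Hh. }
  destruct (Hwf S) as (c & Hc & Min).
  - intros z Hz. now apply ES in Hz.
  - exists (ult_class k M F f). apply ES. split; eauto.
  - apply ES in Hc as [_ (g & Hg & -> & Ng)].
    apply Ng. constructor. intros h Hh. apply NNPP. intros Nh.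
    assert (Hh' := Hh). destruct Hh' as (Hh1 & _ & Hh3).
    apply (Min (ult_class k M F h)).
    + apply ES. split; eauto.
    + exists h, g. auto.
Qed.

(** The Mostowski collapse, defined on functions rather than on their classes. *)
Definition collapse : U -> U :=
  wfrec ult_rel_wf (fun f pi => img pi {{ g in M | ult_rel g f }}).

Lemma collapseE f x : x ∈ collapse f <-> exists g, ult_rel g f /\ x = collapse g.
Proof.
  unfold collapse at 1. rewrite wfrec_eq, imgE.
  assert (E := sepE (fun g => ult_rel g f) M). split.
  - intros (g & Hg & ->). apply E in Hg as [_ Hg]. exists g. split; auto.
    destruct (excluded_middle_informative (ult_rel g f)); tauto.
  - intros (g & Hg & ->). exists g. split; [apply E; split; auto; apply Hg|].
    destruct (excluded_middle_informative (ult_rel g f)); tauto.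
Qed.

Definition two f g : nat -> U := fun i => match i with 0 => f | _ => g end.

Lemma two_fun f g : ult_fun k M f -> ult_fun k M g -> forall i, ult_fun k M (two f g i).
Proof. intros Hf Hg [|i]; auto. Qed.

Lemma ult_relE g f : ult_fun k M g -> ult_fun k M f ->
  (ult_rel g f <-> true_F (fMem 0 1) (two g f)).
Proof. intros Hg Hf. split; [intros H1; apply H1|]. intros H1. split; auto. Qed.

Definition ult_eq f g := true_F (fEq 0 1) (two f g).

Lemma ult_eq_sym f g : ult_fun k M f -> ult_fun k M g -> ult_eq f g -> ult_eq g f.
Proof.
  intros Hf Hg E. apply (true_mono _ _ _ _ (two_fun g f Hg Hf) E). simpl. auto.
Qed.

Lemma ult_rel_eq f g h h' : ult_fun k M g -> ult_fun k M h' -> ult_rel h f -> ult_eq f g -> ult_eq h h' ->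
  ult_rel h' g.
Proof.
  intros Hg Hh' Hhf E E'. assert (HF := proj1 (proj2 Hhf)). assert (HH := proj1 Hhf).
  apply ult_relE in Hhf; auto. apply ult_relE; auto.
  assert (T : true_F (fAnd (fMem 0 1) (fAnd (fEq 1 2) (fEq 0 3)))
     (fun i => match i with 0 => h | 1 => f | 2 => g | _ => h' end)).
  { assert (He : forall i, ult_fun k M (match i with 0 => h | 1 => f | 2 => g | _ => h' end)).
    { intros [|[|[|i]]]; auto. }
    apply true_and; auto. split; [exact Hhf|]. apply true_and; auto. }
  apply (true_mono _ _ _ _ (two_fun h' g Hh' Hg) T). simpl.
  intros x Hx (H1 & <- & <-). exact H1.
Qed.

Lemma ult_eq_refl f : ult_fun k M f -> ult_eq f f.
Proof.
  intros Hf. apply (true_up _ _ k k); auto using ult_k_F, two_fun. reflexivity.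
Qed.

(** Functions that differ almost everywhere are told apart by a function that almost
    everywhere picks an element of the symmetric difference. *)
Lemma ult_differ f g : ult_fun k M f -> ult_fun k M g -> ~ ult_eq f g ->
  exists h, ult_fun k M h /\ ~ (ult_rel h f <-> ult_rel h g).
Proof.
  intros Hf Hg N.
  set (imp := fun p q => fNot (fAnd p (fNot q))).
  set (phi := fAnd (imp (fMem 2 0) (fMem 2 1)) (imp (fMem 2 1) (fMem 2 0))).
  assert (H1 : ~ true_F (fAll 2 phi) (two f g)).
  { intros T. apply N. apply (true_mono _ _ _ _ (two_fun f g Hf Hg) T).
    intros a Ha H1. simpl. apply ext. intros z.
    assert (fH : app f a ∈ H theta) by (apply ult_H, ult_app; auto).
    assert (gH : app g a ∈ H theta) by (apply ult_H, ult_app; auto).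
    split; intros Hz; apply NNPP; intros Nz.
    - assert (zH : z ∈ H theta) by now apply (H_trans Hr (app f a)).
      apply (proj1 (H1 z zH)). auto.
    - assert (zH : z ∈ H theta) by now apply (H_trans Hr (app g a)).
      apply (proj2 (H1 z zH)). auto. }
  apply NNPP. intros N'. apply H1. apply true_all; [now apply two_fun|].
  intros h Hh. assert (E : ult_rel h f <-> ult_rel h g) by (apply NNPP; eauto).
  assert (He : forall n, ult_fun k M (update (two f g) 2 h n)).
  { intros n. unfold update. destruct (n =? 2); auto. now apply two_fun. }
  rewrite (ult_relE h f), (ult_relE h g) in E by auto.
  change (true_F (fMem 2 0) (update (two f g) 2 h) <->
          true_F (fMem 2 1) (update (two f g) 2 h)) in E.
  unfold phi, imp. apply true_and; auto. split; apply true_not; auto;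
    rewrite true_and, true_not by auto; tauto.
Qed.

(** By induction on [f]: a function that tells [f] and [g] apart would also do so in the
    collapse. *)
Lemma collapse_eq f g : ult_fun k M f -> ult_fun k M g ->
  (collapse f = collapse g <-> ult_eq f g).
Proof.
  revert g. induction f as [f IH] using (well_founded_induction ult_rel_wf).
  intros g Hf Hg. split.
  - intros E. apply NNPP. intros N. destruct (ult_differ f g Hf Hg N) as (h & Hh & Nh).
    apply Nh. split; intros R.
    + assert (Hc : collapse h ∈ collapse g) by (rewrite <- E; apply collapseE; eauto).
      apply collapseE in Hc as (h' & R' & E'). assert (Hh' := proj1 R').
      apply IH in E'; auto. apply (ult_rel_eq g g h' h); auto using ult_eq_refl, ult_eq_sym.
    + assert (Hc : collapse h ∈ collapse f) by (rewrite E; apply collapseE; eauto).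
      apply collapseE in Hc as (h' & R' & E'). assert (Hh' := proj1 R'). symmetry in E'.
      apply IH in E'; auto. apply (ult_rel_eq f f h' h); auto using ult_eq_refl.
  - intros E. apply ext. intros x. rewrite !collapseE.
    split; intros (h & R & ->); exists h; split; auto; assert (Hh := proj1 R).
    + apply (ult_rel_eq f g h h); auto using ult_eq_refl.
    + apply (ult_rel_eq g f h h); auto using ult_eq_refl, ult_eq_sym.
Qed.

Lemma collapse_mem f g : ult_fun k M f -> ult_fun k M g ->
  (collapse f ∈ collapse g <-> ult_rel f g).
Proof.
  intros Hf Hg. rewrite collapseE. split; [|eauto].
  intros (h & R & E). assert (Hh := proj1 R). apply collapse_eq in E; auto.
  apply (ult_rel_eq g g h f); auto using ult_eq_refl, ult_eq_sym.
Qed.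

Definition ult_model : U := img collapse {{ f in M | ult_fun k M f }}.

Lemma ult_modelE x : x ∈ ult_model <-> exists f, ult_fun k M f /\ x = collapse f.
Proof.
  unfold ult_model. rewrite imgE. assert (E := sepE (fun f => ult_fun k M f) M). split.
  - intros (f & Hf & ->). apply E in Hf as [_ Hf]. eauto.
  - intros (f & Hf & ->). exists f. split; auto. apply E. split; auto. apply Hf.
Qed.

Lemma los phi : forall e, (forall n, ult_fun k M (e n)) ->
  (sat ult_model (fun n => collapse (e n)) phi <-> true_F phi e).
Proof.
  induction phi as [i j|i j|p IH|p IHp q IHq|i p IH]; intros e He.
  - simpl. rewrite collapse_mem by auto. now apply ult_relE.
  - simpl. now apply collapse_eq.
  - rewrite true_not by auto. simpl. now rewrite IH.
  - rewrite true_and by auto. simpl. now rewrite IHp, IHq.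
  - rewrite true_all by auto. simpl.
    assert (E : forall f, ult_fun k M f ->
      (sat ult_model (update (fun n => collapse (e n)) i (collapse f)) p <-> true_F p (update e i f))).
    { intros f Hf. rewrite <- IH.
      - apply sat_ext. intros n _. unfold update. now destruct (n =? i).
      - intros n. unfold update. destruct (n =? i); auto. }
    split.
    + intros Hx f Hf. apply E; auto. apply Hx, ult_modelE. eauto.
    + intros Hx x Hxm. apply ult_modelE in Hxm as (f & Hf & ->). apply E; auto.
Qed.

(** ** The embedding *)

Definition const x : U := lam k (fun _ => x).

Lemma const_fun x : x ∈ M -> ult_fun k M (const x).
Proof.
  intros Hx. apply (ult_lam (fun _ => x) (fun K e => e 0 = e 2) (fun _ => x)).
  - dfn.
  - intros n. exact Hx.
  - intros a _. now apply ult_H.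
  - intros a y _ _. reflexivity.
Qed.

Definition ult_map : U := lam M (fun x => collapse (const x)).

Lemma ult_map_app x : x ∈ M -> app ult_map x = collapse (const x).
Proof. intros Hx. unfold ult_map. now rewrite app_lam. Qed.

Lemma ult_map_elementary : elem_embedding ult_map M ult_model.
Proof.
  split.
  - apply lam_fun_to. intros x Hx. apply ult_modelE. eauto using const_fun.
  - intros phi e He.
    assert (Hc : forall n, ult_fun k M (const (e n))) by (intros n; apply const_fun, He).
    rewrite (sat_ext ult_model phi _ (fun n => collapse (const (e n))))
      by (intros n _; apply ult_map_app, He).
    rewrite los by auto.
    rewrite (proj2 HE phi e He).
    assert (E : forall a, a ∈ k ->
      (sat (H theta) e phi <-> sat (H theta) (fun n => app (const (e n)) a) phi)).
    { intros a Ha. apply sat_ext. intros n _. unfold const. now rewrite app_lam. }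
    split.
    + intros Hs. apply (true_up _ _ k k); auto using ult_k_F.
      intros a Ha _ _. now apply E.
    + intros T. destruct (ult_meet _ _ T T) as (a & Ha & H1 & _).
      apply truthE in H1 as [_ H1]. now apply (E a).
Qed.

Lemma ult_rel_intro g f A B : ult_fun k M g -> ult_fun k M f -> A ∈ F -> B ∈ F ->
  (forall a, a ∈ k -> a ∈ A -> a ∈ B -> app g a ∈ app f a) -> ult_rel g f.
Proof.
  intros Hg Hf HA HB Hlt. apply ult_relE; auto.
  apply (true_up _ _ A B); auto using two_fun.
Qed.

Lemma ult_rel_elim g f A : ult_rel g f -> A ∈ F ->
  exists a, a ∈ k /\ a ∈ A /\ app g a ∈ app f a.
Proof.
  intros (_ & _ & HR) HA. destruct (ult_meet _ _ HR HA) as (a & Ha & H1 & H2).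
  apply (sepE (fun a => app g a ∈ app f a)) in H1. exists a. tauto.
Qed.

Lemma ident_fun : ult_fun k M (lam k (fun a => a)).
Proof.
  apply (ult_lam (fun a => a) (fun K e => e 0 = e 1) (fun _ => k)).
  - dfn.
  - intros n. apply ult_k_in.
  - apply ult_k_H.
  - intros a y _ _. reflexivity.
Qed.

Lemma ult_lam_set (G : U -> U) P e : Dfn P -> env_in M e ->
  (forall a, a ∈ k -> G a ∈ H theta) ->
  (forall a z, a ∈ k -> z ∈ H theta -> (z ∈ G a <-> P (H theta) (scons z (scons a e)))) ->
  ult_fun k M (lam k G).
Proof.
  intros HP He HG EG.
  apply (ult_lam G (fun K e => forall z, z ∈ K ->
    (z ∈ e 0 <-> P K (scons z (fun n => e (S n))))) e); auto.
  - dfn. apply (dfn_rename P (fun n => match n with 0 => 0 | S n => S (S n) end)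
      (fun e => scons (e 0) (fun n => e (S (S n))))); auto. intros e' [|n]; reflexivity.
  - intros a y Ha yH. split.
    + intros -> z zH. now apply EG.
    + intros E. apply ext. intros z. split; intros Hz.
      * assert (zH : z ∈ H theta) by now apply (H_trans Hr y).
        apply EG; auto. now apply E.
      * assert (zH : z ∈ H theta) by (apply (H_trans Hr (G a)); auto).
        apply E; auto. now apply (EG a).
Qed.

(** Otherwise the sets where [g] avoids a given value are in the filter, and so is their
    diagonal intersection; but there [g] is not regressive. *)
Lemma regressive g : ult_fun k M g -> {{ a in k | app g a ∈ a }} ∈ F ->
  exists b, b ∈ k /\ ult_eq g (const b).
Proof.
  intros Hg HR. apply NNPP. intros N.
  set (X := fun b => {{ a in k | app g a <> b }}).
  assert (EX : forall b a, a ∈ X b <-> a ∈ k /\ app g a <> b).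
  { intros b a. apply (sepE (fun a => app g a <> b)). }
  assert (kH : k ∈ H theta) by (apply ult_H, ult_k_in).
  assert (gH : g ∈ H theta) by (apply ult_H, Hg).
  assert (XF : ult_fun k M (lam k X)).
  { apply (ult_lam_set X (fun K e => e 0 ∈ e 2 /\ exists y, y ∈ K /\ (rel_in K (e 3) (e 0) y /\ y <> e 1))
      (ev [k; g])).
    - dfn.
    - apply ev_in; [apply ult_empty|]. repeat constructor; auto using ult_k_in. apply Hg.
    - intros a _. apply (H_sub Hr k); auto. intros z Hz. now apply EX in Hz.
    - intros b a Hb aH. rewrite EX. unfold ev; simpl.
      assert (V := fun Ha => ex_value_H Hr g k a (fun y => y <> b) gH (proj2 Hg) Ha). tauto. }
  assert (D := proj2 (proj2 HN) (lam k X) (proj1 XF) (proj2 XF)).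
  assert (HX : forall b, b ∈ k -> app (lam k X) b ∈ F).
  { intros b Hb. rewrite app_lam by auto.
    assert (Nb : true_F (fNot (fEq 0 1)) (two g (const b))).
    { apply true_not; [apply two_fun; auto; now apply const_fun, ult_k_sub|]. intros E. eauto. }
    replace (X b) with (truth (fNot (fEq 0 1)) (two g (const b))); auto.
    apply ext. intros a. rewrite truthE, EX. simpl. unfold const.
    split; intros [Ha Hne]; split; auto; [rewrite app_lam in Hne|rewrite app_lam]; auto. }
  specialize (D HX). destruct (ult_meet _ _ HR D) as (a & Ha & H1 & H2).
  apply (sepE (fun a => app g a ∈ a)) in H1 as [_ H1].
  apply (sepE (fun a => forall b, b ∈ a -> a ∈ app (lam k X) b)) in H2 as [_ H2].
  assert (Hga : app g a ∈ k) by (apply (ord_trans k a); auto; now apply regular_ord).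
  specialize (H2 _ H1). rewrite app_lam in H2 by auto. apply EX in H2 as [_ H2]. auto.
Qed.

Lemma regressive_in g : ult_rel g (lam k (fun a => a)) ->
  exists b, b ∈ k /\ ult_eq g (const b).
Proof.
  intros HR. assert (Hg := proj1 HR). apply regressive; auto.
  destruct HR as (_ & _ & HR).
  replace {{ a in k | app g a ∈ a }} with {{ a in k | app g a ∈ app (lam k (fun a => a)) a }}; auto.
  apply ext. intros a. rewrite (sepE (fun a => app g a ∈ app (lam k (fun a => a)) a)),
    (sepE (fun a => app g a ∈ a)).
  split; intros [Ha H1]; split; auto; [rewrite app_lam in H1|rewrite app_lam]; auto.
Qed.

Lemma const_rel b f A : b ∈ M -> ult_fun k M f -> A ∈ F ->
  (forall a, a ∈ k -> a ∈ A -> b ∈ app f a) -> ult_rel (const b) f.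
Proof.
  intros Hb Hf HA Hlt. apply (ult_rel_intro _ _ A A); auto using const_fun.
  intros a Ha H1 _. unfold const. rewrite app_lam; auto.
Qed.

Lemma const_rel_elim b f A : ult_rel (const b) f -> A ∈ F ->
  exists a, a ∈ k /\ a ∈ A /\ b ∈ app f a.
Proof.
  intros HR HA. destruct (ult_rel_elim _ _ A HR HA) as (a & Ha & H1 & H2).
  exists a. split; auto. split; auto. unfold const in H2. now rewrite app_lam in H2.
Qed.

Lemma tail_above b a : b ∈ k -> a ∈ k -> a ∈ diff k (succ b) -> b ∈ a.
Proof.
  intros Hb Ha H1. apply diffE in H1 as [_ H1]. rewrite succE in H1.
  assert (Ok := regular_ord k Hk).
  destruct (ord_total b a (ord_in k b Ok Hb) (ord_in k a Ok Ha)) as [|[E|E]]; auto; exfalso; auto.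
Qed.

Lemma const_below g b : b ∈ k -> ult_rel g (const b) ->
  exists c, c ∈ b /\ ult_eq g (const c).
Proof.
  intros Hb HR. assert (Hg := proj1 HR).
  assert (HbM := ult_k_sub b Hb). assert (Ok := regular_ord k Hk).
  destruct (regressive_in g) as (c & Hc & E).
  { apply (ult_rel_intro g _ (truth (fMem 0 1) (two g (const b))) (diff k b));
      auto using ident_fun, ult_tail.
    - now apply ult_relE in HR; auto using const_fun.
    - intros a Ha H1 H2. rewrite app_lam by auto. apply truthE in H1 as [_ H1].
      simpl in H1. unfold const in H1. rewrite app_lam in H1 by auto.
      apply diffE in H2 as [_ H2].
      apply (ord_nsub a b (ord_in k a Ok Ha) (ord_in k b Ok Hb) H2). exact H1. }
  exists c. split; auto.
  destruct (ult_rel_elim _ _ _ HR E) as (a & Ha & H1 & H2).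
  apply truthE in H1 as [_ H1]. simpl in H1. unfold const in H1, H2.
  rewrite app_lam in H1, H2 by auto. now rewrite <- H1.
Qed.

(** By induction on [b]: a function with values in [b] is regressive on a final segment of
    [k], hence almost everywhere constant. *)
Lemma collapse_const b : b ∈ k -> collapse (const b) = b.
Proof.
  induction b as [b IH] using (well_founded_induction mem_wf). intros Hb.
  assert (Hsub : forall c, c ∈ b -> c ∈ k).
  { intros c Hc. apply (ord_trans k b); auto. now apply regular_ord. }
  apply ext. intros x. rewrite collapseE. split.
  - intros (g & HR & ->). assert (Hg := proj1 HR).
    destruct (const_below g b Hb HR) as (c & Hc & E).
    apply collapse_eq in E; auto using const_fun, ult_k_sub. rewrite E, IH; auto.
  - intros Hx. exists (const x). split; [|now rewrite IH; auto].
    apply (const_rel x _ k); auto using const_fun, ult_k_sub, ult_k_F.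
    intros a Ha _. unfold const. now rewrite app_lam.
Qed.

(** Every function that belongs almost everywhere to [f] is regressive, hence almost
    everywhere constant. *)
Lemma collapse_bounded f : ult_fun k M f -> (forall a, a ∈ k -> app f a ⊆ a) ->
  forall x, x ∈ collapse f <-> x ∈ k /\ ult_rel (const x) f.
Proof.
  intros Hf Hs x. rewrite collapseE. split.
  - intros (g & HR & ->). assert (Hg := proj1 HR).
    destruct (regressive_in g) as (c & Hc & E).
    { apply (ult_rel_intro g _ (truth (fMem 0 1) (two g f)) k); auto using ident_fun, ult_k_F.
      - now apply ult_relE in HR.
      - intros a Ha H1 _. apply truthE in H1 as [_ H1]. rewrite app_lam by auto.
        now apply (Hs a Ha). }
    assert (HcM := const_fun c (ult_k_sub c Hc)).
    assert (Ec : collapse g = c).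
    { apply collapse_eq in E; auto. rewrite E. now apply collapse_const. }
    rewrite Ec. split; auto. apply (ult_rel_eq f f g); auto using ult_eq_refl.
  - intros [Hx HR]. exists (const x). split; auto. symmetry. now apply collapse_const.
Qed.

Lemma collapse_ident : collapse (lam k (fun a => a)) = k.
Proof.
  apply ext. intros x. rewrite collapse_bounded; [|apply ident_fun|].
  - split; [tauto|]. intros Hx. split; auto.
    apply (const_rel x _ (diff k (succ x))); auto using ident_fun, ult_k_sub.
    + apply ult_tail. now apply regular_succ.
    + intros a Ha H1. rewrite app_lam by auto. now apply tail_above.
  - intros a Ha. rewrite app_lam by auto. auto.
Qed.

(** The identity represents [k], and almost everywhere it belongs to the constant
    function with value [k]. *)
Lemma ult_map_critical : critical_point ult_map M k.
Proof.
  split; [now apply regular_ord|]. split; [apply ult_k_in|]. split.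
  - rewrite ult_map_app by apply ult_k_in. intros E.
    assert (H1 : ult_rel (lam k (fun a => a)) (const k)).
    { apply (ult_rel_intro _ _ k k); auto using ident_fun, const_fun, ult_k_in, ult_k_F.
      intros a Ha _ _. unfold const. now rewrite !app_lam. }
    apply collapse_mem in H1; auto using ident_fun, const_fun, ult_k_in.
    rewrite E, collapse_ident in H1. now apply no_self in H1.
  - intros a Ha Hak. rewrite ult_map_app by auto. now apply collapse_const.
Qed.

Lemma ult_map_powerset : powerset_preserving k ult_map M ult_model.
Proof.
  assert (kH : k ∈ H theta) by (apply ult_H, ult_k_in).
  split; [exact ult_map_critical|]. split.
  - apply ext. intros A. rewrite !capE, powE. split; intros [HA H1]; split; auto.
    + (* [A] is represented by the function that maps [a] to the intersection of [A] and [a] *)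
      assert (AH := ult_H A H1).
      assert (Hf : ult_fun k M (lam k (fun a => cap A a))).
      { apply (ult_lam_set (cap A) (fun K e => e 0 ∈ e 2 /\ e 0 ∈ e 1) (fun _ => A)).
        - dfn.
        - intros n. exact H1.
        - intros a _. apply (H_sub Hr A); auto. intros z Hz. now apply capE in Hz.
        - intros a z _ _. apply capE. }
      apply ult_modelE. exists (lam k (fun a => cap A a)). split; auto.
      apply ext. intros x. rewrite collapse_bounded; auto.
      * split.
        { intros Hx. split; auto. apply (const_rel x _ (diff k (succ x))); auto.
          - now apply ult_k_sub, HA.
          - apply ult_tail, regular_succ; auto.
          - intros a Ha H2. rewrite app_lam by auto. apply capE. split; auto.
            apply tail_above; auto. }
        { intros [Hx HR]. destruct (const_rel_elim x _ k HR ult_k_F) as (a & Ha & _ & H2).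
          rewrite app_lam in H2 by auto. now apply capE in H2. }
      * intros a Ha. rewrite app_lam by auto. intros z Hz. now apply capE in Hz.
    + (* weak amenability collects the [b] that almost all values contain *)
      apply ult_modelE in H1 as (f & Hf & ->).
      assert (fH : f ∈ H theta) by apply ult_H, Hf.
      set (Y := fun b => {{ a in k | b ∈ app f a }}).
      assert (EY : forall b a, a ∈ Y b <-> a ∈ k /\ b ∈ app f a).
      { intros b a. apply (sepE (fun a => b ∈ app f a)). }
      assert (HY : ult_fun k M (lam k Y)).
      { apply (ult_lam_set Y (fun K e => e 0 ∈ e 2 /\
            exists y, y ∈ K /\ (rel_in K (e 3) (e 0) y /\ e 1 ∈ y)) (ev [k; f])).
        - dfn.
        - apply ev_in; [apply ult_empty|]. repeat constructor; auto using ult_k_in. apply Hf.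
        - intros a _. apply (H_sub Hr k); auto. intros z Hz. now apply EY in Hz.
        - intros b a Hb aH. rewrite EY. unfold ev; simpl.
          assert (V := fun Ha => ex_value_H Hr f k a (fun y => b ∈ y) fH (proj2 Hf) Ha). tauto. }
      assert (HB := Ham (lam k Y) (proj1 HY) (proj2 HY)).
      assert (EB := sepE (fun b => app (lam k Y) b ∈ F) k).
      set (B := {{ b in k | app (lam k Y) b ∈ F }}) in *.
      replace (collapse f) with B.
      * apply HB. intros b Hb. rewrite app_lam by auto. intros z Hz. now apply EY in Hz.
      * apply ext. intros b. rewrite EB.
        assert (E : b ∈ k -> (app (lam k Y) b ∈ F <-> b ∈ collapse f)).
        { intros Hb. assert (HbM := const_fun b (ult_k_sub b Hb)).
          rewrite <- (collapse_const b Hb) at 2. rewrite collapse_mem by auto.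
          rewrite app_lam by auto.
          assert (EYb : Y b = {{ a in k | app (const b) a ∈ app f a }}).
          { apply ext. intros a. rewrite EY, (sepE (fun a => app (const b) a ∈ app f a)).
            unfold const. split; intros [Ha H2]; split; auto;
              [rewrite app_lam|rewrite app_lam in H2]; auto. }
          rewrite EYb. unfold ult_rel. tauto. }
        split; [intros [Hb H2]; now apply E|]. intros H2. assert (Hb := HA b H2).
        split; auto. now apply E.
  - intros x Hx Hs z Hz. apply Hs; auto. apply ult_modelE in Hx as (f & Hf & ->).
    apply collapseE in Hz as (g & HR & ->). apply ult_modelE. exists g. split; auto. apply HR.
Qed.

End Ultrapower.

(** * The well-founded filter property implies omega-Ramsey *)

Section Backward.
Context {U : ZFC}.
Implicit Types (a b c d x y z A B C : U).
Context (k : U) (Hk : regular k) (Hom : omega ∈ k) (Hlt : k = lt_power k).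

(** A formula has finitely many variables, so the relevant part of an environment lies in
    one of the models. *)
Lemma chain_elem (f : U -> U) (N : U) : (forall n, elem_sub (f (num n)) N) ->
  (forall m n, m <= n -> f (num m) ⊆ f (num n)) -> elem_sub (fam omega f) N.
Proof.
  intros Hf Mon.
  assert (HM := fam_omegaE f).
  apply tarski_vaught.
  - intros x Hx. apply HM in Hx as [n Hx]. now apply (Hf n).
  - intros p e i He Hx.
    assert (Hn : forall m, exists n, forall l, l < m -> e l ∈ f (num n)).
    { induction m as [|m [n IH]]; [exists 0; lia|].
      destruct (proj1 (HM (e m)) (He m)) as [n' Hn']. exists (max n n'). intros l Hl.
      destruct (Nat.eq_dec l m) as [->|].
      - apply (Mon n'); auto. lia.
      - apply (Mon n); [lia|]. apply IH. lia. }
    destruct (Hn (S (var_bound p))) as [n Hn'].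
    set (e' := fun l => if l <? var_bound p then e l else e 0).
    assert (Ee : forall x, sat N (update e' i x) p <-> sat N (update e i x) p).
    { intros x. apply sat_ext. intros l Hl. unfold update, e'. destruct (l =? i); auto.
      destruct (Nat.ltb_spec l (var_bound p)); auto. lia. }
    assert (He' : env_in (f (num n)) e').
    { intros l. unfold e'. destruct (Nat.ltb_spec l (var_bound p)); apply Hn'; lia. }
    assert (D := @dfn_ex_var U _ i (dfn_sat p)).
    assert (W : exists x, x ∈ f (num n) /\ sat (f (num n)) (update e' i x) p).
    { apply (elem_dfn _ _ _ e' D (Hf n)); auto. destruct Hx as (x & Hx & Hp).
      exists x. split; auto. now apply Ee. }
    destruct W as (x & Hx' & Hp). exists x. split; [apply HM; eauto|].
    apply Ee. apply (proj2 (Hf n)); auto.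
    intros l. unfold update. destruct (l =? i); auto.
Qed.

(** The union of the models in a run won by the judge is the domain of the embedding. The
    rule that the trace of each filter be an element of the next model becomes weak
    amenability. *)
Lemma filter_property_embedding theta A : regular theta -> k ∈ theta -> A ⊆ k ->
  (~ exists sigma, challenger_winning k theta omega sigma) ->
  exists M, weak_model k M /\ elem_sub M (H theta) /\ A ∈ M /\
  exists N j, elem_embedding j M N /\ powerset_preserving k j M N.
Proof.
  intros Hr Hkt HA NW.
  destruct (winning_run k theta Hk Hr Hkt Hom Hlt A HA NW)
    as (f & g & sigma & HS & HA0 & HN & Hwf).
  assert (Mon := stage_mono k theta sigma f g HS).
  set (M := fam omega f) in *. set (F := fam omega g) in *.
  assert (HM : forall x, x ∈ M <-> exists n, x ∈ f (num n)) by apply fam_omegaE.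
  assert (HF : forall x, x ∈ F <-> exists n, x ∈ g (num n)) by apply fam_omegaE.
  assert (Wk : forall n, weak_model k (f (num n))) by (intros n; apply (HS n)).
  assert (El : forall n, elem_sub (f (num n)) (H theta)) by (intros n; apply (HS n)).
  assert (HE : elem_sub M (H theta)).
  { apply chain_elem; auto. intros m n Hmn. now apply Mon. }
  assert (kM : k ⊆ M).
  { intros z Hz. apply HM. exists 0. now apply Wk. }
  assert (Hw : weak_model k M).
  { split; [|split; [|split]]; auto.
    - apply card_eq; [now apply regular_cardinal| |now apply inj_le_sub].
      apply fam_le.
      + now apply k_square.
      + now apply elem_le_k.
      + intros x Hx. apply omegaE in Hx as [n ->].
        rewrite <- (proj1 (Wk n)). apply le_card.
    - apply HM. exists 0. apply Wk.
    - apply (elem_ZFCminus Hr); auto.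
      + apply (ord_trans theta k); auto. now apply regular_ord.
      + apply kM, (regular_num k 0 Hk). }
  exists M. split; auto. split; auto. split; [apply HM; eauto|].
  (* the trace of the filter on the [n]-th model is an element of the next model *)
  assert (Ham : forall Y, Y ∈ M -> fun_on Y k -> (forall b, b ∈ k -> app Y b ⊆ k) ->
     {{ b in k | app Y b ∈ F }} ∈ M).
  { intros Y HY HYk HYs. apply HM in HY as [n HYn].
    set (f1 := f (num (S n))). set (G := cap (g (num n)) (f (num n))).
    assert (E1 := El (S n)). fold f1 in E1.
    assert (n_in : (num n : U) ∈ num (S n)) by (apply succE; auto).
    assert (k1 : k ⊆ f1) by apply (Wk (S n)). assert (k1' : k ∈ f1) by apply (Wk (S n)).
    assert (H01 : empty ∈ f1) by apply k1, (regular_num k 0 Hk).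
    assert (HG : G ∈ f1).
    { destruct (HS (S n)) as ((_ & _ & _ & _ & HT) & _). fold f1 in HT.
      set (T := lam (num (S n)) (fun e => cap (app (lam (num (S n)) g) e) (app (lam (num (S n)) f) e))) in HT.
      replace G with (app T (num n)).
      - apply (elem_app Hr E1 H01 T (num (S n))); auto; [apply lam_fun_on|].
        apply k1. now apply regular_num.
      - unfold T. rewrite !app_lam; auto. }
    assert (Y1 : Y ∈ f1) by (apply (Mon n (S n)); auto).
    assert (In : forall b, b ∈ k -> (app Y b ∈ F <-> app Y b ∈ G)).
    { intros b Hb. unfold G. rewrite capE.
      assert (YM : app Y b ∈ f (num n)).
      { apply (elem_app Hr (El n)) with (d := k); auto.
        - apply (Wk n), (regular_num k 0 Hk).
        - now apply (Wk n). }
      split; [|intros [H1 _]; apply HF; eauto].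
      intros H1. split; auto. destruct (HS n) as (_ & (_ & Me & _) & _).
      assert (Hc : app Y b ∈ cap (pow k) (f (num n))).
      { apply capE. split; auto. apply powE. exact (HYs b Hb). }
      destruct (Me (app Y b) Hc) as [|H2]; auto. exfalso.
      assert (H3 : diff k (app Y b) ∈ F) by (apply HF; eauto).
      destruct (filter_meet k F _ _ _ Hk (proj1 HN) H1 H3 H3) as (x & _ & H4 & H5 & _).
      apply diffE in H5. tauto. }
    apply HM. exists (S n). fold f1.
    assert (YH : Y ∈ H theta) by now apply E1. assert (kH : k ∈ H theta) by now apply E1.
    assert (EB := sepE (fun b => app Y b ∈ F) k).
    apply (elem_set Hr E1 H01 (fun K e => e 0 ∈ e 1 /\
      exists y, y ∈ K /\ (rel_in K (e 2) (e 0) y /\ y ∈ e 3)) [k; Y; G]).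
    - dfn.
    - auto.
    - apply (H_sub Hr k); auto. intros z Hz. now apply EB in Hz.
    - intros b bH. rewrite EB. unfold ev; simpl.
      assert (V := fun Hb => ex_value_H Hr Y k b (fun y => y ∈ G) YH HYk Hb).
      assert (I := In b). tauto. }
  exists (ult_model k M F Hwf), (ult_map k M F Hwf). split.
  - now apply (ult_map_elementary k theta Hk Hr Hkt M F Hw HE HN Hwf).
  - now apply (ult_map_powerset k theta Hk Hr Hkt M F Hw HE HN Hwf Ham).
Qed.

Lemma filter_property_ramsey : wf_filter_property omega k -> omega_Ramsey k.
Proof.
  intros HW l Ol.
  assert (Ok := regular_ord k Hk).
  assert (B : exists theta, l ∈ theta /\ k ∈ theta /\ regular theta).
  { destruct (ord_total l k Ol Ok) as [E|[E|E]].
    - destruct (regular_above k Ok) as (t & Ht & Rt). exists t. split; auto.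
      apply (ord_trans t k); auto. now apply regular_ord.
    - destruct (regular_above k Ok) as (t & Ht & Rt). exists t. subst. auto.
    - destruct (regular_above l Ol) as (t & Ht & Rt). exists t. split; auto. split; auto.
      apply (ord_trans t l); auto. now apply regular_ord. }
  destruct B as (theta & Hl & Hkt & Hr). exists theta. split; auto. split; auto.
  intros A HA. apply filter_property_embedding; auto.
Qed.

End Backward.

Theorem corollary5p8 (U : ZFC) (kappa : U) (hkappa : regular kappa) :
  omega_Ramsey kappa <->
  (uncountable kappa /\ kappa = lt_power kappa /\
   wf_filter_property omega kappa).
Proof.
  assert (E : card kappa = kappa).
  { apply card_eq; auto using regular_cardinal, inj_le_refl. }
  unfold uncountable. rewrite E. split.
  - intros HR. split; [|split].
    + now apply ramsey_uncountable.
    + now apply ramsey_lt_power.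
    + now apply ramsey_filter_property.
  - intros (Hom & Hlt & HW). now apply filter_property_ramsey.
Qed.
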